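(* Let $d\ge2$. Let $\Omega\subset\mathbb{R}^d_+$ be open and bounded with Lipschitz boundary, and let $f:\mathbb{R}^d\to[0,\infty)$ be a probability density such that there is a continuous nondecreasing $m:[0,\infty)\to[0,\infty)$ with $m(0)=0$ and $|f(x)-f(y)|\le m(|x-y|)$ for $x,y\in\Omega$, and $f(x)=0$ for $x\notin\Omega$. Let $X_1,X_2,\dots$ be i.i.d. with density $f$. Then for every $z\in\mathbb{R}^d$, \[\limsup_{n\to\infty}n^{-1/d}u_n(z)\le c_dU(z)\quad\text{almost surely.}\]
   Context: $x\leqq y$ means $x_i\le y_i$ for all $i$; $\mathbb{R}^d_+=\{x:x_i>0\ \forall i\}$. $u_n(x)$ is the length of a longest chain (subset totally ordered by $\leqq$) in $\{X_i: 1\le i\le n,\ X_i\leqq x\}$. $\mathcal{A}$ is the set of $\gamma\in C^1([0,1];\mathbb{R}^d)$ with all components of $\gamma'(t)$ nonnegative and $\gamma'(t)\ne0$ for every $t$; $U(x)=\sup\{\int_0^1 f(\gamma(t))^{1/d}(\gamma_1'(t)\cdots\gamma_d'(t))^{1/d}dt:\gamma\in\mathcal{A},\ \gamma(t)\leqq x\ \forall t\}$. $c_d$ is the positive constant such that, for i.i.d. uniform points on $[0,1]^d$, $n^{-1/d}$ times the length of a longest chain among the first $n$ points converges almost surely to $c_d$. *)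

(* Defs.v *)
From HB Require Import structures.
From mathcomp Require Import all_boot all_order all_algebra.
From mathcomp Require Import all_classical all_reals all_analysis.
Set Implicit Arguments. Unset Strict Implicit. Unset Printing Implicit Defensive.
Import Order.TTheory GRing.Theory Num.Theory.
Import numFieldNormedType.Exports.
Local Open Scope classical_set_scope.
Local Open Scope ring_scope.

Section Defs.
Variables (R : realType) (d : nat).
Implicit Types (x y a b : 'rV[R]_d).

Definition leqv x y : bool := [forall i, x ord0 i <= y ord0 i].

Definition enorm x : R := Num.sqrt (\sum_(i < d) (x ord0 i) ^+ 2).

Definition upd x (j : 'I_d) (t : R) : 'rV[R]_d :=
  \row_k (if k == j then t else x ord0 k).

Fixpoint iint (s : seq 'I_d) (F : 'rV[R]_d -> \bar R) a b x : \bar R :=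
  match s with
  | [::] => F x
  | j :: s' =>
      (\int[@lebesgue_measure R]_(t in [set t : R | (a ord0 j <= t <= b ord0 j)%R])
          iint s' F a b (upd x j t))%E
  end.

Definition box_integral (F : 'rV[R]_d -> \bar R) a b : \bar R :=
  iint (enum 'I_d) F a b a.

Definition in_box a b x : Prop := forall i, a ord0 i <= x ord0 i <= b ord0 i.

Definition is_rvec {dT} {T : measurableType dT} (Y : T -> 'rV[R]_d) : Prop :=
  forall i, measurable_fun setT (fun w => Y w ord0 i).

(* Y has Lebesgue density f: P(Y in B) = \int_B f for every box B
   (boxes form a pi-system generating the Borel sets of R^d) *)
Definition has_density {dT} {T : measurableType dT} (P : probability T R)
    (Y : T -> 'rV[R]_d) (f : 'rV[R]_d -> R) : Prop :=
  forall a b, leqv a b ->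
    P [set w | in_box a b (Y w)] = box_integral (fun x => (f x)%:E) a b.

Definition indep_seq {dT} {T : measurableType dT} (P : probability T R)
    (X : nat -> T -> 'rV[R]_d) : Prop :=
  forall (s : seq nat) (a b : nat -> 'rV[R]_d), uniq s ->
    P [set w | forall i, i \in s -> in_box (a i) (b i) (X i w)]
    = (\prod_(i <- s) P [set w | in_box (a i) (b i) (X i w)])%E.

(* X_1, X_2, ... (indexed here from 0) i.i.d. with density f *)
Definition iid_density {dT} {T : measurableType dT} (P : probability T R)
    (X : nat -> T -> 'rV[R]_d) (f : 'rV[R]_d -> R) : Prop :=
  (forall i, is_rvec (X i)) /\ indep_seq P X /\ (forall i, has_density P (X i) f).

(* length of a longest chain in { pts i : i < n, A (pts i) }
   (chain = set of points totally ordered by <==; distinct points counted) *)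
Definition longest_chain (n : nat) (pts : nat -> 'rV[R]_d)
    (A : pred 'rV[R]_d) : nat :=
  \max_(S : {set 'I_n} |
          [forall i in S, forall j in S,
             [&& A (pts i), leqv (pts i) (pts j) || leqv (pts j) (pts i)
               & (pts i == pts j) ==> (i == j)]]) #|S|.

Definition u_n (n : nat) (pts : nat -> 'rV[R]_d) x : nat :=
  longest_chain n pts (fun y => leqv y x).

Definition unit_cube_density (x : 'rV[R]_d) : R :=
  if [forall i, (0 <= x ord0 i <= 1)] then 1 else 0.

Definition is_chain_constant (c : R) : Prop :=
  0 < c /\
  forall (dT : measure_display) (T : measurableType dT) (P : probability T R)
         (Y : nat -> T -> 'rV[R]_d),
    iid_density P Y unit_cube_density ->
    {ae P, forall w, (fun n : nat =>
         n%:R `^ (- (d%:R)^-1) * (longest_chain n (fun i => Y i w) predT)%:R)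
       @ \oo --> c}.

Definition deriv01 (g g' : R -> R) : Prop :=
  forall t, 0 <= t <= 1 ->
    (fun s => (g s - g t) / (s - t))
      @ (within [set s | 0 <= s <= 1 /\ s != t] (nbhs t)) --> g' t.

Definition C1_01 (g g' : 'I_d -> R -> R) : Prop :=
  forall i, deriv01 (g i) (g' i) /\ {within `[0, 1], continuous (g' i)}.

Definition admissible (g g' : 'I_d -> R -> R) x : Prop :=
  C1_01 g g' /\
  (forall t, 0 <= t <= 1 ->
     (forall i, 0 <= g' i t) /\ (exists i, g' i t != 0) /\
     leqv (\row_i g i t) x).

Definition chain_energy (f : 'rV[R]_d -> R) (g g' : 'I_d -> R -> R) : \bar R :=
  (\int[@lebesgue_measure R]_(t in [set t : R | (0 <= t <= 1)%R])
     ((f (\row_i g i t)) `^ (d%:R)^-1 *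
      (\prod_(i < d) g' i t) `^ (d%:R)^-1)%:E)%E.

Definition U_fun (f : 'rV[R]_d -> R) x : \bar R :=
  ereal_sup [set v | exists g g', admissible g g' x /\ v = chain_energy f g g'].

(* Lipschitz boundary: near each boundary point, after a rigid motion,
   Omega is the strict epigraph of a Lipschitz function of the first d-1
   coordinates (the last coordinate has index d-1). *)
Definition lipschitz_boundary (Om : set 'rV[R]_d) : Prop :=
  forall p, closure Om p -> ~ Om p ->
  exists (r : R) (Q : 'M[R]_d) (g : 'rV[R]_d -> R) (L : R),
    0 < r /\ Q *m Q^T = 1%:M /\
    (forall y y', (forall j : 'I_d, val j != d.-1 -> y ord0 j = y' ord0 j) ->
                  g y = g y') /\
    (forall y y', `|g y - g y'| <= L * enorm (y - y')) /\
    (forall x, enorm (x - p) < r ->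
       (Om x <-> exists j : 'I_d, val j = d.-1 /\
                    g ((x - p) *m Q) < ((x - p) *m Q) ord0 j)).

End Defs.

(* Main.v *)
(* The sample is compared with uniform points box by box. On a box of volume v
   where f <= M, discretizing by a fine grid and thinning shows that the longest
   chain among n sample points is, up to an exponentially small error, dominated
   by the longest chain among (1 + dl) M v n uniform points. Uniform points live
   on the same probability space (apply a marginal distribution function to the
   coordinates of the X_i), and independence of disjoint blocks together with
   the second Borel-Cantelli lemma upgrades the almost sure limit defining c_d
   to summable probabilities. Hence, almost surely, a box contributes at most
   c_d (M v n)^(1/d) to a chain, simultaneously for all boxes of a fine grid.

   A longest chain below z passes through a bounded number of small grid boxes
   [u_k, v_k], so it remains to see that the sum of (M_k v_k)^(1/d) is at most
   U(z) up to a small error. The Lipschitz boundary provides inward directions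
   that are constant on long stretches of the chain; translating the boxes
   along them, and dropping those near the end of a stretch to keep the
   sequence increasing, gives an increasing polygon inside the domain, which a
   C^1 reparametrization turns into an admissible curve with the same energy. *)
Require Import Defs.
From HB Require Import structures.
From mathcomp Require Import all_boot all_order all_algebra.
From mathcomp Require Import all_classical all_reals all_analysis.
From mathcomp Require Import measurable_realfun ring lra zify.
Set Implicit Arguments. Unset Strict Implicit. Unset Printing Implicit Defensive.
Import Order.TTheory GRing.Theory Num.Theory.
Import numFieldNormedType.Exports.
Local Open Scope classical_set_scope.
Local Open Scope ring_scope.

(** * Random words *)

(** The constant c_d is known only through an almost sure limit without a rate, while the boxes that
    a chain visits are random and change with [n]. This is why summable probabilities are extracted
    from the limit, along the sizes [al * r ^ j], and why boxes are rounded to a finite grid fixed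
    independently of the sample. Independence and density are given on boxes only, so sample and
    uniform points are never coupled: both are reduced to random words over the cells of a grid, and
    a recursion compares the laws of these words.

    On the deterministic side the obstacle is that a box meeting the chain may stick out of the
    domain. There [f] vanishes, and the modulus of continuity gives no lower bound for [f] on the
    whole box in terms of its supremum; hence the translation into the domain. Different stretches
    may move in different directions, which can destroy the order where they meet. The number of
    stretches is bounded in terms of the domain alone, while the width of the dropped zones can be
    made arbitrarily small, so the loss is negligible. *)

Section ThinnedWords.
Context {R : realType} {K : finType}.
Implicit Types (w mu : K -> R) (G H : pred (seq K)).

(* Probability that the word produced in [n] independent rounds satisfies [G],
   when a round appends the letter [c] with probability [w c] and nothing
   otherwise; the recursion is arranged so that the probability of "nothing"
   does not occur. *)
Fixpoint word_prob w n G : R :=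
  if n is n'.+1 then
    word_prob w n' G +
    \sum_c w c * (word_prob w n' (fun s => G (c :: s)) - word_prob w n' G)
  else (G [::])%:R.

Lemma word_prob_rec w n G : word_prob w n.+1 G = word_prob w n G +
  \sum_c w c * (word_prob w n (fun s => G (c :: s)) - word_prob w n G).
Proof. by []. Qed.

Lemma word_probS w n G :
  word_prob w n.+1 G = (1 - \sum_c w c) * word_prob w n G
                       + \sum_c w c * word_prob w n (fun s => G (c :: s)).
Proof.
rewrite /= mulrBl mul1r -addrA; congr (_ + _).
rewrite (eq_bigr (fun c => w c * word_prob w n (fun s => G (c :: s))
                           - w c * word_prob w n G)); last first.
  by move=> c _; rewrite mulrBr.
by rewrite big_split /= sumrN -mulr_suml addrC.
Qed.

Lemma word_prob_total w n : word_prob w n predT = 1.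
Proof.
elim: n => //= n ->; rewrite big1 ?addr0// => c _.
by rewrite subrr mulr0.
Qed.

Section subprobability.
Variables (w : K -> R) (w_ge0 : forall c, 0 <= w c) (w_le1 : \sum_c w c <= 1).

Lemma le_word_prob n G H : (forall s, G s -> H s) ->
  word_prob w n G <= word_prob w n H.
Proof.
elim: n G H => [|n IH] G H GH.
  by rewrite /= ler_nat; case: (G [::]) (GH [::]) => // ->.
rewrite !word_probS lerD//.
  by apply: ler_wpM2l; [rewrite subr_ge0|exact: IH].
by apply: ler_sum => c _; apply: ler_wpM2l => //; apply: IH => s; exact: GH.
Qed.

Lemma word_prob_ge0 n G : 0 <= word_prob w n G.
Proof.
elim: n G => [|n IH] G; first by rewrite /= ler0n.
rewrite word_probS addr_ge0// ?mulr_ge0 ?subr_ge0//.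
by apply: sumr_ge0 => c _; rewrite mulr_ge0.
Qed.

Lemma word_prob_le1 n G : word_prob w n G <= 1.
Proof. by rewrite -(word_prob_total w n); exact: le_word_prob. Qed.

End subprobability.

Definition subseq_monotone G := forall s1 s2, subseq s1 s2 -> G s1 -> G s2.

(* With letters drawn at rate [w <= p mu], at most [N] of the [n] rounds
   produce a letter up to the Chernoff error of a binomial [(n, p)]; the
   recursion of [word_prob] turns this coupling into an induction. *)
Lemma word_prob_thinning w mu (p l : R) n N G :
  (forall c, 0 <= w c) -> (forall c, 0 <= mu c) -> \sum_c mu c = 1 ->
  (forall c, w c <= p * mu c) -> 0 <= p <= 1 -> 1 <= l -> subseq_monotone G ->
  word_prob w n G <= word_prob mu N G + l ^- N * (1 + p * (l - 1)) ^+ n.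
Proof.
move=> w0 mu0 mu1 wmu /andP[p0 p1] l1 GM.
have w1 : \sum_c w c <= 1.
  apply: (@le_trans _ _ p) => //; rewrite -[leRHS]mulr1 -mu1 mulr_sumr.
  exact: ler_sum.
have lp : 0 < l by apply: lt_le_trans l1.
have Q1 : 1 <= 1 + p * (l - 1) by rewrite lerDl mulr_ge0// subr_ge0.
have Qge k : 1 <= (1 + p * (l - 1)) ^+ k by rewrite exprn_ege1.
elim: n N G GM => [|n IH] N G GM.
  rewrite /= expr0 mulr1.
  case G0: (G [::]) => /=; last first.
    by rewrite addr_ge0// ?word_prob_ge0 ?mu1// invr_ge0 exprn_ge0// ltW.
  have -> : G = predT.
    by apply/funext => s; rewrite /= (GM [::] s)// sub0seq.
  by rewrite word_prob_total lerDl invr_ge0 exprn_ge0// ltW.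
(* Without budget the error term alone is at least 1. *)
case: N => [|N].
  rewrite expr0 invr1 mul1r (le_trans (word_prob_le1 w0 w1 _ _))//.
  by rewrite -[leLHS]add0r lerD// word_prob_ge0// mu1.
have GcM c : subseq_monotone (fun s => G (c :: s)).
  by move=> s1 s2 s12; apply: GM; rewrite /= eqxx.
have GGc c : word_prob w n G <= word_prob w n (fun s => G (c :: s)).
  by apply: le_word_prob => // s; apply: GM; exact: subseq_cons.
set Q := 1 + p * (l - 1) in Qge IH *.
(* Monotonicity of [G] makes every difference in the recursion nonnegative, so [w c] may be replaced
   by the larger [p * mu c]; the result is a round that produces a letter with probability [p]. *)
apply: (@le_trans _ _ ((1 - p) * word_prob w n G
     + p * \sum_c mu c * word_prob w n (fun s => G (c :: s)))).
  have -> : (1 - p) * word_prob w n G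
     + p * \sum_c mu c * word_prob w n (fun s => G (c :: s)) =
     word_prob w n G + \sum_c (p * mu c) *
      (word_prob w n (fun s => G (c :: s)) - word_prob w n G).
    rewrite mulrBl mul1r -addrA; congr (_ + _).
    under [in RHS]eq_bigr do rewrite mulrBr.
    rewrite big_split /= sumrN -mulr_suml -mulr_sumr mu1 mulr1 addrC mulr_sumr.
    by congr (_ + _); apply: eq_bigr => c _; rewrite mulrA.
  by rewrite /= lerD2l; apply: ler_sum => c _; apply: ler_wpM2r => //; rewrite subr_ge0.
(* An empty round keeps the budget [N.+1], a letter lowers it to [N]. The errors recombine because
   [(1 - p) + p * l = Q]. *)
apply: (@le_trans _ _ ((1 - p) * (word_prob mu N.+1 G + l ^- N.+1 * Q ^+ n) +
  p * \sum_c mu c * (word_prob mu N (fun s => G (c :: s)) + l ^- N * Q ^+ n))).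
  apply: lerD; first by apply: ler_wpM2l; [rewrite subr_ge0|exact: IH].
  apply: ler_wpM2l => //; apply: ler_sum => c _; apply: ler_wpM2l => //; exact: IH.
have -> : \sum_c mu c * (word_prob mu N (fun s => G (c :: s)) + l ^- N * Q ^+ n)
   = word_prob mu N.+1 G + l ^- N * Q ^+ n.
  rewrite word_probS mu1 subrr mul0r add0r.
  under eq_bigr do rewrite mulrDr.
  by rewrite big_split /= -mulr_suml mu1 mul1r.
have -> : l ^- N = l ^- N.+1 * l by rewrite exprSr invfM mulfVK ?gt_eqF.
rewrite le_eqVlt; apply/orP; left; apply/eqP.
rewrite [Q ^+ n.+1]exprS {2}/Q.
move: (l ^- N.+1) (Q ^+ n) (word_prob mu N.+1 G) => x y v.
by rewrite /Q; ring.
Qed.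

End ThinnedWords.

Lemma big_option (V : nmodType) (K : finType) (F : option K -> V) :
  \sum_o F o = F None + \sum_c F (Some c).
Proof.
rewrite (bigD1 None)//= (reindex_omap Some id)//=; last by case.
by congr (_ + _); apply: eq_bigl => c; rewrite eqxx.
Qed.

(** * Words read off an independent sequence of samples *)

Section IndependentSequence.
Context {R : realType} {dT : measure_display} {T : measurableType dT}.
Variable P : probability T R.
Implicit Types (A B : set T).

Definition Pr A : R := fine (P A).

Lemma PrE A : measurable A -> P A = (Pr A)%:E.
Proof. by move=> mA; rewrite /Pr fineK// fin_num_measure. Qed.

Lemma Pr_ge0 A : 0 <= Pr A.
Proof. by rewrite /Pr fine_ge0. Qed.

Lemma Pr_le1 A : measurable A -> Pr A <= 1.
Proof. by move=> mA; rewrite -lee_fin -PrE// probability_le1. Qed.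

Lemma Pr_le A B : measurable A -> measurable B -> A `<=` B -> Pr A <= Pr B.
Proof.
by move=> mA mB AB; rewrite -lee_fin -!PrE// le_measure// inE.
Qed.

Lemma PrU A B : measurable A -> measurable B -> A `&` B = set0 ->
  Pr (A `|` B) = Pr A + Pr B.
Proof.
move=> mA mB AB; apply: EFin_inj; rewrite EFinD -!PrE//; last exact: measurableU.
by rewrite measureU.
Qed.

Lemma PrU_le A B : measurable A -> measurable B -> Pr (A `|` B) <= Pr A + Pr B.
Proof.
move=> mA mB; rewrite -lee_fin EFinD -!PrE//; last exact: measurableU.
exact: measureU2.
Qed.

Lemma Pr_bigcup_le (I : Type) (r : seq I) (Q : pred I) (F : I -> set T) :
  (forall i, Q i -> measurable (F i)) ->
  Pr (\big[setU/set0]_(i <- r | Q i) F i) <= \sum_(i <- r | Q i) Pr (F i).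
Proof.
move=> mF; elim: r => [|i r IH]; first by rewrite !big_nil /Pr measure0.
rewrite !big_cons; case: ifP => // Qi; apply: le_trans (PrU_le _ _) _; first exact: mF.
  by apply: bigsetU_measurable.
by rewrite lerD2l.
Qed.

Lemma PrDI A B : measurable A -> measurable B -> Pr A = Pr (A `&` B) + Pr (A `\` B).
Proof.
move=> mA mB; rewrite -PrU; [|exact: measurableI|exact: measurableD|].
  by rewrite setUIDK.
by apply/seteqP; split => // t [[_ ?] []].
Qed.

Lemma Pr_eqI A B : measurable A -> measurable B -> A `<=` B -> Pr (B `\` A) = 0 ->
  Pr A = Pr B.
Proof.
move=> mA mB AB BA; rewrite (PrDI mB mA) BA addr0.
by congr Pr; rewrite setIidr.
Qed.

Lemma Pr_fiber (O : finType) (k : T -> O) A :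
  (forall o, measurable [set t | k t = o]) -> measurable A ->
  Pr A = \sum_o Pr (A `&` [set t | k t = o]).
Proof.
move=> mk mA.
have : forall l : seq O, uniq l ->
    measurable [set t | k t \in l] /\
    Pr (A `&` [set t | k t \in l]) = \sum_(o <- l) Pr (A `&` [set t | k t = o]).
  elim=> [_|o l IH /= /andP[ol ul]].
    have -> : [set t | k t \in [::]] = set0 by apply/seteqP; split.
    by rewrite setI0 big_nil /Pr measure0.
  have [ml IHl] := IH ul.
  have -> : [set t | k t \in o :: l] = [set t | k t = o] `|` [set t | k t \in l].
    apply/seteqP; split=> t /=; rewrite inE.
      by case/orP => [/eqP|]; [left|right].
    by case=> [->|->]; rewrite ?eqxx ?orbT.
  split; first exact: measurableU.
  rewrite setIUr PrU ?IHl ?big_cons//; [exact: measurableI|exact: measurableI|].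
  apply/seteqP; split => // t [[_ /= ->] [_]] /=; by rewrite (negPf ol).
move=> /(_ (enum O) (enum_uniq O))[_]; rewrite big_enum /= => <-.
congr Pr; apply/seteqP; split => [t At|t []//]; split=> //=; by rewrite mem_enum.
Qed.

Variable V : nat -> set (set T).
Hypothesis mV : forall i B, V i B -> measurable B.

Definition cylinder (s : seq nat) (B : nat -> set T) : set T :=
  [set t | forall i, i \in s -> B i t].

Lemma cylinder_nil (B : nat -> set T) : cylinder [::] B = setT.
Proof. by apply/seteqP; split. Qed.

Lemma cylinder_cons i s (B : nat -> set T) : cylinder (i :: s) B = B i `&` cylinder s B.
Proof.
apply/seteqP; split=> t /= H.
  by split=> [|j js]; apply: H; rewrite inE ?eqxx ?js ?orbT.
by move=> j; rewrite inE => /orP[/eqP->|]; [exact: H.1|exact: H.2].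
Qed.

Lemma measurable_cylinder s (B : nat -> set T) : (forall i, i \in s -> measurable (B i)) ->
  measurable (cylinder s B).
Proof.
elim: s => [|i s IH] mB; first by rewrite cylinder_nil.
rewrite cylinder_cons; apply: measurableI; first by apply: mB; rewrite inE eqxx.
by apply: IH => j js; apply: mB; rewrite inE js orbT.
Qed.

(* [A] is independent of the generating events [V i] with [i >= k]. *)
Definition indep_from A k := measurable A /\
  forall s (B : nat -> set T), uniq s -> (forall i, i \in s -> (k <= i)%N) ->
    (forall i, i \in s -> V i (B i)) ->
    Pr (A `&` cylinder s B) = Pr A * \prod_(i <- s) Pr (B i).

Lemma indep_fromW A k k' : (k <= k')%N -> indep_from A k -> indep_from A k'.
Proof.
move=> kk' [mA iA]; split=> // s B us sk; apply: iA => // i /sk; exact: leq_trans.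
Qed.

Variables (K : finType) (k_ : nat -> T -> option K) (w : K -> R).
Hypothesis mk : forall i o, measurable [set t | k_ i t = o].
(** Cells are half-open, whereas the generating events will be closed boxes, so a letter event
    matches a generating event only up to a null set. *)
Hypothesis k_V : forall i c, exists B, [/\ V i B, [set t | k_ i t = Some c] `<=` B,
  Pr (B `\` [set t | k_ i t = Some c]) = 0 & Pr B = w c].

Definition word t i n := pmap (k_^~ t) (iota i n).


Lemma measurable_word i n (G : pred (seq K)) : measurable [set t | G (word t i n)].
Proof.
elim: n i G => [|n IH] i G.
  rewrite /word /=; case: (G [::]).
    by rewrite (_ : [set _ | _] = setT)//; apply/seteqP; split.
  by rewrite (_ : [set _ | _] = set0)//; apply/seteqP; split.
have -> : [set t | G (word t i n.+1)] = \bigcup_(o in [set: option K])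
   ([set t | k_ i t = o] `&` [set t | G (oapp (cons^~ (word t i.+1 n)) (word t i.+1 n) o)]).
  apply/seteqP; split=> t /=; first by move=> GW; exists (k_ i t).
  by case=> o _ [<-].
apply: fin_bigcup_measurable => [|o _]; first exact: finite_finset.
apply: measurableI => //; case: o => [c|] /=; last exact: IH.
exact: (IH i.+1 (fun s => G (c :: s))).
Qed.

(** The letter event is exchanged for the generating event [B] that equals it up to a null set; [B]
    then joins the cylinder as its constraint at index [k]. *)
Lemma indep_from_letter A k c : indep_from A k ->
  indep_from (A `&` [set t | k_ k t = Some c]) k.+1 /\
  Pr (A `&` [set t | k_ k t = Some c]) = Pr A * w c.
Proof.
move=> [mA iA]; have [B [VB kB B0 PB]] := k_V k c.
set E := [set t | k_ k t = Some c] in kB B0 *.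
have mE : measurable E by exact: mk.
have mB := mV VB.
have PE S : measurable S -> Pr (A `&` E `&` S) = Pr (A `&` (B `&` S)).
  move=> mS; rewrite -setIA; apply: Pr_eqI; try by do ?apply: measurableI.
    by move=> t [At [/kB Bt St]].
  apply/eqP; rewrite eq_le Pr_ge0 andbT -B0 Pr_le//.
  - by apply: measurableD; do ?apply: measurableI.
  - exact: measurableD.
  - by move=> t [[At [Bt St]] nE]; split=> // Et; apply: nE.
have PAE : Pr (A `&` E) = Pr A * w c.
  have := iA [:: k] (fun=> B); rewrite big_seq1 cylinder_cons cylinder_nil PB => <-//.
  - by rewrite -PE ?setIT.
  - by move=> i; rewrite inE => /eqP->.
  - by move=> i; rewrite inE => /eqP->.
split=> //; split; first exact: measurableI.
move=> s C us sk VC; rewrite PAE PE; last first.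
  by apply: measurable_cylinder => i /VC/mV.
have ks : k \notin s by apply/negP => /sk; rewrite ltnn.
pose C' i := if i == k then B else C i.
have CC' i : i \in s -> C' i = C i.
  by move=> si; rewrite /C'; case: eqP => // ik; rewrite -ik si in ks.
have -> : B `&` cylinder s C = cylinder (k :: s) C'.
  rewrite cylinder_cons /C' eqxx; congr (_ `&` _).
  by apply/seteqP; split => t H i si; have := H _ si; rewrite -/(C' i) CC'.
rewrite iA/=; last 3 first.
- by rewrite ks.
- by move=> i; rewrite inE => /orP[/eqP->//|/sk/ltnW].
- move=> i; rewrite inE => /orP[/eqP->|si]; first by rewrite /C' eqxx.
  by rewrite CC'//; exact: VC.
rewrite big_cons /C' eqxx PB mulrA; congr (_ * _).
by rewrite big_seq [RHS]big_seq; apply: eq_bigr => i si; rewrite -/(C' i) CC'.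
Qed.

(** Producing no letter is not a generating event, so its probability is obtained by subtraction: on
    that fiber the word starting at [k] equals the word starting at [k.+1], whose total and letter
    fibers are known by induction. This is exactly the shape of the recursion of [word_prob]. The
    later cylinder is carried along to keep independence in the induction. *)
Lemma indep_from_word A k n (G : pred (seq K)) : indep_from A k ->
  indep_from (A `&` [set t | G (word t k n)]) (k + n) /\
  Pr (A `&` [set t | G (word t k n)]) = Pr A * word_prob w n G.
Proof.
move=> iA; have mA := iA.1.
suff H s (B : nat -> set T) : uniq s -> (forall i, i \in s -> (k + n <= i)%N) ->
    (forall i, i \in s -> V i (B i)) ->
    Pr (A `&` [set t | G (word t k n)] `&` cylinder s B) =
    Pr A * word_prob w n G * \prod_(i <- s) Pr (B i).
  have PA : Pr (A `&` [set t | G (word t k n)]) = Pr A * word_prob w n G.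
    have := H [::] (fun=> set0); rewrite cylinder_nil setIT big_nil mulr1.
    by apply.
  split=> //; split; first by apply: measurableI => //; exact: measurable_word.
  by move=> s B us sk VB; rewrite H// PA.
elim: n A k G iA mA => [|n IH] A k G iA mA us sk VB.
  rewrite /word /=; case: (G [::]).
    have -> : [set t : T | true] = setT by apply/seteqP; split.
    by rewrite setIT mulr1; apply: iA.2 => // i /sk; rewrite addn0.
  have -> : [set t : T | false] = set0 by apply/seteqP; split.
  by rewrite setI0 set0I /Pr measure0 mulr0 mul0r.
have mS : measurable (cylinder s B) by apply: measurable_cylinder => i /VB/mV.
set S := cylinder s B in mS *.
pose W := A `&` [set t | G (word t k n.+1)] `&` S.
pose Z := A `&` [set t | G (word t k.+1 n)] `&` S.
pose E o := [set t | k_ k t = o].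
have mW : measurable W by do ?apply: measurableI => //; exact: measurable_word.
have mZ : measurable Z by do ?apply: measurableI => //; exact: measurable_word.
have sk' i : i \in s -> (k.+1 + n <= i)%N by move=> /sk; rewrite addnS.
have HW : Pr W = \sum_o Pr (W `&` E o) := Pr_fiber (mk k) mW.
have HZ : Pr Z = \sum_o Pr (Z `&` E o) := Pr_fiber (mk k) mZ.
rewrite big_option in HW; rewrite big_option in HZ.
have WN : W `&` E None = Z `&` E None.
  apply/seteqP; split=> t [[[At +] St] kt]; rewrite /= in kt.
    by rewrite /= /word /= kt.
  by rewrite /W /= /word /= kt.
have IHZ : Pr Z = Pr A * word_prob w n G * \prod_(i <- s) Pr (B i).
  by rewrite /Z (IH _ k.+1)//; apply: indep_fromW iA.
have IHZc c : Pr (Z `&` E (Some c)) =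
    Pr A * w c * word_prob w n G * \prod_(i <- s) Pr (B i).
  have [i1 i2] := indep_from_letter c iA.
  rewrite -i2 -(IH _ k.+1)//; last exact: i1.1.
  by congr Pr; rewrite /Z -!setIA; congr (_ `&` _); rewrite setIA setIC.
have IHWc c : Pr (W `&` E (Some c)) =
    Pr A * w c * word_prob w n (fun s => G (c :: s)) * \prod_(i <- s) Pr (B i).
  have [i1 i2] := indep_from_letter c iA.
  rewrite -i2 -(IH _ k.+1)//; last exact: i1.1.
  congr Pr; apply/seteqP; split=> t.
    by move=> [[[At +] St] kt]; rewrite /= in kt; rewrite /= /word /= kt.
  by move=> [[[At kt] +] St]; rewrite /= in kt; rewrite /= /W /word /= kt.
rewrite -/W HW WN.
rewrite IHZ in HZ.
have -> : Pr (Z `&` E None) = Pr A * word_prob w n G * \prod_(i <- s) Pr (B i) -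
   \sum_c Pr A * w c * word_prob w n G * \prod_(i <- s) Pr (B i).
  apply/eqP; rewrite eq_sym subr_eq HZ; apply/eqP; congr (_ + _).
  by apply: eq_bigr => c _; rewrite IHZc.
rewrite (eq_bigr _ (fun c _ => IHWc c)).
rewrite word_prob_rec mulrDr mulrDl -addrA; congr (_ + _).
rewrite mulr_sumr mulr_suml addrC -sumrB; apply: eq_bigr => c _.
by rewrite -mulrBl -mulrBr mulrA.
Qed.

End IndependentSequence.

(** * Discretization of chains by grid cells *)

Section WordEvents.
Context {R : realType} {K : finType}.
Variables (mu : K -> R) (mu_ge0 : forall c, 0 <= mu c) (mu1 : \sum_c mu c = 1).
Implicit Types (G H : pred (seq K)).

Lemma word_probU n G H : word_prob mu n (fun s => G s || H s) <=
  word_prob mu n G + word_prob mu n H.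
Proof.
elim: n G H => [|n IH] G H.
  by rewrite /= -natrD ler_nat; case: (G [::]); case: (H [::]).
rewrite !word_probS mu1 subrr !mul0r !add0r -big_split /=.
by apply: ler_sum => c _; rewrite -mulrDr; apply: ler_wpM2l => //; exact: IH.
Qed.

Lemma word_probC n G : word_prob mu n (predC G) = 1 - word_prob mu n G.
Proof.
elim: n G => [|n IH] G; first by rewrite /=; case: (G [::]); rewrite /= ?subrr ?subr0.
rewrite !word_probS mu1 subrr !mul0r !add0r -[in RHS]mu1 -sumrB.
by apply: eq_bigr => c _; rewrite -[X in _ = X - _]mulr1 -mulrBr -IH.
Qed.

Lemma word_prob_has n (Q : pred K) (q : R) : \sum_c mu c * (Q c)%:R <= q ->
  word_prob mu n (has Q) <= n%:R * q.
Proof.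
move=> Qq; elim: n => [|n IH]; first by rewrite /= mul0r.
rewrite word_probS mu1 subrr mul0r add0r.
have -> : n.+1%:R * q = q + n%:R * q by rewrite mulrS mulrDl mul1r.
apply: le_trans (lerD Qq IH).
have -> : word_prob mu n (has Q) = \sum_c mu c * word_prob mu n (has Q).
  by rewrite -mulr_suml mu1 mul1r.
rewrite -big_split /=.
apply: ler_sum => c _; rewrite -mulrDr; apply: ler_wpM2l => //.
apply: le_trans (word_probU _ (fun=> Q c) (has Q)) _.
rewrite lerD2r; case: (Q c); first by rewrite (word_prob_total mu n).
suff -> : word_prob mu n xpred0 = 0 by [].
by elim: n {IH} => //= n ->; rewrite big1 ?addr0// => c' _; rewrite subr0 mulr0.
Qed.

Lemma word_prob_Npairwise n (r : rel K) (q : R) : 0 <= q ->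
  (forall c, \sum_c' mu c' * (~~ r c c')%:R <= q) ->
  word_prob mu n (fun s => ~~ pairwise r s) <= n%:R ^+ 2 * q.
Proof.
move=> q0 rq; elim: n => [|n IH]; first by rewrite /= expr0n mul0r.
rewrite word_probS mu1 subrr mul0r add0r.
apply: (@le_trans _ _ (\sum_c mu c * (n%:R * q + n%:R ^+ 2 * q))).
  apply: ler_sum => c _; apply: ler_wpM2l => //.
  apply: le_trans (lerD (word_prob_has n (rq c)) IH).
  apply: le_trans (word_probU _ _ _); apply: le_word_prob; rewrite ?mu1// => s /=.
  by rewrite negb_and has_predC.
rewrite -mulr_suml mu1 mul1r -mulrDl ler_wpM2r// -[n.+1]addn1 natrD.
have : 0 <= n%:R :> R by rewrite ler0n. nra.
Qed.

End WordEvents.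

Section Cells.
Context {R : realType} {d : nat}.
Implicit Types (a b x y : 'rV[R]_d).
Variables (a b : 'rV[R]_d) (m : nat).
Hypothesis ab : forall i, a ord0 i < b ord0 i.

Definition cell := {ffun 'I_d -> 'I_m.+1}.
Definition grid i (j : nat) : R := a ord0 i + (b ord0 i - a ord0 i) * (j%:R / m.+1%:R).

Lemma ltr_grid i j k : (grid i j < grid i k) = (j < k)%N.
Proof.
by rewrite /grid ltrD2l ltr_pM2l ?subr_gt0// ltr_pM2r ?invr_gt0// ltr_nat.
Qed.

Lemma ler_grid i j k : (grid i j <= grid i k) = (j <= k)%N.
Proof. by rewrite leNgt ltr_grid -leqNgt. Qed.

Lemma grid0 i : grid i 0 = a ord0 i.
Proof. by rewrite /grid mul0r mulr0 addr0. Qed.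

Lemma gridT i : grid i m.+1 = b ord0 i.
Proof. by rewrite /grid divff// mulr1 addrC subrK. Qed.

Lemma grid_step i j : grid i j.+1 - grid i j = (b ord0 i - a ord0 i) / m.+1%:R.
Proof. by rewrite /grid -[j.+1]addn1 natrD; field. Qed.

Definition in_cell (c : cell) x :=
  [forall i, (grid i (c i) <= x ord0 i < grid i (c i).+1)].

Definition cell_of x : option cell := [pick c | in_cell c x].

Lemma in_cellW c c' x y i : in_cell c x -> in_cell c' y -> x ord0 i <= y ord0 i ->
  (c i <= c' i)%N.
Proof.
move=> /forallP/(_ i)/andP[cx _] /forallP/(_ i)/andP[_ yc'] xy.
by rewrite -ltnS -(ltr_grid i); apply: le_lt_trans yc'; exact: le_trans xy.
Qed.

Lemma in_cell_lt c c' x y i : in_cell c x -> in_cell c' y -> (c i < c' i)%N ->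
  x ord0 i < y ord0 i.
Proof.
move=> /forallP/(_ i)/andP[_ cx] /forallP/(_ i)/andP[yc' _].
by rewrite -(ler_grid i) => /le_trans/(_ yc'); apply: lt_le_trans.
Qed.

Lemma in_cell_inj c c' x : in_cell c x -> in_cell c' x -> c = c'.
Proof.
move=> cx c'x; apply/ffunP => i; apply/val_inj/eqP; rewrite eqn_leq.
by rewrite (in_cellW cx c'x)// (in_cellW c'x cx).
Qed.

Lemma cell_ofP x c : cell_of x = Some c <-> in_cell c x.
Proof.
rewrite /cell_of; case: pickP => [c' c'x|nc]; last by split=> //; rewrite nc.
by split=> [[<-]//|cx]; rewrite (in_cell_inj cx c'x).
Qed.

Lemma cell_of_ex x : (forall i, a ord0 i <= x ord0 i < b ord0 i) ->
  exists c, cell_of x = Some c.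
Proof.
move=> abx.
pose j i := Num.truncn ((x ord0 i - a ord0 i) / (b ord0 i - a ord0 i) * m.+1%:R).
have jP i : grid i (j i) <= x ord0 i < grid i (j i).+1.
  have /andP[ax xb] := abx i; have ab0 := ab i.
  have ba0 : 0 < b ord0 i - a ord0 i by rewrite subr_gt0.
  have /truncn_itv : 0 <= (x ord0 i - a ord0 i) / (b ord0 i - a ord0 i) * m.+1%:R.
    by rewrite !mulr_ge0 ?invr_ge0 ?subr_ge0 //; exact: ltW.
  have xE : x ord0 i = a ord0 i + (b ord0 i - a ord0 i) *
     ((x ord0 i - a ord0 i) / (b ord0 i - a ord0 i) * m.+1%:R / m.+1%:R).
    by rewrite mulfK// mulrC divfK ?gt_eqF// addrC subrK.
  rewrite -/(j i) => /andP[j1 j2]; rewrite [X in _ <= X < _]xE /grid lerD2l ltrD2l.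
  by rewrite ler_pM2l// ltr_pM2l// ler_pM2r ?invr_gt0// ltr_pM2r ?invr_gt0// j1 j2.
have jm i : (j i < m.+1)%N.
  rewrite -(ltr_grid i) gridT; have /andP[_] := abx i; apply: le_lt_trans.
  by have /andP[] := jP i.
exists [ffun i => Ordinal (jm i)]; apply/cell_ofP/forallP => i; rewrite ffunE; exact: jP.
Qed.

Definition cell_comparable (c c' : cell) :=
  [forall i, (c i <= c' i)%N] || [forall i, (c' i <= c i)%N].

Lemma cell_comparable_refl : reflexive cell_comparable.
Proof. by move=> c; rewrite /cell_comparable; apply/orP; left; apply/forallP. Qed.

Lemma cell_comparable_sym : symmetric cell_comparable.
Proof. by move=> c c'; rewrite /cell_comparable orbC. Qed.

(** The letters may occur in any order, and a repeated letter counts each time. The event therefore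
    survives the insertion of letters and is implied by a chain of sample points. *)
Definition has_chain k (s : seq cell) : bool :=
  `[< exists t, [/\ subseq t s, pairwise cell_comparable t & (k <= size t)%N] >].

Lemma has_chain_monotone k : subseq_monotone (has_chain k).
Proof.
move=> s1 s2 s12 /asboolP[t [ts tc kt]]; apply/asboolP; exists t; split=> //.
exact: subseq_trans s12.
Qed.

(** The cells share no slab in any direction, so that comparable cells contain strictly comparable
    points. *)
Definition cell_separated (c c' : cell) := [forall i, c i != c' i].

Lemma cell_uniform_sum : \sum_(c : cell) (m.+1%:R ^- d : R) = 1.
Proof.
rewrite sumr_const -[LHS]mulr_natr card_ffun !card_ord natrX.
by rewrite mulVf// expf_neq0.
Qed.

(** Union bound over the coordinates: a uniform cell agrees with [c] in a given coordinate with
    probability [1 / m.+1]. *)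
Lemma cell_separated_prob (c : cell) :
  \sum_(c' : cell) (m.+1%:R ^- d : R) * (~~ cell_separated c c')%:R <= d%:R / m.+1%:R.
Proof.
apply: (@le_trans _ _ (\sum_(l < d) \sum_(c' : cell) (m.+1%:R ^- d : R) * (c l == c'
    l)%:R)).
  rewrite exchange_big /=; apply: ler_sum => c' _; rewrite -mulr_sumr.
  rewrite ler_wpM2l ?invr_ge0 ?exprn_ge0//.
  case: (boolP (cell_separated c c')) => [_|]; first by rewrite sumr_ge0.
  rewrite negb_forall => /existsP[l]; rewrite negbK => cl.
  by rewrite (bigD1 l)//= cl lerDl sumr_ge0.
have E l : \sum_(c' : cell) (m.+1%:R ^- d : R) * (c l == c' l)%:R = m.+1%:R^-1.
  (* Once the summand is a product over the coordinates, the sum over cells factors. *)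
  pose F i (j : 'I_m.+1) : R := m.+1%:R^-1 * (if i == l then (c l == j)%:R else 1).
  transitivity (\sum_(c' : cell) \prod_i F i (c' i)).
    apply: eq_bigr => c' _; rewrite /F big_split /= prodr_const card_ord exprVn.
    congr (_ * _); rewrite (bigD1 l)//= eqxx big1 ?mulr1// => i il.
    by rewrite (negPf il).
  rewrite -bigA_distr_bigA /= (bigD1 l)//= [X in _ * X]big1 ?mulr1; last first.
    move=> i il; rewrite /F (negPf il) -mulr_sumr sumr_const card_ord.
    by rewrite mulVf.
  rewrite /F eqxx -mulr_sumr (bigD1 (c l))//= eqxx big1 ?addr0 ?mulr1// => j jc.
  by rewrite eq_sym (negPf jc).
by rewrite (eq_bigr _ (fun l _ => E l)) sumr_const card_ord mulr_natl.
Qed.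

Lemma pmap_odflt (I : Type) (k : I -> option cell) (s : seq I) :
  pmap k s = [seq odflt [ffun=> ord0] (k i) | i <- s & k i].
Proof. by elim: s => //= i s ->; case ki: (k i) => [c|] //=; rewrite ki. Qed.

Lemma longest_chain_witness n (pts : nat -> 'rV[R]_d) (A : pred 'rV[R]_d) k :
  (k <= longest_chain n pts A)%N -> exists S : {set 'I_n},
  [/\ forall i, i \in S -> A (pts i),
      forall i j, i \in S -> j \in S -> leqv (pts i) (pts j) || leqv (pts j) (pts i),
      forall i j, i \in S -> j \in S -> pts i = pts j -> i = j
    & (k <= #|S|)%N].
Proof.
rewrite /longest_chain; set Q := (X in \max_(S | X S) _).
have Q0 : (0 < #|[pred S | Q S]|)%N.
  by apply/card_gt0P; exists finset.set0; apply/forall_inP => i; rewrite finset.in_set0.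
have [S QS ->] := eq_bigmax_cond (fun S : {set 'I_n} => #|S|) Q0.
move=> kS; exists S; split=> //.
  by move=> i iS; have /forall_inP/(_ i iS)/forall_inP/(_ i iS)/and3P[] := QS.
  by move=> i j iS jS; have /forall_inP/(_ i iS)/forall_inP/(_ j jS)/and3P[] := QS.
move=> i j iS jS /eqP e; apply/eqP.
by have /forall_inP/(_ i iS)/forall_inP/(_ j jS)/and3P[_ _ /implyP/(_ e)] := QS.
Qed.

Lemma leq_longest_chain n (pts : nat -> 'rV[R]_d) (A : pred 'rV[R]_d) (S : {set 'I_n}) :
  (forall i, i \in S -> A (pts i)) ->
  (forall i j, i \in S -> j \in S -> leqv (pts i) (pts j) || leqv (pts j) (pts i)) ->
  (forall i j, i \in S -> j \in S -> pts i = pts j -> i = j) ->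
  (#|S| <= longest_chain n pts A)%N.
Proof.
move=> SA SC SD; apply: (@leq_bigmax_cond _ _ (fun S : {set 'I_n} => #|S|)).
apply/forall_inP => i iS; apply/forall_inP => j jS; rewrite SA//= SC//=.
by apply/implyP => /eqP e; apply/eqP; exact: SD.
Qed.

Lemma has_chain_of_longest_chain n (pts : nat -> 'rV[R]_d) (A : pred 'rV[R]_d) k :
  (forall i, (i < n)%N -> A (pts i) -> cell_of (pts i)) ->
  (k <= longest_chain n pts A)%N ->
  has_chain k (pmap (fun i => cell_of (pts i)) (iota 0 n)).
Proof.
move=> AC /longest_chain_witness[S [SA SC _ kS]]; apply/asboolP.
rewrite pmap_odflt; pose kk i : cell := odflt [ffun=> ord0] (cell_of (pts i)); rewrite -/kk.
have Sk (i : 'I_n) : i \in S -> in_cell (kk i) (pts i).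
  move=> iS; rewrite /kk; have := AC i (ltn_ord i) (SA i iS).
  by case E: (cell_of (pts i)) => [c|]// _; apply/cell_ofP.
exists [seq kk (val i) | i <- enum S]; split.
- rewrite map_comp; apply: map_subseq; rewrite subseq_filter.
  apply/andP; split; last by rewrite -val_enum_ord; apply: map_subseq; rewrite enumT;
      exact: filter_subseq.
  by apply/allP => _ /mapP[i + ->]; rewrite mem_enum => iS; exact: AC (ltn_ord i) (SA i iS).
- rewrite pairwise_all2rel; [|exact: cell_comparable_refl|exact: cell_comparable_sym].
  rewrite allrel_mapl allrel_mapr; apply/allrelP => i j; rewrite !mem_enum => iS jS.
  have /orP[] := SC i j iS jS => /forallP ij; apply/orP; [left|right];
    apply/forallP => l; by apply: in_cellW (ij l); exact: Sk.
- by rewrite size_map -cardE.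
Qed.

(** Points of a common cell or slab could be incomparable or equal; separation excludes both. *)
Lemma longest_chain_of_has_chain i0 n (pts : nat -> 'rV[R]_d) k : (0 < d)%N ->
  has_chain k (pmap (fun i => cell_of (pts i)) (iota i0 n)) ->
  pairwise cell_separated (pmap (fun i => cell_of (pts i)) (iota i0 n)) ->
  (k <= longest_chain (i0 + n) pts predT)%N.
Proof.
move=> d0 /asboolP[t [ts tc kt]] sep.
move: ts tc sep kt; rewrite !pmap_odflt; pose kk i : cell := odflt [ffun=> ord0]
    (cell_of (pts i)); rewrite -/kk; set s0 := [seq i <- iota i0 n | _].
move=> /subseqP[mk0 _ ->]; rewrite -map_mask size_map; set s := mask mk0 s0 => tc sep ks.
have ss0 : subseq s s0 by exact: mask_subseq.
have us : uniq s by apply: subseq_uniq ss0 _; rewrite filter_uniq// iota_uniq.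
have s_cell i : i \in s -> in_cell (kk i) (pts i).
  move=> /(mem_subseq ss0); rewrite mem_filter => /andP[+ _]; rewrite /kk.
  by case E: (cell_of _) => [c|]// _; apply/cell_ofP.
have s_lt i : i \in s -> (i < i0 + n)%N.
  by move=> /(mem_subseq ss0); rewrite mem_filter mem_iota => /andP[_ /andP[]].
pose r i j := (i == j) || cell_comparable (kk i) (kk j) && cell_separated (kk i) (kk j).
have sr i j : i \in s -> j \in s -> r i j.
  move=> iS jS; have : all2rel r s.
    rewrite -pairwise_all2rel; last 2 first.
    - by move=> x; rewrite /r eqxx.
    - move=> x y; rewrite /r eq_sym cell_comparable_sym; congr (_ || _ && _).
      by apply: eq_forallb => l; rewrite eq_sym.
    apply: (@sub_pairwise _
      (relpre kk (fun c c' => cell_comparable c c' && cell_separated c c'))).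
      by move=> x y /=; rewrite /r orbC => ->.
    rewrite -pairwise_map pairwise_relI tc /=.
    by apply: subseq_pairwise sep; apply: map_subseq.
  by move=> /allrelP; apply.
pose S : {set 'I_(i0 + n)} := [set i | val i \in s]%SET.
have SP (i : 'I_(i0 + n)) : (i \in S) = (val i \in s) by rewrite finset.in_set.
have card_S : #|S| = size s.
  rewrite cardE -(size_map val); apply/perm_size/uniq_perm => //.
    by rewrite map_inj_uniq ?enum_uniq//; exact: val_inj.
  move=> i; apply/mapP/idP => [[j + ->]|si]; first by rewrite mem_enum SP.
  by exists (Ordinal (s_lt i si)) => //; rewrite mem_enum SP.
rewrite /longest_chain; apply: leq_trans ks _; rewrite -card_S.
apply: (@leq_bigmax_cond _ _ (fun S : {set 'I_(i0 + n)} => #|S|)).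
apply/forall_inP => i; rewrite SP => si; apply/forall_inP => j; rewrite SP => sj.
have [->|ij] := eqVneq i j; first by rewrite /leqv eqxx orbb implybT andbT; apply/forallP.
have := sr _ _ si sj; rewrite /r (negPf (_ : val i != val j))//= => /andP[cc /forallP cs].
have lt_of c c' x y : in_cell c x -> in_cell c' y -> (forall l, c l != c' l) ->
    [forall l, (c l <= c' l)%N] -> forall l, x ord0 l < y ord0 l.
  move=> cx cy ne /forallP le l; apply: (in_cell_lt cx cy).
  by rewrite ltn_neqAle ne le.
have ne_sym l : kk j l != kk i l by rewrite eq_sym.
have l0 : 'I_d := Ordinal d0.
case/orP: cc => cc.
  have H := lt_of _ _ _ _ (s_cell _ si) (s_cell _ sj) cs cc.
  apply/andP; split; first by apply/orP; left; apply/forallP => l; exact: ltW.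
  by apply/implyP => /eqP e; have := H l0; rewrite e ltxx.
have H := lt_of _ _ _ _ (s_cell _ sj) (s_cell _ si) ne_sym cc.
apply/andP; split; first by apply/orP; right; apply/forallP => l; exact: ltW.
by apply/implyP => /eqP e; have := H l0; rewrite e ltxx.
Qed.

End Cells.

(** * Box probabilities and uniform samples *)

Section BoxIntegral.
Context {R : realType} {d : nat}.
Implicit Types (a b x : 'rV[R]_d) (F : 'rV[R]_d -> \bar R).
Local Open Scope ereal_scope.

(* Monotonicity without any measurability assumption: the integral of a
   nonnegative function is a supremum over the simple functions below it. *)
Lemma ge0_le_integral_nomeas (dT : measure_display) (T : measurableType dT)
    (mu : {measure set T -> \bar R}) (D : set T) (F G : T -> \bar R) :
  (forall t, D t -> 0 <= F t) -> (forall t, D t -> F t <= G t) ->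
  \int[mu]_(t in D) F t <= \int[mu]_(t in D) G t.
Proof.
move=> F0 FG; have G0 t : D t -> 0 <= G t by move=> Dt; apply: le_trans (FG _ Dt);
    exact: F0.
rewrite !ge0_integralE//; apply: ereal_sup_le => _ [h hF <-].
exists h => // t; apply: le_trans (hF t) _; rewrite /patch; case: ifPn => // /set_mem Dt.
exact: FG.
Qed.

Lemma set_itvcc_le (u v : R) : [set t : R | (u <= t <= v)%R] = `[u, v]%classic.
Proof. by apply/seteqP; split=> t /=; rewrite in_itv. Qed.

Lemma iint_ge0 s F a b x : (forall y, 0 <= F y) -> 0 <= iint s F a b x.
Proof.
move=> F0; elim: s x => [|j s IH] x //=; by apply: integral_ge0 => t _; exact: IH.
Qed.

(** The coordinates listed in [s] are overwritten by the integrals, so only the others have to lie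
    in the box from the start. *)
Lemma iint_le s F a b x (M : R) : (0 <= M)%R -> leqv a b ->
  (forall y, 0 <= F y) -> (forall y, in_box a b y -> F y <= M%:E) ->
  (forall i, i \notin s -> (a ord0 i <= x ord0 i <= b ord0 i)%R) ->
  iint s F a b x <= (M * \prod_(i <- s) (b ord0 i - a ord0 i))%:E.
Proof.
move=> M0 /forallP ab F0 FM; elim: s x => [|j s IH] x xab /=.
  by rewrite big_nil mulr1; apply: FM => i; exact: xab.
have ps0 : (0 <= \prod_(i <- s) (b ord0 i - a ord0 i))%R.
  by apply: prodr_ge0 => i _; rewrite subr_ge0.
apply: (@le_trans _ _ (\int[@lebesgue_measure R]_(t in [set t : R | (a ord0 j <= t <= b
    ord0 j)%R])
     (M * \prod_(i <- s) (b ord0 i - a ord0 i))%:E)).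
  apply: ge0_le_integral_nomeas => t /= tab; first exact: iint_ge0.
  apply: IH => i ins; rewrite /upd mxE; case: eqVneq => [->//|ij].
  by apply: xab; rewrite inE negb_or ij.
rewrite set_itvcc_le integral_cst//= lebesgue_measure_itv/= lte_fin.
case: ltP => [_|]; first by rewrite -EFinB -EFinM big_cons [(_ * (_ * _))%R]mulrCA mulrC.
by rewrite mule0 lee_fin big_cons !mulr_ge0// subr_ge0.
Qed.

Lemma box_integral_le F a b (M : R) : (0 <= M)%R -> leqv a b ->
  (forall y, 0 <= F y) -> (forall y, in_box a b y -> F y <= M%:E) ->
  box_integral F a b <= (M * \prod_i (b ord0 i - a ord0 i))%:E.
Proof.
move=> M0 ab F0 FM; rewrite /box_integral -big_enum; apply: iint_le => // i.
by rewrite mem_enum.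
Qed.

(** Length of the part of [u, v] inside [0, 1]. *)
Definition unit_overlap (u v : R) : R := (Num.max 0 (Num.min v 1 - Num.max u 0))%R.

Lemma integral_unit_indicator (C u v : R) : (0 <= C)%R ->
  \int[@lebesgue_measure R]_(t in [set t : R | (u <= t <= v)%R])
     (C * (0 <= t <= 1)%R%:R)%:E = (C * unit_overlap u v)%:E.
Proof.
move=> C0; have -> : \int[@lebesgue_measure R]_(t in [set t : R | (u <= t <= v)%R])
     (C * (0 <= t <= 1)%R%:R)%:E =
   \int[@lebesgue_measure R]_(t in `[Num.max u 0%R, Num.min v 1%R]%classic) C%:E.
  rewrite set_itvcc_le integral_mkcond [RHS]integral_mkcond; apply: eq_integral => t _.
  rewrite /patch !mem_setE !in_itv /=.
  rewrite ge_max le_min; case: (u <= t)%R; case: (t <= v)%R; case: (0 <= t)%R;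
      case: (t <= 1)%R => /=;
   rewrite ?mulr1 ?mulr0//.
rewrite integral_cst//= lebesgue_measure_itv/= lte_fin /unit_overlap.
case: ifPn => h; first by rewrite -EFinB -EFinM [Num.max 0%R _]max_r// subr_ge0 ltW.
by rewrite mule0 [Num.max 0%R _]max_l ?mulr0// subr_le0 leNgt.
Qed.

Lemma iint_unit_cube s a b x : uniq s ->
  iint s (fun y => (unit_cube_density y)%:E) a b x =
  ((\prod_(i | i \notin s) (0 <= x ord0 i <= 1)%R%:R) *
    \prod_(i <- s) unit_overlap (a ord0 i) (b ord0 i))%:E.
Proof.
elim: s x => [|j s IH] x /=.
  move=> _; rewrite big_nil mulr1 /unit_cube_density; case: forallP => [H|H].
    by rewrite big1// => i _; rewrite H.
  congr EFin; apply/esym/eqP; rewrite prodf_seq_eq0.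
  have /forallP : ~ (forall i, (0 <= x ord0 i <= 1)%R) by [].
  rewrite negb_forall => /existsP[i xi]; apply/hasP; exists i;
      first by rewrite mem_index_enum.
  by rewrite /= (negPf xi) eqxx.
move=> /andP[js us].
under eq_integral do rewrite IH//.
pose C := ((\prod_(i | i \notin j :: s) (0 <= x ord0 i <= 1)%R%:R) *
    \prod_(i <- s) unit_overlap (a ord0 i) (b ord0 i))%R.
transitivity (\int[@lebesgue_measure R]_(t in [set t : R | (a ord0 j <= t <= b ord0 j)%R])
     (C * (0 <= t <= 1)%R%:R)%:E).
  apply: eq_integral => t _; congr EFin; rewrite (bigD1 j)//= mxE eqxx /C.
  rewrite -[LHS]mulrA [LHS]mulrC; congr (_ * _ * _)%R.
  apply: eq_big => [i|i /andP[_ ij]]; first by rewrite inE negb_or andbC.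
  by rewrite mxE (negPf ij).
rewrite integral_unit_indicator; last first.
  by rewrite mulr_ge0// prodr_ge0// => i _; rewrite le_max lexx.
by rewrite /C big_cons -mulrA [X in (_ * X)%R]mulrC.
Qed.

Lemma box_integral_unit_cube a b :
  box_integral (fun y => (unit_cube_density y)%:E) a b =
  (\prod_i unit_overlap (a ord0 i) (b ord0 i))%:E.
Proof.
rewrite /box_integral iint_unit_cube ?enum_uniq// big_pred0 ?mul1r ?big_enum//.
by move=> i; rewrite mem_enum.
Qed.

End BoxIntegral.

Section RandomVectors.
Context {R : realType} {d : nat} {dT : measure_display} {T : measurableType dT}.
Variable P : probability T R.

Lemma measurable_coord_itv (g : T -> R) (i : interval R) : measurable_fun setT g ->
  measurable [set w | g w \in i].
Proof.
move=> mg; have -> : [set w | g w \in i] = setT `&` g @^-1` [set` i].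
  by rewrite setTI.
exact: mg.
Qed.

Lemma measurable_forall_fin (I : finType) (Q : I -> set T) :
  (forall i, measurable (Q i)) -> measurable [set w | forall i, Q i w].
Proof.
move=> mQ; have -> : [set w | forall i, Q i w] = \bigcap_(i in [set: I]) Q i.
  by apply/seteqP; split=> w H i; [move=> _; exact: H|exact: H].
by apply: fin_bigcap_measurable => // i _.
Qed.

Lemma measurable_in_box (Y : T -> 'rV[R]_d) (a b : 'rV[R]_d) : is_rvec Y ->
  measurable [set w | in_box a b (Y w)].
Proof.
move=> mY; apply: measurable_forall_fin => i.
have := measurable_coord_itv `[a ord0 i, b ord0 i] (mY i).
by congr measurable; apply/seteqP; split => w /=; rewrite in_itv.
Qed.

Lemma Pr_full_eq (A B N : set T) : measurable A -> measurable B -> measurable N ->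
  Pr P N = 1 -> A `&` N = B `&` N -> Pr P A = Pr P B.
Proof.
move=> mA mB mN N1 AB; rewrite (PrDI P mA mN) (PrDI P mB mN) AB; congr (_ + _).
have NC : Pr P (~` N) = 0.
  have := PrDI P measurableT mN; rewrite setTI setTD N1.
  have -> : Pr P setT = 1 by rewrite /Pr probability_setT.
  by move/eqP; rewrite -subr_eq0 opprD addrA subrr sub0r oppr_eq0 => /eqP.
have H E : measurable E -> Pr P (E `\` N) = 0.
  move=> mE; apply/eqP; rewrite eq_le Pr_ge0 andbT -NC Pr_le//.
  - exact: measurableD.
  - exact: measurableC.
by rewrite (H A)// (H B).
Qed.

Lemma Pr_bigcap1 (N : nat -> set T) : (forall k, measurable (N k)) ->
  (forall k, Pr P (N k) = 1) -> Pr P (\bigcap_k N k) = 1.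
Proof.
move=> mN N1.
have mI : measurable (\bigcap_k N k) by exact: bigcapT_measurable.
have C0 E : measurable E -> Pr P E = 1 -> P (~` E) = 0%E.
  move=> mE E1; rewrite (@probability_setC _ _ _ P E)// PrE// E1.
  by rewrite subee.
have : P (~` \bigcap_k N k) = 0%E.
  apply: measure_negligible; first exact: measurableC.
  rewrite setC_bigcap; apply: negligible_bigcup => k.
  by apply: (negligibleP P (measurableC (mN k))).2; exact: C0.
rewrite (@probability_setC _ _ _ P)// PrE// -EFinB => -[] /eqP.
by rewrite subr_eq0 => /eqP <-.
Qed.

Definition box_events (X : nat -> T -> 'rV[R]_d) (i : nat) : set (set T) :=
  [set B | exists a b, B = [set w | in_box a b (X i w)]].

Section iid.
Variables (X : nat -> T -> 'rV[R]_d) (f : 'rV[R]_d -> R).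
Hypothesis hX : iid_density P X f.

Lemma measurable_box_events i B : box_events X i B -> measurable B.
Proof. by case=> a [b ->]; apply: measurable_in_box; exact: hX.1. Qed.

Lemma indep_from_iid : indep_from P (box_events X) setT 0.
Proof.
split=> // s B us _ VB.
have [a /choice[b BE]] : exists a : nat -> 'rV[R]_d, forall i, exists b, i \in s ->
    B i = [set w | in_box (a i) b (X i w)].
  have : forall i, exists a, exists b, i \in s -> B i = [set w | in_box a b (X i w)].
    move=> i; have [/VB[a [b BE]]|_] := boolP (i \in s); first by exists a, b.
    by exists 0, 0.
  by move=> /choice[a Ha]; exists a.
rewrite setTI /Pr probability_setT mul1r.
have -> : cylinder s B = [set w | forall i, i \in s -> in_box (a i) (b i) (X i w)].
  by apply/seteqP; split=> w H i si; have := H i si; rewrite BE.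
rewrite (hX.2.1 s a b us); apply: EFin_inj; rewrite fineK; last first.
  rewrite -hX.2.1// fin_num_measure//.
  have -> : [set w | forall i, i \in s -> in_box (a i) (b i) (X i w)] = cylinder s B.
    by apply/seteqP; split=> w H i si; have := H i si; rewrite BE.
  by apply: measurable_cylinder => i /VB/measurable_box_events.
rewrite (big_morph EFin EFinM erefl).
apply: eq_big_seq => i si; rewrite BE// fineK// fin_num_measure//.
by apply: measurable_in_box; exact: hX.1.
Qed.

Lemma Pr_in_box k a b : leqv a b -> Pr P [set w | in_box a b (X k w)] =
  fine (box_integral (fun x => (f x)%:E) a b).
Proof. by move=> ab; rewrite /Pr hX.2.2. Qed.

Lemma Pr_in_box_le k a b (M : R) : 0 <= M -> leqv a b -> (forall x, 0 <= f x) ->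
  (forall x, in_box a b x -> f x <= M) ->
  Pr P [set w | in_box a b (X k w)] <= M * \prod_i (b ord0 i - a ord0 i).
Proof.
move=> M0 ab f0 fM; rewrite -lee_fin -PrE; last first.
  by apply: measurable_in_box; exact: hX.1.
by rewrite hX.2.2//; apply: box_integral_le => // y; rewrite lee_fin; exact: fM.
Qed.

End iid.
End RandomVectors.

(** * Uniform points built from the sample *)

Section Uniformization.
Context {R : realType} {d : nat} {dT : measure_display} {T : measurableType dT}.
Variables (P : probability T R) (X : nat -> T -> 'rV[R]_d) (f : 'rV[R]_d -> R).
Hypothesis hX : iid_density P X f.
Variables (M D : R) (l0 : 'I_d).
Hypotheses (f_ge0 : forall x, 0 <= f x) (f_le : forall x, f x <= M) (D_gt0 : 0 < D).
Hypothesis f_mass : box_integral (fun x => (f x)%:E) (const_mx 0) (const_mx D) = 1%E.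
Local Notation Pr := (Pr P).

(** The law of a sample is given on bounded boxes, while a condition on one coordinate describes an
    unbounded slab. On the almost sure event [N] such a slab coincides with a box. *)
Let big k := [set w | in_box (const_mx 0) (const_mx D) (X k w)].
Let N := \bigcap_k big k.
Let g k w := X k w ord0 l0.

Let M_ge0 : 0 <= M. Proof. exact: le_trans (f_ge0 0) (f_le 0). Qed.

Let mbig k : measurable (big k).
Proof. by apply: measurable_in_box; exact: hX.1. Qed.

Let leqv0D : leqv (const_mx 0) (const_mx D : 'rV[R]_d).
Proof. by apply/forallP => i; rewrite !mxE ltW. Qed.

Let big1 k : Pr (big k) = 1.
Proof. by rewrite (Pr_in_box hX)// f_mass. Qed.

Let mN : measurable N. Proof. exact: bigcapT_measurable. Qed.
Let N1 : Pr N = 1. Proof. exact: Pr_bigcap1. Qed.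

Let mg k i : measurable [set w | g k w \in (i : interval R)].
Proof. by apply: measurable_coord_itv; exact: hX.1. Qed.

Let mgcc k s t : measurable [set w | s <= g k w <= t].
Proof. by have := mg k `[s, t]; congr measurable; apply/seteqP; split=> w /=;
    rewrite in_itv. Qed.

Let slo s : 'rV[R]_d := \row_i (if i == l0 then s else 0).
Let shi t : 'rV[R]_d := \row_i (if i == l0 then t else D).

Let slab_eq k s t : [set w | s <= g k w <= t] `&` big k =
  [set w | in_box (slo s) (shi t) (X k w)] `&` big k.
Proof.
apply/seteqP; split=> w [/= st bw]; split=> //.
  move=> i; rewrite !mxE; case: eqVneq => [->//|_].
  by have := bw i; rewrite !mxE.
by have := st l0; rewrite !mxE eqxx.
Qed.

Let Pr_slab k s t : Pr [set w | s <= g k w <= t] = Pr [set w | in_box (slo s) (shi t)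
    (X k w)].
Proof.
apply: Pr_full_eq (slab_eq k s t) => //; exact: (measurable_in_box _ _ (hX.1 k)).
Qed.

Let leqv_slab s t : s <= t -> leqv (slo s) (shi t).
Proof. by move=> st; apply/forallP => i; rewrite !mxE; case: ifP => // _; exact: ltW. Qed.

Let C := M * \prod_(i < d | i != l0) D.

Let C_ge0 : 0 <= C.
Proof. by rewrite mulr_ge0// prodr_ge0// => i _; exact: ltW. Qed.

Let Pr_slab_le k s t : s <= t -> Pr [set w | s <= g k w <= t] <= C * (t - s).
Proof.
move=> st; rewrite Pr_slab; apply: le_trans (Pr_in_box_le hX _ M_ge0 (leqv_slab st) _
    _) _ => //.
rewrite (bigD1 l0)//= !mxE eqxx /C -mulrA [X in M * X]mulrC ler_wpM2l//.
rewrite ler_wpM2r ?subr_ge0//; apply: ler_prod => i il; rewrite !mxE (negPf il) subr0.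
by rewrite lexx ltW.
Qed.

Definition cdf0 t : R := Pr [set w | X 0%N w ord0 l0 <= t].
Local Notation F := cdf0.

Let mgle k t : measurable [set w | g k w <= t].
Proof. by have := mg k `]-oo, t]; congr measurable; apply/seteqP; split=> w /=;
    rewrite in_itv. Qed.

(** Slabs of width zero carry no mass, so closed and half-open slabs have equal probability; this
    probability depends on the common law only, hence not on [k]. *)
Let cdf0_diff k s t : s <= t -> F t - F s = Pr [set w | s <= g k w <= t].
Proof.
move=> st; have -> : Pr [set w | s <= g k w <= t] = Pr [set w | s <= g 0%N w <= t].
  by rewrite !Pr_slab !(Pr_in_box hX)//; exact: leqv_slab.
have Ft : F t = F s + Pr ([set w | g 0%N w <= t] `\` [set w | g 0%N w <= s]).
  rewrite /F (PrDI P (mgle 0 t) (mgle 0 s)); congr (Pr _ + _).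
  by apply/seteqP; split=> w /=; [case|move=> ws; split=> //; exact: le_trans st].
rewrite Ft addrC addKr.
rewrite (PrDI P (mgcc 0 s t) (mgle 0 s)).
have -> : Pr ([set w | s <= g 0%N w <= t] `&` [set w | g 0%N w <= s]) = 0.
  apply/eqP; rewrite eq_le Pr_ge0 andbT.
  apply: (@le_trans _ _ (Pr [set w | s <= g 0%N w <= s])).
    by apply: Pr_le => // [|w [/andP[/= -> _] ->]//]; exact: measurableI.
  by rewrite (le_trans (Pr_slab_le _ _))// subrr mulr0.
rewrite add0r; congr Pr; apply/seteqP; split=> w [/=].
  by move=> wt ws; split=> //; rewrite wt andbT ltW// ltNge; exact/negP.
by move=> /andP[_ wt] ws.
Qed.

Lemma cdf0_le s t : s <= t -> F s <= F t.
Proof. by move=> st; rewrite -subr_ge0 (cdf0_diff 0)// Pr_ge0. Qed.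

Let cdf0_lip s t : s <= t -> F t <= F s + C * (t - s).
Proof. by move=> st; rewrite -lerBlDl (cdf0_diff 0)// Pr_slab_le. Qed.

Let cdf0_0 : F 0 = 0.
Proof.
apply/eqP; rewrite eq_le Pr_ge0 andbT.
have -> : F 0 = Pr [set w | 0 <= g 0%N w <= 0].
  apply: (Pr_full_eq (mgle 0%N 0) (mgcc 0%N 0 0) (mbig 0%N) (big1 0%N)).
  apply/seteqP; split=> w [/= w0 bw]; split=> //.
    by rewrite w0 andbT; have := bw l0; rewrite !mxE => /andP[].
  by case/andP: w0.
by rewrite (le_trans (Pr_slab_le _ _))// subrr mulr0.
Qed.

Let cdf0_D : F D = 1.
Proof.
apply/eqP; rewrite eq_le; apply/andP; split; first exact: Pr_le1 (mgle 0%N D).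
apply: (@le_trans _ _ (Pr (big 0%N))); first by rewrite (big1 0%N).
apply: (Pr_le P (mbig 0%N) (mgle 0%N D)) => w /= /(_ l0); by rewrite !mxE => /andP[].
Qed.

Let cdf0_itv t : 0 <= F t <= 1.
Proof. by rewrite Pr_ge0 (Pr_le1 P (mgle 0%N t)). Qed.

Let Ce e : 0 < e -> C * (e / (C + 1)) <= e.
Proof.
move=> e0; rewrite mulrA ler_pdivrMr ?ltr_wpDl// mulrC ler_wpM2l ?lerDl//.
exact: ltW.
Qed.

(** The least point where [F] reaches [a]. The equivalence turns a bound on [F] into a bound on the
    coordinate; continuity of [F] gives the exact value [F q = a], needed for the probability of the
    slab. *)
Let quantile_lo a : 0 <= a <= 1 -> exists q, [/\ 0 <= q <= D, F q = a &
  forall x, 0 <= x <= D -> (a <= F x) = (q <= x)].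
Proof.
move=> /andP[a0 a1]; pose S := [set x | 0 <= x <= D /\ a <= F x].
have SD : S D by split; [rewrite lexx ltW|rewrite cdf0_D].
have Slb : has_lbound S by exists 0 => x [/andP[]].
have Sinf : has_inf S by split=> //; exists D.
have q0 : 0 <= inf S by apply: lb_le_inf; [exists D|move=> x [/andP[]]].
have qD : inf S <= D by exact: ge_inf.
have Fq : F (inf S) >= a.
  apply/ler_addgt0Pr => e e0.
  (* A step of this length changes [F] by at most [e]; the denominator [C + 1] is positive even if
     [C = 0]. *)
  have e'0 : 0 < e / (C + 1) by rewrite divr_gt0// ltr_wpDl.
  have [x [/andP[x0 xD] ax] xq] := inf_adherent e'0 Sinf.
  have qx : inf S <= x by apply: ge_inf => //; split=> //; rewrite x0 xD.
  apply: (le_trans ax); apply: le_trans (cdf0_lip qx) _; rewrite lerD2l.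
  apply: (@le_trans _ _ (C * (e / (C + 1)))).
    by rewrite ler_wpM2l// lerBlDl ltW.
  exact: Ce.
have aF x : 0 <= x <= D -> (a <= F x) = (inf S <= x).
  move=> xD; apply/idP/idP => [ax|qx]; first exact: ge_inf.
  exact: le_trans Fq (cdf0_le qx).
exists (inf S); split=> //; first by rewrite q0.
apply/eqP; rewrite eq_le Fq andbT; have [qe|qn] := eqVneq (inf S) 0.
  by rewrite qe cdf0_0.
have {q0 qn} q0 : 0 < inf S by rewrite lt_def qn.
apply/ler_addgt0Pr => e e0.
have e'0 : 0 < e / (C + 1) by rewrite divr_gt0// ltr_wpDl.
pose x := Num.max 0 (inf S - e / (C + 1)).
have xq : x < inf S by rewrite gt_max q0 ltrBlDr ltrDl.
have x0 : 0 <= x by rewrite le_max lexx.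
have Fx : F x < a by rewrite ltNge aF -?ltNge// x0 (le_trans (ltW xq)).
apply: le_trans (cdf0_lip (ltW xq)) _; apply: lerD; first exact: ltW.
apply: (@le_trans _ _ (C * (e / (C + 1)))).
  by rewrite ler_wpM2l// lerBlDl -lerBlDr le_max lexx orbT.
exact: Ce.
Qed.

Let quantile_hi b : 0 <= b <= 1 -> exists q, [/\ 0 <= q <= D, F q = b &
  forall x, 0 <= x <= D -> (F x <= b) = (x <= q)].
Proof.
move=> /andP[b0 b1]; pose S := [set x | 0 <= x <= D /\ F x <= b].
have S0 : S 0 by split; [rewrite lexx ltW|rewrite cdf0_0].
have Sub : has_ubound S by exists D => x [/andP[]].
have Ssup : has_sup S by split=> //; exists 0.
have qD : sup S <= D by apply: ge_sup; [exists 0|move=> x [/andP[]]].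
have q0 : 0 <= sup S by exact: ub_le_sup.
have Fq : F (sup S) <= b.
  apply/ler_addgt0Pr => e e0.
  have e'0 : 0 < e / (C + 1) by rewrite divr_gt0// ltr_wpDl.
  have [x [/andP[x0 xD] xb] xq] := sup_adherent e'0 Ssup.
  have qx : x <= sup S by apply: ub_le_sup => //; split=> //; rewrite x0 xD.
  apply: le_trans (cdf0_lip qx) _; apply: lerD => //.
  apply: (@le_trans _ _ (C * (e / (C + 1)))).
    by rewrite ler_wpM2l// lerBlDl -lerBlDr ltW.
  exact: Ce.
have bF x : 0 <= x <= D -> (F x <= b) = (x <= sup S).
  move=> xD; apply/idP/idP => [ax|qx]; first exact: ub_le_sup.
  exact: le_trans (cdf0_le qx) Fq.
exists (sup S); split=> //; first by rewrite q0.
apply/eqP; rewrite eq_le Fq /=; have [qe|qn] := eqVneq D (sup S).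
  by rewrite -qe cdf0_D.
have {qD qn} qD : sup S < D by rewrite lt_def qn.
apply/ler_addgt0Pr => e e0.
have e'0 : 0 < e / (C + 1) by rewrite divr_gt0// ltr_wpDl.
pose x := Num.min D (sup S + e / (C + 1)).
have xq : sup S < x by rewrite lt_min qD ltrDl.
have xD : x <= D by rewrite ge_min lexx.
have Fx : b < F x by rewrite ltNge bF -?ltNge// xD (le_trans q0 (ltW xq)).
apply: (le_trans (ltW Fx)); apply: le_trans (cdf0_lip (ltW xq)) _; rewrite lerD2l.
apply: (@le_trans _ _ (C * (e / (C + 1)))).
  by rewrite ler_wpM2l// lerBlDl ge_min lexx orbT.
exact: Ce.
Qed.

Let cdf0_event a b : exists uv : 'rV[R]_d * 'rV[R]_d, forall k,
  [set w | a <= F (g k w) <= b] `&` N = [set w | in_box uv.1 uv.2 (X k w)] `&` N /\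
  Pr [set w | in_box uv.1 uv.2 (X k w)] = unit_overlap a b.
Proof.
have [ab|ba] := leP (Num.max a 0) (Num.min b 1); last first.
  (* Bounds in the wrong order give an empty box for an event that cannot occur. *)
  exists (slo 1, shi 0) => k.
  have -> : [set w | in_box (slo 1) (shi 0) (X k w)] = set0.
    apply/seteqP; split=> // w /(_ l0); rewrite !mxE eqxx => /andP[/le_trans H /H].
    by rewrite ler10.
  split; last by rewrite /Pr measure0 /unit_overlap [Num.max 0 _]max_l// subr_le0 ltW.
  rewrite set0I; apply/seteqP; split=> // w [/= /andP[aF Fb] _].
  have /andP[F0 F1] := cdf0_itv (g k w).
  move: ba; rewrite ltNge le_min !ge_max (le_trans aF Fb) (le_trans F0 Fb).
  by rewrite (le_trans aF F1) ler01.
have mm01 : 0 <= Num.max a 0 <= 1 /\ 0 <= Num.min b 1 <= 1.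
  have h1 : 0 <= Num.max a 0 by rewrite le_max lexx orbT.
  have h2 : Num.min b 1 <= 1 by rewrite ge_min lexx orbT.
  by rewrite h1 h2 (le_trans ab h2) (le_trans h1 ab).
have [p [pD Fp pP]] := quantile_lo mm01.1.
have [q [qD Fq qP]] := quantile_hi mm01.2.
have pq : p <= q by rewrite -pP// Fq.
exists (slo p, shi q) => k; split; last first.
  rewrite /= -Pr_slab -cdf0_diff// Fp Fq /unit_overlap [Num.max 0 _]max_r//.
  by rewrite subr_ge0.
have -> : [set w | in_box (slo p) (shi q) (X k w)] `&` N = [set w | p <= g k w <= q] `&` N.
  have NE : N = big k `&` N by rewrite setIC; apply/esym/setIidPl => w; apply.
  by rewrite NE !setIA -slab_eq.
apply/seteqP; split=> w [/= H Nw]; split=> //=.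
  have gD : 0 <= g k w <= D by have := Nw k I l0; rewrite !mxE.
  rewrite -pP// -qP// ge_max le_min; have /andP[-> ->] := cdf0_itv (g k w).
  by rewrite !andbT.
have gD : 0 <= g k w <= D by have := Nw k I l0; rewrite !mxE.
by move: H; rewrite -pP// -qP// ge_max le_min => /andP[/andP[-> _] /andP[-> _]].
Qed.

Let mcdf0 a b k : measurable [set w | a <= F (g k w) <= b].
Proof.
have mF : measurable_fun setT (F \o g k).
  apply: measurableT_comp; last exact: hX.1.
  by apply: nondecreasing_measurable => // s t; exact: cdf0_le.
have := measurable_coord_itv `[a, b] mF.
by congr measurable; apply/seteqP; split=> w /=; rewrite in_itv.
Qed.

Let cdf0_cylinder (s : seq nat) (a b : nat -> R) : uniq s ->
  Pr [set w | forall k, k \in s -> a k <= F (g k w) <= b k] =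
  \prod_(k <- s) unit_overlap (a k) (b k).
Proof.
move=> us; have [uv uvP] := choice (fun k => cdf0_event (a k) (b k)).
pose B k := [set w | in_box (uv k).1 (uv k).2 (X k w)].
have VB k : box_events X k (B k) by exists (uv k).1, (uv k).2.
have mB k : measurable (B k) := measurable_box_events hX (VB k).
have [_ /(_ s B us)] := indep_from_iid hX.
rewrite setTI /(Pr setT) probability_setT mul1r => H.
transitivity (Pr (cylinder s B)).
  apply: (Pr_full_eq _ _ mN N1).
  - exact: (@measurable_cylinder _ _ s (fun k => [set w | a k <= F (g k w) <= b k])).
  - exact: measurable_cylinder.
  - apply/seteqP; split=> w [/= H1 Nw]; split=> // k ks.
      have [E _] := uvP k k; suff : (B k `&` N) w by case.
      by rewrite /B -E; split=> //; exact: H1.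
    have [E _] := uvP k k; suff : ([set w | a k <= F (g k w) <= b k] `&` N) w by case.
    by rewrite E; split=> //; exact: H1.
by rewrite H//; apply: eq_bigr => k _; have [_ ->] := uvP k k.
Qed.

(* Consecutive blocks of [d] samples provide the coordinates of one uniform
   point, so the probability space of [X] already carries an i.i.d. uniform
   sequence. *)
Definition uniformized (j : nat) (w : T) : 'rV[R]_d :=
  \row_(i < d) F (X (j * d + i)%N w ord0 l0).
Local Notation Y := uniformized.

Let Pr_uniformized (s : seq nat) (a b : nat -> 'rV[R]_d) : uniq s ->
  Pr [set w | forall j, j \in s -> in_box (a j) (b j) (Y j w)] =
  \prod_(j <- s) \prod_i unit_overlap (a j ord0 i) (b j ord0 i).
Proof.
move=> us; have d0 : (0 < d)%N by case: (d) l0 => // -[].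
(* Sample [k] supplies coordinate [k %% d] of point [k %/ d]. Different coordinates thus come from
   different samples, which makes them independent. *)
pose crd k : 'I_d := Ordinal (ltn_pmod k d0).
pose a' k := a (k %/ d)%N ord0 (crd k); pose b' k := b (k %/ d)%N ord0 (crd k).
have dE j (i : 'I_d) : ((j * d + i) %/ d)%N = j.
  by rewrite divnMDl// divn_small// addn0.
have mE j (i : 'I_d) : crd (j * d + i)%N = i.
  by apply: val_inj; rewrite /= modnMDl modn_small.
pose s' := [seq (j * d + val i)%N | j <- s, i <- enum 'I_d].
have us' : uniq s'.
  apply: allpairs_uniq; rewrite ?enum_uniq// => -[j i] [j' i'] _ _ /= e.
  have jj : j = j' by rewrite -(dE j i) -(dE j' i') e.
  by rewrite jj; congr pair; rewrite -(mE j i) -(mE j' i') e.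
have -> : [set w | forall j, j \in s -> in_box (a j) (b j) (Y j w)] =
   [set w | forall k, k \in s' -> a' k <= F (g k w) <= b' k].
  apply/seteqP; split=> w /= H.
    move=> k /allpairsP[[j i] /= [js _ ->]].
    by have := H j js i; rewrite /a' /b' dE mE mxE.
  move=> j js i; have := H (j * d + i)%N; rewrite /a' /b' dE mE mxE; apply.
  by apply/allpairsP; exists (j, i); rewrite mem_enum.
rewrite cdf0_cylinder// big_allpairs_dep; apply: eq_bigr => j _.
by rewrite big_enum; apply: eq_bigr => i _; rewrite /a' /b' dE mE.
Qed.

Lemma iid_uniformized : iid_density P uniformized (@unit_cube_density R d).
Proof.
have mY i : is_rvec (Y i).
  move=> l; have -> : (fun w => Y i w ord0 l) = F \o g (i * d + l)%N.
    by apply/funext => w; rewrite mxE.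
  apply: measurableT_comp; last exact: hX.1.
  by apply: nondecreasing_measurable => // s t; exact: cdf0_le.
have Y1 j a b : P [set w | in_box a b (Y j w)] =
    (\prod_i unit_overlap (a ord0 i) (b ord0 i))%:E.
  rewrite PrE; last exact: measurable_in_box.
  congr EFin; have := @Pr_uniformized [:: j] (fun=> a) (fun=> b) erefl.
  rewrite big_seq1 => <-; congr Pr; apply/seteqP; split=> w /= H.
    by move=> i; rewrite inE => /eqP->.
  by apply: H; rewrite inE.
split=> //; split.
  move=> s a b us.
  rewrite PrE; last first.
    exact: (@measurable_cylinder _ _ s (fun j => [set w | in_box (a j) (b j) (Y j w)])
      (fun j _ => measurable_in_box _ _ (mY j))).
  rewrite Pr_uniformized// (big_morph EFin EFinM erefl).
  by apply: eq_bigr => j _; rewrite Y1.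
by move=> j a b ab; rewrite box_integral_unit_cube Y1.
Qed.

End Uniformization.

Section CellProbabilities.
Context {R : realType} {d : nat} {dT : measure_display} {T : measurableType dT}.
Variables (P : probability T R) (X : nat -> T -> 'rV[R]_d) (f : 'rV[R]_d -> R).
Hypothesis hX : iid_density P X f.
Hypothesis f_ge0 : forall x, 0 <= f x.
Variable M : R.
Hypothesis f_le : forall x, f x <= M.
Variables (a b : 'rV[R]_d) (m : nat).
Hypothesis ab : forall i, a ord0 i < b ord0 i.
Local Notation Pr := (Pr P).
Local Notation K := (cell (d := d) m).
Local Notation grid := (grid a b m).

Definition cell_lo (c : K) : 'rV[R]_d := \row_i grid i (c i).
Definition cell_hi (c : K) : 'rV[R]_d := \row_i grid i (c i).+1.
Definition cell_mass (c : K) : R :=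
  fine (box_integral (fun x => (f x)%:E) (cell_lo c) (cell_hi c)).
Definition letter i w : option K := cell_of a b m (X i w).

Let leqv_cell c : leqv (cell_lo c) (cell_hi c).
Proof. by apply/forallP => i; rewrite !mxE ler_grid// leqnSn. Qed.

Let cell_side c i : cell_hi c ord0 i - cell_lo c ord0 i = (b ord0 i - a ord0 i) / m.+1%:R.
Proof. by rewrite !mxE grid_step. Qed.

Lemma measurable_in_cell i (c : K) : measurable [set w | in_cell a b c (X i w)].
Proof.
have -> : [set w | in_cell a b c (X i w)] =
    [set w | forall l, X i w ord0 l \in `[grid l (c l), grid l (c l).+1[].
  apply/seteqP; split=> w /=; first by move=> /forallP H l; rewrite in_itv /= H.
  by move=> H; apply/forallP => l; have := H l; rewrite in_itv.
by apply: measurable_forall_fin => l; apply: measurable_coord_itv; exact: hX.1.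
Qed.

Lemma letter_SomeE i (c : K) : [set w | letter i w = Some c] = [set w | in_cell a b c
    (X i w)].
Proof. by apply/seteqP; split => w /=; rewrite /letter => /(cell_ofP ab). Qed.

Lemma measurable_letter i o : measurable [set w | letter i w = o].
Proof.
case: o => [c|]; first by rewrite letter_SomeE; exact: measurable_in_cell.
have -> : [set w | letter i w = None] = ~` \bigcup_(c in [set: K]) [set w | letter i w
    = Some c].
  apply/seteqP; split=> w /=; first by move=> ln [c _ /=]; rewrite ln.
  by case E: (letter i w) => [c|]// H; case: H; exists c.
apply: measurableC; apply: fin_bigcup_measurable => [|c _]; first exact: finite_finset.
by rewrite letter_SomeE; exact: measurable_in_cell.
Qed.

Let measurable_box i u v : measurable [set w | in_box u v (X i w)].
Proof. by apply: measurable_in_box; exact: hX.1. Qed.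

Let M_ge0 : 0 <= M. Proof. exact: le_trans (f_ge0 0) (f_le 0). Qed.

(** The closed box exceeds the half-open cell only by upper faces. These are degenerate boxes, of
    mass zero because [f] is bounded. *)
Lemma letter_box_event i c : exists B, [/\ box_events X i B,
  [set w | letter i w = Some c] `<=` B, Pr (B `\` [set w | letter i w = Some c]) = 0 &
  Pr B = cell_mass c].
Proof.
exists [set w | in_box (cell_lo c) (cell_hi c) (X i w)]; split.
- by exists (cell_lo c), (cell_hi c).
- rewrite letter_SomeE => w /forallP H l; rewrite !mxE.
  by have /andP[-> /ltW] := H l.
- pose face l : 'rV[R]_d := \row_j (if j == l then cell_hi c ord0 j else cell_lo c ord0 j).
  have leF l : leqv (face l) (cell_hi c).
    apply/forallP => j; rewrite mxE; case: ifP => // _.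
    by move: (leqv_cell c) => /forallP.
  have F0 l : Pr [set w | in_box (face l) (cell_hi c) (X i w)] = 0.
    apply/eqP; rewrite eq_le Pr_ge0 andbT.
    apply: le_trans (Pr_in_box_le hX _ M_ge0 (leF l) _ _) _ => //.
    by rewrite (bigD1 l)//= [face l _ _]mxE eqxx subrr mul0r mulr0.
  apply/eqP; rewrite eq_le Pr_ge0 andbT.
  apply: (@le_trans _ _ (Pr (\big[setU/set0]_l [set w | in_box (face l) (cell_hi c) (X
      i w)]))).
    apply: Pr_le.
    + by apply: measurableD => //; exact: measurable_letter.
    + by apply: bigsetU_measurable => l _.
    + rewrite letter_SomeE => w [/= H]; rewrite /in_cell => /negP.
      rewrite negb_forall => /existsP[l nl]; rewrite -bigcup_seq.
      exists l => [|j]; [exact: mem_index_enum|rewrite !mxE; have := H j; rewrite !mxE].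
      case: eqVneq => [->|_ //].
      by move=> /andP[h1 h2]; rewrite h2 andbT; move: nl; rewrite h1 /= -leNgt.
  apply: le_trans (Pr_bigcup_le _ _ _) _ => //.
  by rewrite big1.
- by rewrite (Pr_in_box hX).
Qed.

Lemma cell_mass_ge0 c : 0 <= cell_mass c.
Proof. by rewrite /cell_mass -(Pr_in_box hX 0) ?Pr_ge0. Qed.

Lemma cell_mass_le (q : R) c : 0 <= q -> (forall x, in_box a b x -> f x <= q) ->
  cell_mass c <= q * \prod_i (b ord0 i - a ord0 i) * m.+1%:R ^- d.
Proof.
move=> q0 fq; rewrite /cell_mass -(Pr_in_box hX 0)//.
apply: le_trans (Pr_in_box_le hX 0 q0 _ _ _) _ => //.
  move=> x cx; apply: fq => i; have := cx i; rewrite !mxE => /andP[h1 h2].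
  rewrite -(grid0 a b m) -(gridT a b m); apply/andP; split.
    by apply: le_trans h1; rewrite ler_grid.
  by apply: (le_trans h2); rewrite ler_grid.
rewrite -mulrA ler_wpM2l//.
under eq_bigr do rewrite cell_side.
by rewrite big_split /= prodr_const card_ord exprVn.
Qed.

Lemma Pr_word i n (G : pred (seq K)) :
  Pr [set w | G (word letter w i n)] = word_prob cell_mass n G.
Proof.
have H := indep_from_word (measurable_box_events hX) measurable_letter letter_box_event
  n G (indep_fromW (leq0n i) (indep_from_iid hX)).
have [_] := H; rewrite setTI => ->.
by rewrite /(Pr setT) probability_setT mul1r.
Qed.

Lemma Pr_word_thinning (q l : R) n N (G : pred (seq K)) : 0 <= q ->
  (forall x, in_box a b x -> f x <= q) -> q * \prod_i (b ord0 i - a ord0 i) <= 1 ->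
  1 <= l -> subseq_monotone G ->
  Pr [set w | G (word letter w 0 n)] <=
  word_prob (fun=> m.+1%:R ^- d) N G +
  l ^- N * (1 + q * \prod_i (b ord0 i - a ord0 i) * (l - 1)) ^+ n.
Proof.
move=> q0 fq p1 l1 GM; rewrite Pr_word; apply: word_prob_thinning => //.
- exact: cell_mass_ge0.
- exact: cell_uniform_sum.
- by move=> c; exact: cell_mass_le.
- rewrite p1 andbT mulr_ge0// prodr_ge0// => i _; by rewrite subr_ge0 ltW.
Qed.

End CellProbabilities.

Lemma cell_mass_unit_cube (R : realType) (d m : nat) (c : cell m) :
  cell_mass (@unit_cube_density R d) (const_mx 0) (const_mx 1) c = m.+1%:R ^- d.
Proof.
have ab i : (const_mx 0 : 'rV[R]_d) ord0 i < (const_mx 1 : 'rV[R]_d) ord0 i.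
  by rewrite !mxE ltr01.
rewrite /cell_mass box_integral_unit_cube /=.
transitivity (\prod_(i < d) (m.+1%:R^-1 : R)); last by rewrite prodr_const card_ord exprVn.
apply: eq_bigr => i _; rewrite /unit_overlap !mxE.
have g0 : 0 <= grid (const_mx 0) (const_mx 1) m i (c i) :> R.
  by rewrite -[leLHS](_ : grid (const_mx 0) (const_mx 1) m i 0 = 0) ?ler_grid// grid0 mxE.
have g1 : grid (const_mx 0) (const_mx 1) m i (c i).+1 <= 1 :> R.
  rewrite -[leRHS](_ : grid (const_mx 0) (const_mx 1) m i m.+1 = 1) ?ler_grid//.
  by rewrite gridT mxE.
rewrite (min_l g1) (max_l g0) grid_step !mxE subr0 mul1r max_r//.
Qed.

(** * Almost sure bounds for chains in a box *)

Section RareEvents.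
Context {R : realType} {dT : measure_display} {T : measurableType dT}.
Variable P : probability T R.
Local Notation Pr := (Pr P).

Lemma eventually_notin (E : nat -> set T) (B : R) : (forall j, measurable (E j)) ->
  (forall J, \sum_(j < J) Pr (E j) <= B) ->
  {ae P, forall w, exists J, forall j, (J <= j)%N -> ~ E j w}.
Proof.
move=> mE EB.
have L0 : P (lim_sup_set E) = 0%E.
  apply: lim_sup_set_cvg0 => //; apply: (@le_lt_trans _ _ B%:E); last exact: ltry.
  apply: lime_le; first by apply: is_cvg_nneseries => n _ _; exact: measure_ge0.
  apply: nearW => J; rewrite big_mkord.
  rewrite (eq_bigr (fun j : 'I_J => (Pr (E j))%:E)); last by move=> j _; exact: PrE.
  by rewrite sumEFin lee_fin; exact: EB.
exists (lim_sup_set E); split=> //.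
  by apply: bigcapT_measurable => n; apply: bigcup_measurable.
move=> w /= H n _; apply: contrapT => nE; apply: H; exists n => j nj Ej; apply: nE.
by exists j.
Qed.

(* The second Borel-Cantelli lemma in contrapositive form, obtained from
   [prod (1 - q_j) * (1 + sum q_j) <= 1]. *)
Lemma eventually_disjoint_sum_bounded (E : nat -> set T) (q : nat -> R) :
  (forall j, measurable (E j)) -> (forall j, 0 <= q j <= 1) ->
  (forall J n, Pr (\bigcap_(j in [set j | J <= j < J + n]%N) ~` E j) =
               \prod_(J <= j < J + n) (1 - q j)) ->
  {ae P, forall w, exists J, forall j, (J <= j)%N -> ~ E j w} ->
  exists B, forall J, \sum_(j < J) q j <= B.
Proof.
move=> mE q01 indE evE.
pose S J := \bigcap_(j in [set j | J <= j]%N) ~` E j.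
have mS J : measurable (S J).
  by apply: bigcap_measurableType => j _; exact: measurableC.
(* By hypothesis the events [S J] cover almost the whole space, so one of them has positive
   probability; it bounds all products starting at [J] from below. *)
have [J SJ] : exists J, 0 < Pr (S J).
  apply: contrapT => H.
  have S0 J : P (S J) = 0%E.
    rewrite PrE//; congr EFin; apply/eqP; rewrite eq_le Pr_ge0 andbT leNgt.
    by apply/negP => SJ; apply: H; exists J.
  have : P.-negligible [set: T].
    have -> : [set: T] = (\bigcup_J S J) `|` ~` (\bigcup_J S J) by rewrite setUv.
    apply: negligibleU.
      by apply: negligible_bigcup => J; apply: (negligibleP P (mS J)).2; exact: S0.
    apply: negligibleS evE => w /= nS [J HJ]; by apply: nS; exists J.
  move=> /(negligibleP P measurableT).1 PT0.
  by have := probability_setT P; rewrite PT0 => /eqP; rewrite eq_sym onee_eq0.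
set dl := Pr (S J) in SJ.
exists (\sum_(j < J) q j + dl^-1) => K.
have prod_le n : \prod_(J <= j < J + n) (1 - q j) * (1 + \sum_(J <= j < J + n) q j) <= 1.
  elim: n => [|n IH]; first by rewrite addn0 !big_geq// addr0 mulr1.
  rewrite addnS !big_nat_recr ?leq_addr//=.
  set p0 := \prod_(_ <= _ < _) _ in IH *; set s0 := \sum_(_ <= _ < _) _ in IH *.
  have s00 : 0 <= s0 by apply: sumr_ge0 => j _; have /andP[] := q01 j.
  have p00 : 0 <= p0 by apply: prodr_ge0 => j _; rewrite subr_ge0; have /andP[] := q01 j.
  have /andP[qj0 qj1] := q01 (J + n)%N.
  apply: le_trans IH; rewrite -mulrA ler_wpM2l//.
  move: (q (J + n)%N) qj0 qj1 => x x0 x1; nra.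
have dl_le n : dl <= \prod_(J <= j < J + n) (1 - q j).
  rewrite -indE; apply: Pr_le => //.
    by apply: bigcap_measurableType => j _; exact: measurableC.
  by move=> w Sw j /andP[Jj _]; exact: Sw.
have tail n : \sum_(J <= j < J + n) q j <= dl^-1.
  have s00 : 0 <= \sum_(J <= j < J + n) q j.
    by apply: sumr_ge0 => j _; have /andP[] := q01 j.
  rewrite -[dl^-1]mul1r ler_pdivlMr//.
  apply: le_trans (prod_le n); rewrite mulrC.
  apply: ler_pM => //; [exact: ltW|by rewrite lerDr].
have [KJ|JK] := leqP K J.
  rewrite -[leLHS]addr0; apply: lerD; last by rewrite invr_ge0 ltW.
  rewrite -!(big_mkord xpredT q) (big_cat_nat _ KJ)//= lerDl.
  by apply: sumr_ge0 => j _; have /andP[] := q01 j.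
rewrite -!(big_mkord xpredT q) (big_cat_nat _ (ltnW JK))//= lerD2l.
by have := tail (K - J)%N; rewrite subnKC// ltnW.
Qed.

End RareEvents.

Section UniformChains.
Context {R : realType} {d : nat}.
Hypothesis d_gt0 : (0 < d)%N.
Variable c : R.

Definition chain_threshold (C : R) (n : nat) : nat :=
  (Num.truncn (C * n%:R `^ (d%:R)^-1)).+1.

Definition uniform_chain_prob m n k : R :=
  word_prob (fun=> m.+1%:R ^- d) n (@has_chain d m k).

(* Chains in disjoint blocks of [al * r ^ j] uniform points are independent and
   cannot be long infinitely often, since the block dominates all its
   predecessors when [r] is large; hence the almost sure limit defining [c]
   yields summable probabilities. The mesh [m j] only has to be fine enough to
   make two points sharing a slab unlikely. *)
Lemma uniform_chain_prob_summable {dT : measure_display} {T : measurableType dT}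
    (P : probability T R) (Y : nat -> T -> 'rV[R]_d) (eps : R) :
  iid_density P Y (@unit_cube_density R d) -> is_chain_constant d c -> 0 < eps ->
  exists r0, forall r al, (r0 <= r)%N -> (0 < al)%N -> exists (m : nat -> nat) (B : R),
    forall J, \sum_(j < J) uniform_chain_prob (m j) (al * r ^ j)
                 (chain_threshold (c + eps) (al * r ^ j)) <= B.
Proof.
move=> hY [c0 hc] eps0.
have inv_d : 0 < (d%:R : R)^-1 <= 1.
  by rewrite invr_gt0 ltr0n d_gt0 invf_le1 ?ltr0n// ler1n.
(* For [r] at least [2 * (c + eps) / eps] one has [(c + eps / 2) * (r / (r - 1)) <= c + eps], which
   pays for the predecessors of a block. *)
exists (Num.truncn (2 * (c + eps) / eps)).+2 => r al r_ge al0.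
have r1 : (1 < r)%N by apply: leq_trans r_ge.
have r_big : 2 * (c + eps) / eps <= r%:R.
  have h : 0 <= 2 * (c + eps) / eps by rewrite divr_ge0 ?mulr_ge0 ?addr_ge0// ltW.
  have /andP[_ /ltW h2] := truncn_itv h; apply: (le_trans h2).
  by rewrite ler_nat; apply: leq_trans r_ge.
pose n j := (al * r ^ j)%N.
pose N j := (\sum_(i < j) n i)%N.
have NS j : N j.+1 = (N j + n j)%N by rewrite /N big_ord_recr.
have n0 j : (0 < n j)%N by rewrite /n muln_gt0 al0 expn_gt0 (ltnW r1).
have Nle j : (r.-1 * N j.+1 <= r * n j)%N.
  suff : (r.-1 * N j.+1 + al = r * n j)%N by move=> <-; exact: leq_addr.
  elim: j => [|j IH].
    by rewrite NS /N big_ord0 add0n /n expn0 muln1 -[X in (_ + X = _)%N]mul1n -mulnDl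
        addn1 prednK// ltnW.
  rewrite NS mulnDr addnAC IH /n expnS; move: (ltnW r1); case: (r) => // r' _ /=; nia.
have jn j : (j <= n j)%N.
  apply: (@leq_trans (r ^ j)); first exact: ltnW (ltn_expl j r1).
  by rewrite /n leq_pmull.
(* There are at most [n j ^ 2] pairs in a block, each failing separation with probability at most
   [d / (m j).+1], so block [j] fails with probability at most [2 ^- j]. *)
pose m j := (n j ^ 2 * d * 2 ^ j)%N.
pose k j := chain_threshold (c + eps) (n j).
exists m; pose q j := uniform_chain_prob (m j) (n j) (k j).
have u0 j : (forall _ : cell (d := d) (m j), 0 <= ((m j).+1%:R ^- d : R)).
  by move=> _; rewrite invr_ge0 exprn_ge0.
have u1 j := @cell_uniform_sum R d (m j).
have q01 j : 0 <= q j <= 1.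
  by rewrite /q /uniform_chain_prob word_prob_ge0 ?word_prob_le1 ?u1.
have ab i : (const_mx 0 : 'rV[R]_d) ord0 i < (const_mx 1 : 'rV[R]_d) ord0 i.
  by rewrite !mxE ltr01.
have f0 x : 0 <= @unit_cube_density R d x by rewrite /unit_cube_density; case: ifP.
have f1 x : @unit_cube_density R d x <= 1 by rewrite /unit_cube_density; case: ifP.
pose lt j := letter Y (const_mx 0) (const_mx 1) (m j).
pose Ev j (G : pred (seq (cell (d := d) (m j)))) := [set w | G (word (lt j) w (N j) (n j))].
have mEv j G : measurable (Ev j G).
  apply: (measurable_word (k_ := lt j)) => i o; exact: (measurable_letter hY (m := m j) ab).
have step A j G : indep_from P (box_events Y) A (N j) ->
   indep_from P (box_events Y) (A `&` Ev j G) (N j.+1) /\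
   Pr P (A `&` Ev j G) = Pr P A * word_prob (fun=> (m j).+1%:R ^- d) (n j) G.
  move=> iA; rewrite NS.
  have wE : (fun=> (m j).+1%:R ^- d) = cell_mass (@unit_cube_density R d) (const_mx 0)
      (const_mx 1) (m := m j).
    by apply/funext => x; rewrite cell_mass_unit_cube.
  rewrite wE; apply: indep_from_word iA.
  - exact: measurable_box_events hY.
  - by move=> i o; exact: (measurable_letter hY (m := m j) ab).
  - by move=> i x; exact: (letter_box_event hY f0 f1 (m := m j) ab).
pose E j := Ev j (has_chain (k j)).
pose Bad j := Ev j (fun s => ~~ pairwise (@cell_separated d (m j)) s).
have PBad j : Pr P (Bad j) <= 2 ^- j.
  have [_] := step setT j (fun s => ~~ pairwise (@cell_separated d (m j)) s)
     (indep_fromW (leq0n _) (indep_from_iid hY)).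
  rewrite setTI /(Pr _ setT) probability_setT mul1r /Bad => ->.
  apply: le_trans (word_prob_Npairwise (u0 j) (u1 j) (n j)
    (divr_ge0 (ler0n R d) (ler0n R (m j).+1)) (@cell_separated_prob R d (m j))) _.
  rewrite mulrA ler_pdivrMr// [leRHS]mulrC ler_pdivlMr ?exprn_gt0//.
  by rewrite -!natrX -!natrM ler_nat /m; exact: leqnSn.
have evBad : {ae P, forall w, exists J, forall j, (J <= j)%N -> ~ Bad j w}.
  apply: (@eventually_notin _ _ _ P Bad 2) => [j|J]; first exact: mEv.
  apply: (@le_trans _ _ (\sum_(j < J) 2 ^- j)); first by apply: ler_sum => j _.
  suff : \sum_(j < J) 2 ^- j = 2 - 2 * 2 ^- J :> R.
    by move=> ->; rewrite gerBl mulr_ge0 ?invr_ge0 ?exprn_ge0.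
  elim: J => [|J IH]; first by rewrite big_ord0 expr0 invr1 mulr1 subrr.
  rewrite big_ord_recr /= IH exprS invfM mulrA divff// mul1r.
  by rewrite mulr_natl mulr2n opprD addrA subrK.
apply: (@eventually_disjoint_sum_bounded _ _ _ P E q) => //.
- by move=> j; exact: mEv.
- move=> J l.
  suff [] : indep_from P (box_events Y) (\bigcap_(j in [set j | J <= j < J + l]%N) ~` E
      j) (N (J + l)%N) /\
     Pr P (\bigcap_(j in [set j | J <= j < J + l]%N) ~` E j) = \prod_(J <= j < J + l)
         (1 - q j) by [].
  elim: l => [|l [IH1 IH2]].
    rewrite addn0 big_geq//.
    have -> : \bigcap_(j in [set j | J <= j < J]%N) ~` E j = setT.
      apply/seteqP; split=> // w _ j /= /andP[h1 h2].
      by move: (leq_ltn_trans h1 h2); rewrite ltnn.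
    by split; [exact: indep_fromW (indep_from_iid hY)|rewrite /Pr probability_setT].
  have -> : \bigcap_(j in [set j | J <= j < J + l.+1]%N) ~` E j =
     (\bigcap_(j in [set j | J <= j < J + l]%N) ~` E j) `&` Ev (J + l)%N (predC
         (has_chain (k (J + l)%N))).
    apply/seteqP; split=> w.
      move=> H; split.
        by move=> j /= /andP[h1 h2]; apply: H; rewrite /= h1 addnS ltnS ltnW.
      by apply/negP; apply: H; rewrite /= leq_addr addnS ltnSn.
    move=> [H1 /negP H2] j /=; rewrite addnS ltnS [(j <= _)%N]leq_eqVlt => /andP[Jj
        /orP[/eqP->//|jl]].
    by apply: H1; rewrite /= Jj.
  have [i1 i2] := step _ (J + l)%N (predC (has_chain (k (J + l)%N))) IH1.
  rewrite !addnS; split; first exact: i1.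
  apply: (etrans i2); rewrite IH2 big_nat_recr ?leq_addr//=; congr (_ * _).
  by rewrite word_probC//; exact: u1.
- have := hc _ _ P Y hY; apply: filterS2 evBad => w [J0 HJ0] cvc.
  have eps2 : 0 < eps / 2 by rewrite divr_gt0.
  have [J1 _ HJ1] : \forall n \near \oo, n%:R `^ (- (d%:R)^-1) *
     (longest_chain n (fun i => Y i w) predT)%:R < c + eps / 2.
    by apply: (cvgr_lt c cvc); rewrite ltrDl.
  exists (maxn J0 J1) => j; rewrite geq_max => /andP[J0j J1j] Ej.
  have nBad := HJ0 j J0j.
  (* A long chain of separated cells in one block is a chain among all points up to the end of that
     block, which the almost sure limit forbids for large [j]. *)
  have kL : (k j <= longest_chain (N j + n j) (fun i => Y i w) predT)%N.
    apply: (@longest_chain_of_has_chain R d (const_mx 0) (const_mx 1) (m j) ab) => //.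
    by apply: contrapT => /negP h; apply: nBad.
  rewrite -NS in kL.
  have J1N : (J1 <= N j.+1)%N.
    by apply: (leq_trans J1j); apply: (leq_trans (jn j)); rewrite NS leq_addl.
  have := HJ1 _ J1N.
  have N0 : 0 < (N j.+1)%:R :> R by rewrite ltr0n NS addn_gt0 n0 orbT.
  have n0' : 0 < (n j)%:R :> R by rewrite ltr0n.
  rewrite powRN mulrC ltr_pdivrMr ?powR_gt0//; apply/negP; rewrite -leNgt.
  apply: (@le_trans _ _ ((k j)%:R)); last by rewrite ler_nat.
  have x0 : 0 <= (c + eps) * (n j)%:R `^ (d%:R)^-1.
    by rewrite mulr_ge0 ?powR_ge0// addr_ge0 ?ltW.
  have /andP[_ /ltW] := truncn_itv x0; apply: le_trans.
  (* All points up to the end of block [j] number at most [rho] times the block size. Since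
     [rho >= 1], its [d]-th root may be replaced by [rho] itself. *)
  set rho := r%:R / (r%:R - 1) : R.
  have r1' : 0 < r%:R - 1 :> R by rewrite subr_gt0 ltr1n.
  have rho1 : 1 <= rho by rewrite /rho ler_pdivlMr// mul1r gerBl.
  have Nrho : (N j.+1)%:R <= rho * (n j)%:R.
    rewrite /rho mulrAC ler_pdivlMr// mulrC.
    have -> : r%:R - 1 = r.-1%:R :> R by rewrite -subn1 natrB// ltnW.
    by rewrite -!natrM ler_nat.
  have d0' : 0 <= (d%:R : R)^-1 by rewrite invr_ge0.
  apply: (@le_trans _ _ ((c + eps / 2) * (rho * (n j)%:R `^ (d%:R)^-1))).
    apply: ler_wpM2l; first exact: addr_ge0 (ltW c0) (ltW eps2).
    have rho0 : 0 <= rho := le_trans ler01 rho1.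
    apply: (@le_trans _ _ ((rho * (n j)%:R) `^ (d%:R)^-1)).
      apply: ge0_ler_powR => //; rewrite nnegrE.
        exact: ler0n.
      exact: mulr_ge0 rho0 (ler0n _ _).
    rewrite powRM ?ler0n//; rewrite ler_wpM2r ?powR_ge0//.
    have /andP[_ dle1] := inv_d.
    by rewrite -[leRHS]powRr1// ler_powR.
  rewrite mulrA ler_wpM2r ?powR_ge0// /rho mulrA ler_pdivrMr//.
  move: r_big; rewrite ler_pdivrMr// => r_big.
  move: (r%:R : R) r_big => rr r_big; lra.
Qed.

End UniformChains.

Section BoxChains.
Context {R : realType} {d : nat} {dT : measure_display} {T : measurableType dT}.
Hypothesis d_gt0 : (0 < d)%N.
Variables (P : probability T R) (X Y : nat -> T -> 'rV[R]_d) (f : 'rV[R]_d -> R).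
Hypothesis hX : iid_density P X f.
Hypothesis hY : iid_density P Y (@unit_cube_density R d).
Hypothesis f_ge0 : forall x, 0 <= f x.
Variables (M c : R).
Hypothesis f_le : forall x, f x <= M.
Hypothesis hc : is_chain_constant d c.

Definition in_hbox (a b : 'rV[R]_d) : pred 'rV[R]_d :=
  fun y => [forall i, a ord0 i <= y ord0 i < b ord0 i].

(** The fourth power collects two factors of thinning slack and one factor for each of two
    roundings; 15 is the sum of its binomial coefficients 4, 6, 4, 1. *)
Lemma exists_slack (C eps : R) : 0 <= C -> 0 < eps ->
  exists dl : R, [/\ 0 < dl, dl <= 1 & C * (1 + dl) ^+ 4 <= C + eps].
Proof.
move=> C0 e0; exists (Num.min 1 (eps / (15 * (C + 1)))).
set dl := Num.min _ _.
have C1 : 0 < 15 * (C + 1) by rewrite mulr_gt0// ltr_wpDl.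
have dl0 : 0 < dl by rewrite lt_min ltr01 divr_gt0.
have dl1 : dl <= 1 by rewrite ge_min lexx.
have dle : dl * (15 * (C + 1)) <= eps by rewrite -ler_pdivlMr// ge_min lexx orbT.
split=> //.
have h : (1 + dl) ^+ 4 <= 1 + 15 * dl.
  have d2 : dl ^+ 2 <= dl by rewrite expr2 ler_piMr// ltW.
  have d3 : dl ^+ 3 <= dl by rewrite exprS (le_trans _ d2)// expr2 ler_wpM2l// ltW.
  have d4 : dl ^+ 4 <= dl by rewrite exprS (le_trans _ d2)// expr2 ler_wpM2l// ltW.
  have -> : (1 + dl) ^+ 4 = 1 + 4 * dl + 6 * dl ^+ 2 + 4 * dl ^+ 3 + dl ^+ 4 by ring.
  lra.
apply: le_trans (ler_wpM2l C0 h) _; rewrite mulrDr mulr1 lerD2l.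
apply: le_trans dle; lra.
Qed.

(* The Chernoff term of [word_prob_thinning] decays geometrically in [N] as soon
   as [n] is a factor [(1 + dl) ^+ 2] below [N / p]. *)
Lemma thinning_tail (p dl : R) (n N : nat) : 0 < p -> 0 < dl ->
  n%:R * ((1 + dl) ^+ 2 * p) <= N%:R ->
  (1 + dl) ^- N * (1 + p * dl) ^+ n <= expR (- (dl / (1 + dl)) ^+ 2) ^+ N.
Proof.
move=> p0 dl0 nN; have l0 : 0 < 1 + dl by rewrite addr_gt0.
have h1 : (1 + p * dl) ^+ n <= expR (dl / (1 + dl) ^+ 2) ^+ N.
  apply: (@le_trans _ _ (expR (p * dl) ^+ n)).
    by apply: lerXn2r; rewrite ?nnegrE ?expR_ge0 ?expR_ge1Dx// addr_ge0// mulr_ge0// ltW.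
  rewrite -!expRM_natl ler_expR.
  rewrite [leRHS]mulrA ler_pdivlMr ?exprn_gt0//.
  move: nN; rewrite -(ler_pM2r dl0); apply: le_trans.
  by rewrite le_eqVlt; apply/orP; left; apply/eqP; ring.
have h2 : (1 + dl) ^- N <= expR (- (dl / (1 + dl))) ^+ N.
  rewrite -exprVn; apply: lerXn2r; rewrite ?nnegrE ?expR_ge0 ?invr_ge0 ?(ltW l0)//.
  apply: le_trans (expR_ge1Dx _); rewrite le_eqVlt; apply/orP; left; apply/eqP.
  by field; rewrite gt_eqF.
apply: (@le_trans _ _ (expR (- (dl / (1 + dl))) ^+ N * expR (dl / (1 + dl) ^+ 2) ^+ N)).
  apply: ler_pM => //; first by rewrite invr_ge0 exprn_ge0// ltW.
  by rewrite exprn_ge0// addr_ge0// mulr_ge0// ltW.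
rewrite -exprMn -expRD le_eqVlt; apply/orP; left; apply/eqP; congr (expR _ ^+ _).
by field; rewrite gt_eqF.
Qed.

(** Summability is available along each sequence [al.+1 * r ^ j] with [al] fixed. The sizes with
    [al < A * r] already approximate every large integer from above within a factor [1 + dl], so
    finitely many thresholds [J al] control all [n]. *)
Lemma box_chain_upper_bound (a b : 'rV[R]_d) (q eps : R) :
  (forall i, a ord0 i < b ord0 i) -> 0 < q -> (forall x, in_box a b x -> f x <= q) ->
  q * \prod_i (b ord0 i - a ord0 i) <= 1 -> 0 < eps ->
  {ae P, forall w, exists n0, forall n, (n0 <= n)%N ->
    (longest_chain n (fun i => X i w) (in_hbox a b))%:R <=
    (c + eps) * ((q * \prod_i (b ord0 i - a ord0 i)) `^ (d%:R)^-1 * n%:R `^ (d%:R)^-1)}.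
Proof.
move=> ab q0 fq p1 eps0; set p := q * _ in p1 *.
have c0 : 0 < c by case: hc.
have p0 : 0 < p by rewrite mulr_gt0// prodr_gt0// => i _; rewrite subr_gt0.
have eps2 : 0 < eps / 2 by rewrite divr_gt0.
have ce0 : 0 <= c + eps / 2 by rewrite addr_ge0// ltW.
have [dl [dl0 dl1 dlP]] := exists_slack ce0 eps2.
have [r0 Hr] := uniform_chain_prob_summable d_gt0 hY hc eps2.
pose r := maxn r0 2.
have r1 : (1 < r)%N by rewrite leq_max orbT.
(* Rounding [y] up to a multiple of [r ^ j] adds at most [r ^ j <= y / A <= dl * y]. *)
pose A := (Num.truncn (dl^-1)).+1.
have A_dl : dl^-1 <= A%:R.
  have : 0 <= dl^-1 by rewrite invr_ge0 ltW.
  by move=> /truncn_itv/andP[_ /ltW].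
pose S := (1 + dl) ^+ 2 * p.
have S0 : 0 < S by rewrite mulr_gt0// exprn_gt0// addr_gt0.
pose nN N := Num.truncn (N%:R / S).
pose thr := chain_threshold (R := R) (d := d) (c + eps / 2).
have [m Hm] : exists m : nat -> nat -> nat, forall al, exists B : R, forall J,
    \sum_(j < J) uniform_chain_prob (R := R) (d := d) (m al j) (al.+1 * r ^ j) (thr
        (al.+1 * r ^ j)%N) <= B.
  have : forall al, exists m : nat -> nat, exists B : R, forall J,
    \sum_(j < J) uniform_chain_prob (R := R) (d := d) (m j) (al.+1 * r ^ j) (thr (al.+1
        * r ^ j)%N) <= B.
    by move=> al; apply: Hr => //; exact: leq_maxl.
  by move=> /choice[m Hm]; exists m.
pose gN al j := (al.+1 * r ^ j)%N.
pose E al j := [set w | has_chain (thr (gN al j))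
   (word (letter X a b (m al j)) w 0 (nN (gN al j)))].
have mE al j : measurable (E al j).
  by apply: measurable_word => i o; exact: (measurable_letter hX (m := m al j) ab).
set rho := expR (- (dl / (1 + dl)) ^+ 2).
have rho0 : 0 <= rho by exact: expR_ge0.
have rho1 : rho < 1.
  by rewrite /rho -expR0 ltr_expR oppr_lt0 exprn_gt0// divr_gt0// addr_gt0.
have jgN al j : (j <= gN al j)%N.
  apply: (@leq_trans (r ^ j)); first exact: ltnW (ltn_expl j r1).
  by rewrite /gN leq_pmull.
have PE al j : Pr P (E al j) <= uniform_chain_prob (R := R) (d := d) (m al j) (gN al j)
    (thr (gN al j)) + rho ^+ j.
  have l1 : 1 <= 1 + dl by rewrite lerDl ltW.
  have := @Pr_word_thinning _ _ _ _ _ _ _ hX f_ge0 _ f_le a b (m al j) ab q (1 + dl)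
    (nN (gN al j)) (gN al j) _ (ltW q0) fq p1 l1 (has_chain_monotone (k := thr (gN al j))).
  move=> /le_trans; apply; rewrite lerD2l -/p.
  have -> : 1 + dl - 1 = dl by rewrite addrC addKr.
  apply: (@le_trans _ _ (rho ^+ gN al j)); last by apply: ler_wiXn2l => //; exact: ltW.
  apply: thinning_tail => //; rewrite -/S -ler_pdivlMr//.
  have h : 0 <= (gN al j)%:R / S by rewrite divr_ge0// ltW.
  by have /andP[] := truncn_itv h.
have evE : {ae P, forall w, forall al, exists J, forall j, (J <= j)%N -> ~ E al j w}.
  apply: ae_foralln => al; have [B HB] := Hm al.
  apply: (@eventually_notin _ _ _ P (E al) (B + (1 - rho)^-1)) => // J.
  apply: (@le_trans _ _ (\sum_(j < J) (uniform_chain_prob (R := R) (d := d) (m al j)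
      (gN al j) (thr (gN al j)) + rho ^+ j))).
    by apply: ler_sum => j _; exact: PE.
  rewrite big_split /=; apply: lerD; first exact: HB.
  have -> : \sum_(j < J) rho ^+ j = (1 - rho ^+ J) / (1 - rho).
    rewrite -opprB -[1 - rho]opprB invrN mulrNN; apply/esym/eqP.
    rewrite subrX1 mulrAC divff ?mul1r//.
    by rewrite subr_eq0 lt_eqF.
  rewrite ler_pdivrMr ?subr_gt0// mulVf ?subr_eq0 ?gt_eqF//.
  by rewrite gerBl exprn_ge0.
apply: filterS evE => w /choice[J HJ].
pose Jm := (\max_(al < A * r) J al)%N.
(* The summand [A * r ^ Jm] forces [j >= Jm] below; the summand [A], at least [1 / dl], makes
   rounding [S * n] up to an integer cost a factor [1 + dl]. *)
exists (Num.truncn ((A * r ^ Jm + A)%:R / S)).+1 => n n_ge.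
have Sn : (A * r ^ Jm + A)%:R <= S * n%:R.
  rewrite mulrC -ler_pdivrMr//.
  have h : 0 <= (A * r ^ Jm + A)%:R / S by rewrite divr_ge0// ltW.
  have /andP[_ /ltW] := truncn_itv h; move=> /le_trans; apply.
  by rewrite ler_nat.
have Sn0 : 0 <= S * n%:R by rewrite mulr_ge0// ltW.
pose y := (Num.truncn (S * n%:R)).+1.
have /andP[yS Sy] := truncn_itv Sn0; rewrite -/y in Sy.
have Ay : (A * r ^ Jm <= y)%N.
  rewrite -(ler_nat R); apply: le_trans (ltW Sy); apply: le_trans Sn.
  by rewrite ler_nat leq_addr.
have A0 : (0 < A)%N by [].
have rJ : (r ^ Jm <= y %/ A)%N by rewrite leq_divRL// mulnC.
have yA0 : (0 < y %/ A)%N by apply: leq_trans rJ; rewrite expn_gt0 ltnW.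
(* Then [y] lies between [A * r ^ j] and [A * r ^ j.+1], so its quotient by [r ^ j] is at least [A]
   and less than [A * r]. *)
pose j := trunc_log r (y %/ A)%N.
have /andP[rj1 rj2] := trunc_log_bounds r1 yA0; rewrite -/j in rj1 rj2.
have Jj : (Jm <= j)%N by apply: trunc_log_max.
pose al := (y %/ r ^ j)%N.
have rj0 : (0 < r ^ j)%N by rewrite expn_gt0 ltnW.
have alA : (al < A * r)%N.
  rewrite /al ltn_divLR// -mulnA -expnS mulnC.
  by rewrite -ltn_divLR.
have JalJ : (J al <= j)%N.
  by apply: leq_trans Jj; exact: (@leq_bigmax _ (fun i : 'I_(A * r) => J i) (Ordinal alA)).
have yN : (y < gN al j)%N by rewrite /gN ltn_ceil.
have ArJ : (A * r ^ j <= y)%N by rewrite mulnC -leq_divRL.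
have Ny : (gN al j)%:R <= (1 + dl) * y%:R :> R.
  have h1 : (gN al j <= y + r ^ j)%N.
    by rewrite /gN mulSn addnC leq_add2r leq_trunc_div.
  apply: (@le_trans _ _ (y + r ^ j)%:R); first by rewrite ler_nat.
  rewrite natrD mulrDl mul1r lerD2l -ler_pdivrMl// mulrC.
  apply: (@le_trans _ _ ((r ^ j)%:R * A%:R)); first by rewrite ler_wpM2l.
  by rewrite -natrM ler_nat mulnC.
have yle : y%:R <= (1 + dl) * (S * n%:R).
  rewrite /y -natr1 mulrDl mul1r; apply: lerD => //.
  rewrite -ler_pdivrMl// mulr1; apply: (le_trans A_dl); apply: le_trans Sn.
  by rewrite ler_nat leq_addl.
have n_le : (n <= nN (gN al j))%N.
  rewrite /nN truncn_ge_nat ?divr_ge0 ?(ltW S0)// ler_pdivlMr// mulrC.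
  by apply: (le_trans (ltW Sy)); rewrite ler_nat ltnW.
have nE := HJ al j JalJ.
have L_lt : (longest_chain n (fun i => X i w) (in_hbox a b) < thr (gN al j))%N.
  rewrite ltnNge; apply/negP => /(has_chain_of_longest_chain (m := m al j) ab) H.
  apply: nE; apply: has_chain_monotone (H _).
    rewrite /word -(subnKC n_le) iotaD pmap_cat; exact: prefix_subseq.
  by move=> i _ /forallP/(cell_of_ex (m al j) ab)[x ->].
have x0 : 0 <= (c + eps / 2) * (gN al j)%:R `^ (d%:R)^-1 by rewrite mulr_ge0// powR_ge0.
have /andP[tx _] := truncn_itv x0.
have d0' : 0 <= (d%:R : R)^-1 by rewrite invr_ge0.
have dle1 : (d%:R : R)^-1 <= 1 by rewrite invf_le1 ?ltr0n// ler1n.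
apply: (@le_trans _ _ ((c + eps / 2) * (gN al j)%:R `^ (d%:R)^-1)).
  by apply: le_trans tx; rewrite ler_nat.
set l := 1 + dl; have l0 : 0 <= l by rewrite addr_ge0// ltW.
have l1 : 1 <= l by rewrite lerDl ltW.
have Nn : (gN al j)%:R <= l ^+ 4 * (p * n%:R).
  apply: (le_trans Ny); apply: (@le_trans _ _ (l * (l * (S * n%:R)))).
    by rewrite ler_wpM2l.
  by rewrite le_eqVlt; apply/orP; left; apply/eqP; rewrite /S -/l; ring.
have pn0 : 0 <= p * n%:R by rewrite mulr_ge0// ltW.
have l40 : 0 <= l ^+ 4 by rewrite exprn_ge0.
apply: (@le_trans _ _ ((c + eps / 2) * (l ^+ 4 * (p * n%:R)) `^ (d%:R)^-1)).
  apply: ler_wpM2l => //; apply: ge0_ler_powR => //; rewrite nnegrE ?ler0n//.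
  exact: mulr_ge0.
rewrite powRM// powRM ?(ltW p0)// mulrA; apply: ler_wpM2r.
  by rewrite mulr_ge0 ?powR_ge0.
apply: (@le_trans _ _ ((c + eps / 2) * l ^+ 4)).
  apply: ler_wpM2l => //; rewrite -[leRHS]powRr1//; apply: ler_powR => //.
  by rewrite exprn_ege1.
by apply: (le_trans dlP); rewrite -addrA -splitr.
Qed.

End BoxChains.

(** * Lower bounds for the continuum energy *)

Section QuadraticDerivative.
Context {R : realType}.
Implicit Types (F f : R -> R).

(* A derivative with a uniform quadratic error term: unlike [is_derive] it is
   stable under sums and affine substitutions by plain estimates, and it
   yields both the one-sided quotients of [deriv01] and the FTC hypotheses. *)
Definition quad_deriv F f := exists2 K, 0 <= K &
  forall s t, `|F s - F t - f t * (s - t)| <= K * (s - t) ^+ 2.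

Lemma quad_deriv_cst (a : R) : quad_deriv (fun=> a) (fun=> 0).
Proof. by exists 0 => // s t; rewrite !mul0r subrr subr0 normr0. Qed.

Lemma quad_derivD F f G g : quad_deriv F f -> quad_deriv G g ->
  quad_deriv (fun t => F t + G t) (fun t => f t + g t).
Proof.
move=> [K K0 HK] [L L0 HL]; exists (K + L); first exact: addr_ge0.
move=> s t; have -> : F s + G s - (F t + G t) - (f t + g t) * (s - t) =
  (F s - F t - f t * (s - t)) + (G s - G t - g t * (s - t)) by ring.
by rewrite mulrDl; apply: le_trans (ler_normD _ _) _; exact: lerD.
Qed.

Lemma quad_derivZ F f (a : R) : quad_deriv F f ->
  quad_deriv (fun t => a * F t) (fun t => a * f t).
Proof.
move=> [K K0 HK]; exists (`|a| * K); first exact: mulr_ge0.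
move=> s t; have -> : a * F s - a * F t - a * f t * (s - t) =
  a * (F s - F t - f t * (s - t)) by ring.
by rewrite normrM -mulrA ler_wpM2l.
Qed.

Lemma quad_deriv_affine F f (a b : R) : quad_deriv F f ->
  quad_deriv (fun t => F (a * t - b)) (fun t => a * f (a * t - b)).
Proof.
move=> [K K0 HK]; exists (K * a ^+ 2); first by rewrite mulr_ge0// sqr_ge0.
move=> s t; have := HK (a * s - b) (a * t - b).
have -> : a * s - b - (a * t - b) = a * (s - t) by ring.
by rewrite exprMn !mulrA [f _ * a]mulrC.
Qed.

Lemma quad_deriv_id : quad_deriv (fun t => t - 1) (fun=> 1).
Proof.
exists 0 => // s t; rewrite mul0r mul1r.
have -> : s - 1 - (t - 1) - (s - t) = 0 by ring.
by rewrite normr0.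
Qed.

Lemma quad_deriv_sum (I : Type) (r : seq I) (F f : I -> R -> R) :
  (forall i, quad_deriv (F i) (f i)) ->
  quad_deriv (fun t => \sum_(i <- r) F i t) (fun t => \sum_(i <- r) f i t).
Proof.
move=> Ff; elim: r => [|i r IH].
  have -> : (fun t => \sum_(i <- [::]) F i t) = fun=> 0.
    by apply/funext => t; rewrite big_nil.
  have -> : (fun t => \sum_(i <- [::]) f i t) = fun=> 0.
    by apply/funext => t; rewrite big_nil.
  exact: quad_deriv_cst.
have -> : (fun t => \sum_(i <- i :: r) F i t) = fun t => F i t + \sum_(i <- r) F i t.
  by apply/funext => t; rewrite big_cons.
have -> : (fun t => \sum_(i <- i :: r) f i t) = fun t => f i t + \sum_(i <- r) f i t.
  by apply/funext => t; rewrite big_cons.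
exact: quad_derivD.
Qed.

Lemma quad_deriv_quotient F f K s t :
  (forall s t, `|F s - F t - f t * (s - t)| <= K * (s - t) ^+ 2) -> s != t ->
  `|(F s - F t) / (s - t) - f t| <= K * `|s - t|.
Proof.
move=> HK st; have st0 : s - t != 0 by rewrite subr_eq0.
have -> : (F s - F t) / (s - t) - f t = (F s - F t - f t * (s - t)) / (s - t).
  by rewrite [RHS]mulrBl mulfK.
rewrite normrM normfV ler_pdivrMr ?normr_gt0// -mulrA -normrM -expr2.
by rewrite [`|_ ^+ 2|]ger0_norm ?sqr_ge0//; exact: HK.
Qed.

Lemma quad_deriv_deriv01 F f : quad_deriv F f -> deriv01 F f.
Proof.
move=> [K K0 HK] t t01; apply/cvgrPdist_le => e e0.
rewrite near_withinE; near=> s => -[_ st].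
rewrite distrC; apply: le_trans (quad_deriv_quotient HK st) _.
apply: (@le_trans _ _ (K * (e / (K + 1)))).
  rewrite ler_wpM2l// distrC; near: s.
  by apply: cvgr_dist_le (divr_gt0 e0 _); [exact: cvg_id|rewrite ltr_wpDl].
by rewrite mulrA ler_pdivrMr ?ltr_wpDl// mulrC ler_wpM2l ?lerDl// ltW.
Unshelve. all: by end_near.
Qed.

Lemma quad_deriv_cvg F f t : quad_deriv F f ->
  (fun h => h^-1 *: (F (h + t) - F t)) @ 0^' --> f t.
Proof.
move=> [K K0 HK]; apply/cvgrPdist_le => e e0.
near=> h; have h0 : h != 0 by near: h; exact: nbhs_dnbhs_neq.
have ht : h + t != t by rewrite -subr_eq0 addrK.
have := quad_deriv_quotient HK ht; rewrite addrK distrC /GRing.scale /= mulrC => H.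
apply: (le_trans H); apply: (@le_trans _ _ (K * (e / (K + 1)))).
  rewrite ler_wpM2l//; near: h.
  apply: dnbhs0_le; by rewrite divr_gt0// ltr_wpDl.
by rewrite mulrA ler_pdivrMr ?ltr_wpDl// mulrC ler_wpM2l ?lerDl// ltW.
Unshelve. all: by end_near.
Qed.

Lemma quad_deriv_derivable F f t : quad_deriv F f -> derivable F t 1.
Proof.
move=> Ff; apply/cvg_ex; exists (f t).
have -> : (fun h => h^-1 *: ((F \o shift t) (h *: 1) - F t)) =
          (fun h => h^-1 *: (F (h + t) - F t)).
  by apply/funext => h; rewrite /= [h *: 1]mulr1.
exact: quad_deriv_cvg.
Qed.

Lemma quad_deriv_derive1 F f t : quad_deriv F f -> derive1 F t = f t.
Proof. by move=> Ff; apply: cvg_lim => //; exact: quad_deriv_cvg. Qed.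

Lemma quad_deriv_continuous F f : quad_deriv F f -> continuous f.
Proof.
move=> [K K0 HK] t; apply/cvgrPdist_le => e e0; near=> s.
have [->|st] := eqVneq s t; first by rewrite subrr normr0 ltW.
have ts : t != s by rewrite eq_sym.
apply: (@le_trans _ _ (2 * K * `|s - t|)).
  have := quad_deriv_quotient HK st; have := quad_deriv_quotient HK ts.
  have -> : (F t - F s) / (t - s) = (F s - F t) / (s - t).
    by rewrite -opprB -[t - s]opprB invrN mulrNN.
  rewrite [`|t - s|]distrC => h1 h2.
  have -> : f t - f s = ((F s - F t) / (s - t) - f s) - ((F s - F t) / (s - t) - f t)
      by ring.
  by apply: le_trans (ler_normB _ _) _; rewrite -mulrA mulr_natl mulr2n lerD.
apply: (@le_trans _ _ (2 * K * (e / (2 * K + 1)))).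
  rewrite ler_wpM2l ?mulr_ge0// distrC; near: s.
  by apply: cvgr_dist_le (divr_gt0 e0 _); [exact: cvg_id|rewrite ltr_wpDl ?mulr_ge0].
rewrite mulrA ler_pdivrMr ?ltr_wpDl ?mulr_ge0// [leRHS]mulrC.
by rewrite ler_wpM2r ?lerDl// ltW.
Unshelve. all: by end_near.
Qed.

Lemma quad_deriv_integral F f : quad_deriv F f ->
  (\int[@lebesgue_measure R]_(t in `[0%R, 1%R]) (f t)%:E = (F 1 - F 0)%:E)%E.
Proof.
move=> Ff.
have cF : continuous F.
  move=> t; apply: differentiable_continuous; apply/derivable1_diffP.
  exact: quad_deriv_derivable Ff.
rewrite EFinB; apply: continuous_FTC2 => //.
- by apply: continuous_subspaceT; exact: quad_deriv_continuous Ff.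
- split; first by move=> t _; exact: quad_deriv_derivable Ff.
  + by apply: cvg_at_right_filter; exact: cF.
  + by apply: cvg_at_left_filter; exact: cF.
- by move=> t _; exact: quad_deriv_derive1.
Qed.

Definition pos_part (t : R) := Num.max 0 t.

Lemma quad_deriv_pos_part : quad_deriv (fun t => pos_part t ^+ 2) (fun t => 2 * pos_part t).
Proof.
exists 1 => // s t; rewrite /pos_part mul1r ler_norml.
have s2 := sqr_ge0 s; have t2 := sqr_ge0 t; have st2 := sqr_ge0 (s - t).
case: (leP 0 s) => hs; case: (leP 0 t) => ht; apply/andP; split;
  try (have := mulr_ge0_le0 hs (ltW ht)); try (have := mulr_le0_ge0 (ltW hs) ht);
  rewrite ?expr0n /=; rewrite !expr2 in s2 t2 st2 *; lra.
Qed.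

(** The primitive of the tent [smooth_bump], which has height 2 and base [0, 1]. As the tent
    vanishes at both ends, successive steps join to a function with continuous derivative. *)
Definition smooth_step (t : R) : R :=
  2 * pos_part (t - 0) ^+ 2 + (- 4 * pos_part (t - 2^-1) ^+ 2 + 2 * pos_part (t - 1) ^+ 2).
Definition smooth_bump (t : R) : R :=
  4 * pos_part t - 8 * pos_part (t - 2^-1) + 4 * pos_part (t - 1).

Lemma quad_deriv_smooth_step : quad_deriv smooth_step smooth_bump.
Proof.
have H b : quad_deriv (fun t => pos_part (t - b) ^+ 2) (fun t => 2 * pos_part (t - b)).
  have := quad_deriv_affine 1 b quad_deriv_pos_part.
  congr quad_deriv; apply/funext => t; by rewrite mul1r// mul1r.
have -> : smooth_bump = fun t => 2 * (2 * pos_part (t - 0)) +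
   (- 4 * (2 * pos_part (t - 2^-1)) + 2 * (2 * pos_part (t - 1))).
  by apply/funext => t; rewrite /smooth_bump subr0; ring.
by apply: quad_derivD; [|apply: quad_derivD]; apply: quad_derivZ; exact: H.
Qed.

Let half_lt1 : 2^-1 + 2^-1 = 1 :> R. Proof. by lra. Qed.

Lemma smooth_step_le0 t : t <= 0 -> smooth_step t = 0 /\ smooth_bump t = 0.
Proof.
move=> t0; rewrite /smooth_step /smooth_bump /pos_part subr0.
by rewrite !max_l ?subr_le0 ?(le_trans t0)// !expr0n/= !mulr0 !addr0 subr0.
Qed.

Lemma smooth_step_ge1 t : 1 <= t -> smooth_step t = 1 /\ smooth_bump t = 0.
Proof.
move=> t1; rewrite /smooth_step /smooth_bump /pos_part subr0.
have h : (2^-1 : R) <= 1 by rewrite invf_le1// ler1n.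
rewrite !max_r ?subr_ge0 ?(le_trans _ t1)//.
by split; field.
Qed.

Lemma smooth_bump_ge0 t : 0 <= smooth_bump t.
Proof.
rewrite /smooth_bump /pos_part; have h := half_lt1; set x := 2^-1 in h *.
by case: (leP 0 t) => h1; case: (leP 0 (t - x)) => h2; case: (leP 0 (t - 1)) => h3; lra.
Qed.

Lemma smooth_step_itv t : 0 <= smooth_step t <= 1.
Proof.
rewrite /smooth_step /pos_part subr0; have h := half_lt1; set x := 2^-1 in h *.
have hx : x = 1 / 2 by lra.
rewrite hx; case: (leP 0 t) => h1; case: (leP 0 (t - 1 / 2)) => h2;
    case: (leP 0 (t - 1)) => h3;
  apply/andP; split; nra.
Qed.

End QuadraticDerivative.

Section PolygonEnergy.
Context {R : realType} {d : nat}.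
Hypothesis d_gt0 : (0 < d)%N.

Lemma sum_smooth_step (N k : nat) (a : nat -> R) (x : R) : (k < N)%N ->
  k%:R <= x <= k.+1%:R ->
  \sum_(j < N) a j * smooth_step (x - j%:R) =
    \sum_(j < k) a j + a k * smooth_step (x - k%:R) /\
  \sum_(j < N) a j * smooth_bump (x - j%:R) = a k * smooth_bump (x - k%:R).
Proof.
move=> kN /andP[kx xk].
have before j : (j < k)%N -> 1 <= x - j%:R.
  by move=> jk; rewrite lerBrDr; apply: le_trans kx; rewrite nat1r ler_nat.
have after j : (k < j)%N -> x - j%:R <= 0.
  by move=> kj; rewrite subr_le0 (le_trans xk)// ler_nat.
rewrite -(big_mkord xpredT (fun j => a j * smooth_step (x - j%:R))).
rewrite -(big_mkord xpredT (fun j => a j * smooth_bump (x - j%:R))) -(big_mkord xpredT a).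
split.
  rewrite (big_cat_nat (leq0n k) (ltnW kN)) (big_ltn kN) /=; congr (_ + _).
    by apply: eq_big_nat => j /andP[_ /before/smooth_step_ge1[-> _]]; rewrite mulr1.
  rewrite big_nat_cond big1 ?addr0// => j /andP[/andP[kj _] _].
  by have [-> _] := smooth_step_le0 (after _ kj); rewrite mulr0.
rewrite (big_cat_nat (leq0n k) (ltnW kN)) (big_ltn kN) /=.
rewrite big_nat_cond big1 ?add0r; last first.
  move=> j /andP[/andP[_ jk] _].
  by have [_ ->] := smooth_step_ge1 (before _ jk); rewrite mulr0.
rewrite big_nat_cond big1 ?addr0// => j /andP[/andP[kj _] _].
by have [_ ->] := smooth_step_le0 (after _ kj); rewrite mulr0.
Qed.

Definition segment_energy (mu : R) (u v : 'rV[R]_d) : R :=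
  mu `^ (d%:R)^-1 * (\prod_i (v ord0 i - u ord0 i)) `^ (d%:R)^-1.

Lemma powR_exprn_inv (x : R) : 0 <= x -> (x ^+ d) `^ (d%:R)^-1 = x.
Proof.
by move=> x0; rewrite -powR_mulrn// -powRrM divff ?powRr1// pnatr_eq0 -lt0n.
Qed.

(** The integrand is homogeneous of degree one in the velocity, so traversing an edge with speed
    profile [b] contributes its segment energy times [b], and [b] integrates to 1 over the time
    spent on the edge. *)
Lemma U_fun_ge_polygon (f : 'rV[R]_d -> R) (z : 'rV[R]_d) (N : nat)
    (p : nat -> 'rV[R]_d) (mu : nat -> R) (kappa : R) :
  (forall x, 0 <= f x) -> 0 < kappa ->
  (forall k i, (k < N)%N -> p k ord0 i <= p k.+1 ord0 i) -> leqv (p N) z ->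
  (forall k, 0 <= mu k) ->
  (forall k u (x : 'rV[R]_d), (k < N)%N -> 0 <= u <= 1 ->
     (forall i, `|x ord0 i - (p k ord0 i + (p k.+1 ord0 i - p k ord0 i) * u)| <= kappa) ->
     mu k <= f x) ->
  ((\sum_(k < N) segment_energy (mu k) (p k) (p k.+1))%:E <= U_fun f z)%E.
Proof.
move=> f0 kappa0 p_le pz mu0 tube.
pose D i k := p k.+1 ord0 i - p k ord0 i.
have D0 i k : (k < N)%N -> 0 <= D i k by move=> kN; rewrite subr_ge0 p_le.
(* The speed of the polygon vanishes at its vertices. The drift [kappa * (t - 1)] makes all
   derivatives positive; being nonpositive it keeps the curve below [z], and the tube of radius
   [kappa] absorbs it. *)
pose g i t := p 0%N ord0 i + \sum_(k < N) D i k * smooth_step (N%:R * t - k%:R) + kappa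
    * (t - 1).
pose g' i t := 0 + \sum_(k < N) D i k * (N%:R * smooth_bump (N%:R * t - k%:R)) + kappa * 1.
have gg' i : quad_deriv (g i) (g' i).
  apply: quad_derivD; last by apply: quad_derivZ; exact: quad_deriv_id.
  apply: quad_derivD; first exact: quad_deriv_cst.
  apply: quad_deriv_sum => k; apply: quad_derivZ; apply: quad_deriv_affine.
  exact: quad_deriv_smooth_step.
have NB0 t (k : nat) : 0 <= N%:R * smooth_bump (N%:R * t - k%:R) :> R.
  by rewrite mulr_ge0// smooth_bump_ge0.
have g'_gt i t : kappa <= g' i t.
  rewrite /g' add0r mulr1 lerDr; apply: sumr_ge0 => k _.
  by apply: mulr_ge0 => //; exact: D0.
have tele k i : (k <= N)%N -> p 0%N ord0 i + \sum_(j < k) D i j = p k ord0 i.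
  move=> kN; rewrite -(big_mkord xpredT (D i)) telescope_sumr// addrC subrK//.
have adm : admissible g g' z.
  split.
    move=> i; split; first exact: quad_deriv_deriv01.
    by apply: continuous_subspaceT; exact: quad_deriv_continuous (gg' i).
  move=> t /andP[t0 t1]; split; first by move=> i; apply: le_trans (g'_gt i t); exact: ltW.
  split; first by exists (Ordinal d_gt0); rewrite gt_eqF// (lt_le_trans kappa0 (g'_gt _ t)).
  apply/forallP => i; rewrite mxE; move/forallP: pz => /(_ i); apply: le_trans.
  rewrite -(tele N)// /g -[leRHS]addr0; apply: lerD; last by rewrite pmulr_rle0// subr_le0.
  rewrite lerD2l; apply: ler_sum => k _.
  rewrite -[leRHS]mulr1 ler_wpM2l ?D0//.
  by have /andP[] := smooth_step_itv (N%:R * t - k%:R).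
apply: (@le_trans _ _ (chain_energy f g g')); last first.
  by apply: ereal_sup_ubound; exists g, g'.
(* An explicit primitive of a lower bound for the integrand, so that the energy itself need not be
   computed. *)
pose G t := \sum_(k < N) segment_energy (mu k) (p k) (p k.+1) * smooth_step (N%:R * t -
    k%:R).
pose G' t := \sum_(k < N) segment_energy (mu k) (p k) (p k.+1) * (N%:R * smooth_bump
    (N%:R * t - k%:R)).
have GG' : quad_deriv G G'.
  apply: quad_deriv_sum => k; apply: quad_derivZ; apply: quad_deriv_affine.
  exact: quad_deriv_smooth_step.
have E0 k : 0 <= segment_energy (mu k) (p k) (p k.+1) by rewrite mulr_ge0// powR_ge0.
have -> : (\sum_(k < N) segment_energy (mu k) (p k) (p k.+1))%:E =
   (\int[@lebesgue_measure R]_(t in [set t : R | (0 <= t <= 1)%R]) (G' t)%:E)%E.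
  rewrite set_itvcc_le (quad_deriv_integral GG'); congr EFin.
  rewrite /G [X in _ - X]big1 ?subr0; last first.
    move=> k _; rewrite mulr0 add0r.
    have [|-> _] := @smooth_step_le0 R (- (k : nat)%:R); first by rewrite oppr_le0.
    by rewrite mulr0.
  apply: eq_bigr => k _; rewrite mulr1.
  have [|-> _] := @smooth_step_ge1 R (N%:R - (k : nat)%:R); last by rewrite mulr1.
  by rewrite lerBrDr nat1r ler_nat ltn_ord.
apply: ge0_le_integral_nomeas => t /= t01; rewrite lee_fin.
  by apply: sumr_ge0 => k _; apply: mulr_ge0.
have rhs0 : 0 <= f (\row_i g i t) `^ (d%:R)^-1 * (\prod_(i < d) g' i t) `^ (d%:R)^-1.
  by rewrite mulr_ge0 ?powR_ge0.
have [N0|N0] := posnP N.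
  rewrite /G' big1// => k _; move: (ltn_ord k); by rewrite [X in (_ < X)%N]N0.
have NR0 : 0 < N%:R :> R by rewrite ltr0n.
have [k kN ktN] : exists2 k, (k < N)%N & k%:R <= N%:R * t <= k.+1%:R.
  case/andP: t01 => t0 t1; have [te|tn] := eqVneq t 1.
    by exists N.-1; rewrite ?prednK// te mulr1 !ler_nat leq_pred leqnn.
  have Nt0 : 0 <= N%:R * t by rewrite mulr_ge0.
  exists (Num.truncn (N%:R * t)).
    by rewrite truncn_lt_nat// -[ltRHS]mulr1 ltr_pM2l// lt_neqAle tn.
  by have /andP[-> /ltW ->] := truncn_itv Nt0.
set u := N%:R * t - k%:R; pose b := N%:R * smooth_bump u.
have b0 : 0 <= b by exact: NB0.
have gE i : g i t = p k ord0 i + D i k * smooth_step u + kappa * (t - 1).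
  rewrite /g; have [-> _] := sum_smooth_step (D i) kN ktN.
  by rewrite addrA tele// ltnW.
have g'E i : g' i t = D i k * b + kappa.
  rewrite /g' add0r mulr1; congr (_ + _).
  have [_ H] := sum_smooth_step (D i) kN ktN.
  rewrite /b mulrCA -H mulr_sumr; by apply: eq_bigr => j _; rewrite mulrCA.
have G'E : G' t = segment_energy (mu k) (p k) (p k.+1) * b.
  have [_ H] := sum_smooth_step (fun k => segment_energy (mu k) (p k) (p k.+1)) kN ktN.
  rewrite /b mulrCA -H mulr_sumr; by apply: eq_bigr => j _; rewrite mulrCA.
have muf : mu k <= f (\row_i g i t).
  apply: (tube _ (smooth_step u)) => //; first exact: smooth_step_itv.
  move=> i; rewrite mxE gE -/(D i k) [p k ord0 i + _ + _]addrC addrK normrM (gtr0_norm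
      kappa0).
  rewrite -[leRHS]mulr1 ler_wpM2l ?(ltW kappa0)// distrC ger0_norm ?subr_ge0.
    by rewrite lerBlDr lerDl; case/andP: t01.
  by case/andP: t01.
have PD0 : 0 <= \prod_i D i k by apply: prodr_ge0 => i _; exact: D0.
have d0' : 0 <= (d%:R : R)^-1 by rewrite invr_ge0.
rewrite G'E /segment_energy -mulrA; apply: ler_pM; rewrite ?powR_ge0//.
- by rewrite mulr_ge0 ?powR_ge0.
- by apply: ge0_ler_powR => //; rewrite nnegrE.
rewrite -[X in _ * X <= _](powR_exprn_inv b0) -powRM//; last exact: exprn_ge0.
apply: ge0_ler_powR => //; rewrite ?nnegrE.
- by rewrite mulr_ge0// exprn_ge0.
- by apply: prodr_ge0 => i _; apply: le_trans (g'_gt i t); exact: ltW.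
have -> : b ^+ d = \prod_(i < d) b by rewrite prodr_const card_ord.
rewrite -big_split /=; apply: ler_prod => i _; rewrite g'E -/(D i k) mulr_ge0 ?D0//=.
by rewrite lerDl ltW.
Qed.

End PolygonEnergy.

(** * Lipschitz domains *)

Section UniformCone.
Context {R : realType} {d : nat}.
Implicit Types (x y v w : 'rV[R]_d).

Lemma enorm_le v (b : R) : (forall i, `|v ord0 i| <= b) -> enorm v <= d%:R * b.
Proof.
case: d v => [|n] v vb; first by rewrite /enorm big_ord0 sqrtr0 mul0r.
have b0 : 0 <= b := le_trans (normr_ge0 _) (vb ord0).
have nb0 : 0 <= n.+1%:R * b by rewrite mulr_ge0.
rewrite /enorm -[leRHS]ger0_norm// -sqrtr_sqr ler_wsqrtr//.
apply: (@le_trans _ _ (\sum_(i < n.+1) b ^+ 2)).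
  apply: ler_sum => i _; rewrite -real_normK ?num_real// !expr2.
  by apply: ler_pM.
rewrite sumr_const card_ord -[leLHS]mulr_natl exprMn.
apply: ler_wpM2r; first exact: sqr_ge0.
by rewrite expr2 ler_peMr// ler1n.
Qed.

(* [inward_direction Om dl x nu]: from every point of the closure near [x], a
   cone of height and aperture [dl] around the direction [nu] enters [Om]. *)
Definition inward_direction (Om : set 'rV[R]_d) (dl : R) x (nu : 'rV[R]_d) :=
  (forall i, `|nu ord0 i| <= 1) /\
  forall y (s : R) w, closure Om y -> (forall i, `|y ord0 i - x ord0 i| < dl) ->
    0 < s < dl -> (forall i, `|w ord0 i| < dl * s) -> Om (y + s *: nu + w).

Lemma inward_direction_near (Om : set 'rV[R]_d) (dl dl' : R) x x' nu :
  inward_direction Om dl x nu -> dl' <= dl / 2 ->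
  (forall i, `|x' ord0 i - x ord0 i| < dl / 2) -> 0 < dl ->
  inward_direction Om dl' x' nu.
Proof.
move=> [nu1 H] dl'd xx' dl0; split=> // y s w cy yx /andP[s0 sd] wd.
have dl2 : dl / 2 <= dl by lra.
apply: H => //.
- move=> i; have := yx i; have := xx' i.
  have := ler_distD (x' ord0 i) (y ord0 i) (x ord0 i); lra.
- by rewrite s0 (lt_le_trans sd)// (le_trans dl'd).
- by move=> i; apply: lt_le_trans (wd i) _; rewrite ler_pM2r// (le_trans dl'd).
Qed.

(** The conditions on [y] and [w] are strict, so [y] may be replaced by a nearby point of [Om] and
    the difference moved into [w]. *)
Lemma inward_direction_closure (Om : set 'rV[R]_d) (dl : R) x (nu : 'rV[R]_d) :
  (forall i, `|nu ord0 i| <= 1) ->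
  (forall y (s : R) w, Om y -> (forall i, `|y ord0 i - x ord0 i| < dl) ->
    0 < s < dl -> (forall i, `|w ord0 i| < dl * s) -> Om (y + s *: nu + w)) ->
  inward_direction Om dl x nu.
Proof.
move=> nu1 H; split=> // y s w cy yx s0 wd.
have [y0 [Oy0 By0]] : Om `&` [set y0 | forall i, `|y0 ord0 i - x ord0 i| < dl /\
    `|w ord0 i + (y ord0 i - y0 ord0 i)| < dl * s] !=set0.
  apply: cy; apply: (@filter_forall _ _ (fun i y0 => `|y0 ord0 i - x ord0 i| < dl /\
    `|w ord0 i + (y ord0 i - y0 ord0 i)| < dl * s) (nbhs y)) => i.
  have ci : (fun y0 : 'rV[R]_d => y0 ord0 i) @ y --> y ord0 i by exact: coord_continuous.
  near=> y0; split.
    near: y0; apply: (cvgr_lt `|y ord0 i - x ord0 i|) => //.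
    by apply: cvg_norm; apply: cvgB => //; exact: cvg_cst.
  near: y0; apply: (cvgr_lt `|w ord0 i + (y ord0 i - y ord0 i)|);
      last by rewrite subrr addr0.
  by apply: cvg_norm; apply: cvgD; [exact: cvg_cst|apply: cvgB => //; exact: cvg_cst].
have -> : y + s *: nu + w = y0 + s *: nu + (w + (y - y0)).
  by apply/rowP => i; rewrite !mxE; ring.
apply: H => //; first by move=> i; have [] := By0 i.
by move=> i; have [_] := By0 i; rewrite !mxE.
Unshelve. all: by end_near.
Qed.

Lemma inward_direction_interior (Om : set 'rV[R]_d) x : open Om -> Om x ->
  exists2 dl, 0 < dl & inward_direction Om dl x 0.
Proof.
move=> oO Ox; have : nbhs x Om by exact: open_nbhs_nbhs.
move=> /nbhs_ballP[e /= e0 eO].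
have dl0 : 0 < Num.min 1 (e / 3) by rewrite lt_min ltr01 divr_gt0.
exists (Num.min 1 (e / 3)) => //.
set dl := Num.min _ _ in dl0 *.
have dle : dl <= e / 3 by rewrite ge_min lexx orbT.
have dl1 : dl <= 1 by rewrite ge_min lexx.
apply: inward_direction_closure => [i|y s w _ yx /andP[s0 sd] wd].
  by rewrite mxE normr0.
apply: eO; split=> // i j; rewrite (ord1 i) /ball /= !mxE mulr0 addr0.
have h1 := yx j; have h2 := wd j.
have h3 : dl * s <= dl by rewrite ler_piMr ?(le_trans (ltW sd))// ltW.
have -> : x ord0 j - (y ord0 j + w ord0 j) = - ((y ord0 j - x ord0 j) + w ord0 j) by ring.
rewrite normrN; apply: le_lt_trans (ler_normD _ _) _; lra.
Qed.

(** The direction is the vertical axis of the chart, rotated back. Moving up by [s] leaves the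
    Lipschitz function unchanged and raises the last coordinate by [s], more than a perturbation of
    size [dl * s] can undo. *)
Lemma inward_direction_boundary (Om : set 'rV[R]_d) p : (0 < d)%N ->
  lipschitz_boundary Om -> closure Om p -> ~ Om p ->
  exists2 dl, 0 < dl & exists nu, inward_direction Om dl p nu.
Proof.
move=> d0 lip cp np.
have [r [Q [g [L [r0 [QQ [g_loc [g_lip chart]]]]]]]] := lip p cp np.
have QTQ : Q^T *m Q = 1%:M by exact: mulmx1C.
have Q1 i j : `|Q i j| <= 1.
  have : (Q *m Q^T) i i = 1 by rewrite QQ mxE eqxx.
  rewrite mxE (bigD1 j)//= mxE => E.
  rewrite -(@expr_le1 _ 2)// real_normK ?num_real// -E expr2 lerDl.
  by apply: sumr_ge0 => k _; rewrite mxE -expr2 sqr_ge0.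
have dl' : (d.-1 < d)%N by rewrite prednK.
pose l : 'I_d := Ordinal dl'.
pose e_l : 'rV[R]_d := delta_mx ord0 l.
pose nu : 'rV[R]_d := e_l *m Q^T.
have nuQ : nu *m Q = e_l by rewrite /nu -mulmxA QTQ mulmx1.
have nu1 i : `|nu ord0 i| <= 1.
  by rewrite /nu /e_l -rowE !mxE.
clearbody nu; have dR : 1 <= d%:R :> R by rewrite ler1n.
(* With [dl * B <= 1], a perturbation [w] changes the graph height and the last coordinate by at
   most [s] altogether. The bound by [r / (3 * d + 1)] keeps all points, which differ from [p] by at
   most [3 * dl] per coordinate, inside the chart. *)
set B := (`|L| + 1) * (d%:R ^+ 2 : R) + 1.
have B1 : 1 <= B by rewrite lerDr mulr_ge0 ?sqr_ge0// addr_ge0.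
pose dl := Num.min 1 (Num.min (r / (3 * d%:R + 1)) B^-1).
have dl0 : 0 < dl.
  by rewrite !lt_min ltr01 divr_gt0 ?invr_gt0 ?ltr_wpDl ?mulr_ge0// (lt_le_trans ltr01 B1).
have dl1 : dl <= 1 by rewrite ge_min lexx.
have dlr : dl * (3 * d%:R + 1) <= r.
  by rewrite -ler_pdivlMr ?ltr_wpDl ?mulr_ge0// !ge_min lexx !orbT.
have dlB : dl * B <= 1.
  by rewrite -ler_pdivlMr ?(lt_le_trans ltr01 B1)// mul1r !ge_min lexx !orbT.
exists dl => //; exists nu; apply: inward_direction_closure => // y s w Oy yp /andP[s0
    sd] wd.
have s1 : s <= 1 by apply: le_trans dl1; exact: ltW.
have near_p v : (forall i, `|v ord0 i - p ord0 i| <= 3 * dl) -> enorm (v - p) < r.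
  move=> vp; apply: (@le_lt_trans _ _ (d%:R * (3 * dl))).
    by apply: enorm_le => i; rewrite !mxE.
  by apply: lt_le_trans dlr; lra.
have yp_r : enorm (y - p) < r by apply: near_p => i; have := yp i; lra.
have dls : dl * s <= dl by rewrite ler_piMr// ltW.
have y'p_r : enorm (y + s *: nu + w - p) < r.
  apply: near_p => i; rewrite !mxE.
  have -> : y ord0 i + s * nu ord0 i + w ord0 i - p ord0 i =
    (y ord0 i - p ord0 i) + s * nu ord0 i + w ord0 i by ring.
  have h1 := yp i; have h2 := wd i.
  have h3 : `|s * nu ord0 i| <= s.
    by rewrite normrM (gtr0_norm s0) ler_piMr// ltW.
  apply: le_trans (ler_normD _ _) _.
  have := ler_normD (y ord0 i - p ord0 i) (s * nu ord0 i); lra.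
have [j [jl gX]] := (chart y yp_r).1 Oy.
have jE : j = l by exact: val_inj.
apply/(chart _ y'p_r); exists l; split=> //.
rewrite jE in gX; set X := (y - p) *m Q in gX.
have -> : (y + s *: nu + w - p) *m Q = X + s *: e_l + w *m Q.
  by rewrite /X -nuQ scalemxAl -!mulmxDl; congr (_ *m _); apply/rowP => i; rewrite !mxE;
      ring.
have wQ k : `|(w *m Q) ord0 k| <= d%:R * (dl * s).
  rewrite mxE; apply: le_trans (ler_norm_sum _ _ _) _.
  apply: (@le_trans _ _ (\sum_(i < d) dl * s)).
    apply: ler_sum => i _; rewrite normrM -[leRHS]mulr1; apply: ler_pM => //.
    exact: ltW.
  by rewrite sumr_const card_ord mulr_natl.
have gE : g (X + s *: e_l) = g X.
  apply: g_loc => k kl; have kn : k != l by apply: contraNneq kl => ->.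
  by rewrite !mxE (negPf kn) andbF mulr0 addr0.
have := g_lip (X + s *: e_l + w *m Q) (X + s *: e_l).
have -> : X + s *: e_l + w *m Q - (X + s *: e_l) = w *m Q by rewrite addrC addKr.
rewrite gE => gL.
have eL : L * enorm (w *m Q) <= `|L| * (d%:R * (d%:R * (dl * s))).
  apply: le_trans (ler_norm _) _; rewrite normrM ler_wpM2l// ger0_norm ?sqrtr_ge0//.
  exact: enorm_le.
have gX' := le_trans (ler_norm _) (le_trans gL eL).
have := wQ l; rewrite ler_norml => /andP[wl _].
rewrite [X in _ < X](_ : _ = X ord0 l + s + (w *m Q) ord0 l);
    last by rewrite !mxE !eqxx mulr1.
have key : `|L| * (d%:R * (d%:R * (dl * s))) + d%:R * (dl * s) <= s.
  apply: (@le_trans _ _ (dl * B * s)); last by rewrite ler_piMl// ltW.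
  rewrite /B; have dls0 : 0 <= dl * s by rewrite mulr_ge0// ltW.
  have -> : dl * ((`|L| + 1) * d%:R ^+ 2 + 1) * s =
    `|L| * (d%:R * (d%:R * (dl * s))) + (d%:R ^+ 2 * (dl * s) + dl * s) by ring.
  rewrite lerD2l -[leLHS]addr0; apply: lerD => //; apply: ler_wpM2r => //.
  by rewrite expr2 ler_peMr// (le_trans ler01).
lra.
Qed.

(** Compactness of the closure: near each point, one direction works with every aperture up to half
    the local one. *)
Lemma uniform_inward_direction (Om : set 'rV[R]_d) : (0 < d)%N ->
  open Om -> bounded_set Om -> lipschitz_boundary Om ->
  exists dl, 0 < dl <= 1 /\ forall x, closure Om x -> exists nu, inward_direction Om dl
      x nu.
Proof.
move=> d0 oO bO lip.
have cpt : compact (closure Om).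
  apply: bounded_closed_compact; last exact: closed_closure.
  move: bO => [M [Mr HM]]; exists M; split=> // N MN x cx.
  have e0 : 0 < (N - M) / 2 by lra.
  have [y [Oy xy]] := cx _ (nbhsx_ballx x _ e0).
  have yN : `|y| <= (M + N) / 2 by apply: HM Oy; lra.
  have xyN : `|x - y| < (N - M) / 2 by move: xy; rewrite -ball_normE.
  have NE : N = (N - M) / 2 + (M + N) / 2 by lra.
  rewrite NE -[x](subrK y); apply: le_trans (ler_normD _ _) _.
  by apply: lerD => //; exact: ltW.
have loc x : closure Om x -> exists2 dl, 0 < dl & exists nu, inward_direction Om dl x nu.
  move=> cx; have [Ox|nOx] := pselect (Om x); last exact: inward_direction_boundary.
  by have [dl dl0 H] := inward_direction_interior oO Ox; exists dl => //; exists 0.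
have /compact_near_coveringP/(_ R 0^'+ (fun dl x => exists nu, inward_direction Om dl x
    nu)) := cpt.
move=> /(_ _ _)[|e /= e0 H].
  move=> x /loc[dl dl0 [nu Hnu]].
  have dl2 : 0 < dl / 2 by rewrite divr_gt0.
  exists (ball x (dl / 2), [set t | t <= dl / 2]) => /=.
    split; first exact: nbhsx_ballx.
    by near=> t => /=; near: t; exact: nbhs_right_le.
  move=> [x' t] /= [xx' tdl]; exists nu; apply: inward_direction_near Hnu tdl _ dl0 => i.
  have [_ /(_ ord0 i)] := xx'; by rewrite /ball /= distrC.
exists (Num.min 1 (e / 2)); rewrite lt_min ltr01 divr_gt0// ge_min lexx; split=> // x cx.
apply: H cx => //=.
  rewrite sub0r normrN ger0_norm; first by rewrite gt_min; apply/orP; right; lra.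
  by rewrite le_min ler01 ltW// divr_gt0.
by rewrite lt_min ltr01 divr_gt0.
Unshelve. all: by end_near.
Qed.

End UniformCone.

Section Segments.
Context {R : realType} {d : nat}.
Hypothesis d_gt0 : (0 < d)%N.

Lemma sum_double (V : nmodType) (F : nat -> V) n :
  \sum_(k < n.*2) F k = \sum_(j < n) (F j.*2 + F j.*2.+1).
Proof.
elim: n => [|n IH]; first by rewrite !big_ord0.
by rewrite doubleS !big_ord_recr /= IH addrA.
Qed.

Lemma segment_energy_ge0 (mu : R) (u v : 'rV[R]_d) : 0 <= segment_energy mu u v.
Proof. by rewrite mulr_ge0 ?powR_ge0. Qed.

Lemma U_fun_ge_segments (f : 'rV[R]_d -> R) (z : 'rV[R]_d) (L : seq nat)
    (A B : nat -> 'rV[R]_d) (mu : nat -> R) (kappa : R) :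
  (forall x, 0 <= f x) -> 0 < kappa -> sorted ltn L ->
  (forall k i, k \in L -> A k ord0 i <= B k ord0 i) ->
  (forall k k' i, k \in L -> k' \in L -> (k < k')%N -> B k ord0 i <= A k' ord0 i) ->
  (forall k i, k \in L -> B k ord0 i <= z ord0 i) ->
  (forall k, 0 <= mu k) ->
  (forall k u (x : 'rV[R]_d), k \in L -> 0 <= u <= 1 ->
     (forall i, `|x ord0 i - (A k ord0 i + (B k ord0 i - A k ord0 i) * u)| <= kappa) ->
     mu k <= f x) ->
  ((\sum_(k <- L) segment_energy (mu k) (A k) (B k))%:E <= U_fun f z)%E.
Proof.
move=> f0 kappa0 sL AB BA Bz mu0 tube.
pose e j := nth 0%N L j.
(* Even vertices start a segment, odd vertices end it, and the last vertex is [z]. The connecting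
   edges may leave the domain, so they get weight 0 in [mu']. *)
pose p k := if (k./2 < size L)%N then (if odd k then B else A) (e k./2) else z.
pose mu' k := if odd k then 0 else mu (e k./2).
have eL j : (j < size L)%N -> e j \in L by exact: mem_nth.
have H : ((\sum_(k < (size L).*2) segment_energy (mu' k) (p k) (p k.+1))%:E <= U_fun f z)%E.
  apply: (U_fun_ge_polygon d_gt0 (kappa := kappa)) => //.
  - move=> k i kN; have kL : (k./2 < size L)%N by rewrite ltn_half_double.
    rewrite /p kL /= uphalf_half; case: (boolP (odd k)) => ok; last first.
      by rewrite add0n kL; apply: AB; exact: eL.
    rewrite add1n; case: ltnP => [kL1|_]; last by apply: Bz; exact: eL.
    apply: BA; rewrite ?eL//; by apply: (sorted_ltn_nth ltn_trans 0%N sL); rewrite ?inE.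
  - by rewrite /p doubleK ltnn; apply/forallP.
  - by move=> k; rewrite /mu'; case: ifP.
  - move=> k u x kN u01; have kL : (k./2 < size L)%N by rewrite ltn_half_double.
    rewrite /p kL /= uphalf_half /mu'; case: (boolP (odd k)) => ok; first by move=> _;
        exact: f0.
    by rewrite add0n kL; apply: tube => //; exact: eL.
apply: le_trans H; rewrite lee_fin (sum_double (fun k => segment_energy (mu' k) (p k)
    (p k.+1))).
rewrite (big_nth 0%N) big_mkord.
apply: ler_sum => j _; rewrite -[leLHS]addr0; apply: lerD; last exact: segment_energy_ge0.
by rewrite /mu' /p /= odd_double /= doubleK uphalf_double ltn_ord.
Qed.

Lemma sum_disjoint_intervals (a b : nat -> R) (Q : pred nat) (K : nat) (l u : R) :
  (forall k k', (k < k' < K)%N -> Q k -> Q k' -> b k <= a k') ->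
  (forall k, (k < K)%N -> Q k -> l <= a k /\ b k <= u) -> l <= u ->
  \sum_(k < K | Q k) (b k - a k) <= u - l.
Proof.
elim: K u => [|K IH] u ba lu le_lu; first by rewrite big_ord0 subr_ge0.
rewrite big_mkcond big_ord_recr /= -big_mkcond /=.
case: ifPn => [QK|_]; last first.
  rewrite addr0; apply: IH => // [k k' /andP[kk' k'K]|k kK].
    by apply: ba; rewrite kk' ltnS ltnW.
  by apply: lu; rewrite ltnS ltnW.
have [laK bKu] := lu K (ltnSn K) QK.
have -> : u - l = (a K - l) + (u - a K) by ring.
apply: lerD; last by rewrite lerD2r.
apply: IH => // [k k' /andP[kk' k'K]|k kK Qk].
  by apply: ba; rewrite kk' ltnS ltnW.
split; last by apply: ba => //; rewrite kK ltnSn.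
by have [] := lu k _ Qk; rewrite // ltnS ltnW.
Qed.

(* Weighted AM-GM in a crude form: scaling the sides by [Lam^(d-1)] and
   [Lam^-1] keeps the volume and makes the [i]-th side dominant. *)
Lemma root_prod_le (D : 'I_d -> R) (Lam : R) i : 0 < Lam -> (forall j, 0 <= D j) ->
  (\prod_j D j) `^ (d%:R)^-1 <= Lam ^+ d.-1 * D i + (\sum_j D j) / Lam.
Proof.
move=> Lam0 D0; set x := Lam ^+ d.-1 * D i + _.
have S0 : 0 <= (\sum_j D j) / Lam by rewrite divr_ge0 ?sumr_ge0// ltW.
have L0 : 0 <= Lam ^+ d.-1 * D i by rewrite mulr_ge0// exprn_ge0// ltW.
have x0 : 0 <= x by rewrite addr_ge0.
rewrite -[leRHS](powR_exprn_inv d_gt0 x0).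
have P0 : 0 <= \prod_j D j by apply: prodr_ge0.
apply: ge0_ler_powR; rewrite ?invr_ge0 ?nnegrE ?exprn_ge0//.
have -> : \prod_j D j = \prod_j (if j == i then Lam ^+ d.-1 * D i else D j / Lam).
  rewrite (bigD1 i)//= [RHS](bigD1 i)//= eqxx.
  rewrite [X in _ = _ * X](eq_bigr (fun j => D j / Lam)); last by move=> j /negPf ->.
  rewrite big_split /= prodr_const.
  have -> : #|(fun j => j != i) : pred 'I_d| = d.-1.
    by rewrite -[in RHS](card_ord d) -(cardC1 i); apply: eq_card => j; rewrite !inE.
  have c0 : Lam ^+ d.-1 != 0 by rewrite expf_neq0// gt_eqF.
  by rewrite exprVn; move: (Lam ^+ d.-1) c0 => y y0; field.
have -> : x ^+ d = \prod_(j < d) x by rewrite prodr_const card_ord.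
apply: ler_prod => j _; case: eqVneq => _.
  by rewrite L0 /x lerDl.
rewrite divr_ge0 ?(ltW Lam0)//= /x; apply: ler_wpDl => //.
by rewrite ler_pM2r ?invr_gt0// (bigD1 j)//= lerDl sumr_ge0.
Qed.

End Segments.

(** * From chains to curves *)

Section ChainDecomposition.
Context {R : realType} {d : nat}.
Hypothesis d_gt0 : (0 < d)%N.
Variables (Om : set 'rV[R]_d) (f : 'rV[R]_d -> R) (m : R -> R).
Hypothesis f_ge0 : forall x, 0 <= f x.
Hypothesis m_ndecr : forall r s : R, 0 <= r -> r <= s -> m r <= m s.
Hypothesis m_ge0 : forall r : R, 0 <= r -> 0 <= m r.
Hypothesis f_mod : forall x y, Om x -> Om y -> `|f x - f y| <= m (enorm (x - y)).
Hypothesis f_out : forall x, ~ Om x -> f x = 0.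
Variables (D M1 : R).
Hypothesis D_ge0 : 0 <= D.
Hypothesis f_le : forall x, f x + 1 <= M1.
Hypothesis OmD : forall x, closure Om x -> forall i, 0 <= x ord0 i <= D.
Variables (dl s eta e' : R) (W : nat).
Hypothesis dl01 : 0 < dl <= 1.
Hypothesis cone : forall x, closure Om x -> exists nu, inward_direction Om dl x nu.
Hypothesis s0 : 0 < s < dl.
Hypothesis e'01 : 0 < e' <= 1.
Hypothesis W_gt0 : (0 < W)%N.
(** A run of [W] bins then has total width [dl / 2], within the reach of a single inward
    direction. *)
Let h := dl / (2 * W%:R).
Let K := (Num.truncn (d%:R * D / h)).+1.
Hypothesis h_s : h <= dl * s / 4.
Hypothesis eta0 : 0 < eta.
(** Rounding together with the shifts [2 * eta * k], [k < K], must use only a fraction of the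
    aperture [dl * s] of the cone. *)
Hypothesis eta_s : 2 * eta * (K%:R + 2) <= dl * s / 4.

(* The summand [e'] makes the bound positive on boxes where [f] vanishes. *)
Definition box_sup (u v : 'rV[R]_d) : R := sup [set f y | y in [set y | in_box u v y]] + e'.

Let s_gt0 : 0 < s. Proof. by case/andP: s0. Qed.
Let dl_gt0 : 0 < dl. Proof. by case/andP: dl01. Qed.
Let h_gt0 : 0 < h. Proof. by rewrite divr_gt0// mulr_gt0// ltr0n. Qed.
Let dls : dl * s <= s. Proof. by rewrite ler_piMl ?(ltW s_gt0)//; case/andP: dl01. Qed.

Lemma box_sup_ge u v y : in_box u v y -> f y <= box_sup u v.
Proof.
move=> uvy; have e'0 : 0 < e' by case/andP: e'01.
apply: (@le_trans _ _ (sup [set f y | y in [set y | in_box u v y]]));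
    last by rewrite lerDl ltW.
apply: ub_le_sup; last by exists y.
by exists M1 => _ [x _ <-]; have := f_le x; lra.
Qed.

Lemma box_sup_le u v C : leqv u v -> (forall y, in_box u v y -> f y <= C) ->
  box_sup u v <= C + e'.
Proof.
move=> /forallP uv H; rewrite lerD2r; apply: ge_sup.
  by exists (f u); exists u => // i; rewrite lexx uv.
by move=> _ [y yb <-]; exact: H.
Qed.

Lemma box_sup_gt0 u v : leqv u v -> 0 < box_sup u v.
Proof.
move=> /forallP uv; apply: ltr_wpDl; last by case/andP: e'01.
apply: (le_trans (f_ge0 u)); apply: ub_le_sup; last by exists u => // i; rewrite lexx uv.
by exists M1 => _ [x _ <-]; have := f_le x; lra.
Qed.

Lemma box_sup_leM u v : leqv u v -> box_sup u v <= M1.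
Proof.
move=> uv; apply: (@le_trans _ _ (M1 - 1 + e')); last by case/andP: e'01; lra.
by apply: box_sup_le => // y _; have := f_le y; lra.
Qed.

Variables (n : nat) (pts : nat -> 'rV[R]_d) (z : 'rV[R]_d) (S : {set 'I_n}).
Let q (i : 'I_n) := pts i.
Hypothesis pts_cl : forall i : 'I_n, closure Om (q i).
Hypothesis S_le : forall i, i \in S -> leqv (q i) z.
Hypothesis S_cmp : forall i j, i \in S -> j \in S -> leqv (q i) (q j) || leqv (q j) (q i).
Hypothesis S_inj : forall i j, i \in S -> j \in S -> q i = q j -> i = j.

(** Along a chain this sum orders the points, and its increments bound those of every single
    coordinate. *)
Let sg (x : 'rV[R]_d) := \sum_l x ord0 l.

Let sg_ge0 i : 0 <= sg (q i).
Proof. by apply: sumr_ge0 => l _; have /andP[] := OmD (@pts_cl i) l. Qed.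

Let sg_leD i : sg (q i) <= d%:R * D.
Proof.
apply: (@le_trans _ _ (\sum_(l < d) D)); last by rewrite sumr_const card_ord mulr_natl.
by apply: ler_sum => l _; have /andP[] := OmD (@pts_cl i) l.
Qed.

Let sg_diff (x y : 'rV[R]_d) l : (forall l, x ord0 l <= y ord0 l) -> y ord0 l - x ord0
    l <= sg y - sg x.
Proof.
move=> xy; rewrite -sumrB (bigD1 l)//= lerDl; apply: sumr_ge0 => k _.
by rewrite subr_ge0.
Qed.

Let chain_le i j l : i \in S -> j \in S -> sg (q i) <= sg (q j) -> q i ord0 l <= q j ord0 l.
Proof.
move=> iS jS ij; have /orP[/forallP//|/forallP ji] := S_cmp iS jS.
have := sg_diff l ji; lra.
Qed.

Let bin i := Num.truncn (sg (q i) / h).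
Let run k := (k %/ W)%N.

Let binP i : (bin i)%:R * h <= sg (q i) < (bin i).+1%:R * h.
Proof.
have H : 0 <= sg (q i) / h by rewrite divr_ge0// ltW.
by have := truncn_itv H; rewrite -/(bin i) ler_pdivlMr// ltr_pdivrMr.
Qed.

Let bin_ltK i : (bin i < K)%N.
Proof. by rewrite ltnS /bin; apply: le_truncn; rewrite ler_pM2r ?invr_gt0. Qed.

Let bin_lt i j : (bin i < bin j)%N -> sg (q i) <= sg (q j).
Proof.
move=> ij; have /andP[_ /ltW h1] := binP i; have /andP[h2 _] := binP j.
by apply: (le_trans h1); apply: le_trans h2; rewrite ler_pM2r// ler_nat.
Qed.

Let bin_eq i j : bin i = bin j -> sg (q i) - sg (q j) <= h.
Proof.
move=> ij; have /andP[_ h1] := binP i; have /andP[h2 _] := binP j.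
by rewrite -ij in h2; move: h1; rewrite -natr1 mulrDl mul1r => h1; lra.
Qed.

Let run_sg i j : run (bin i) = run (bin j) -> sg (q i) - sg (q j) < dl.
Proof.
move=> ij; have /andP[_ h1] := binP i; have /andP[h2 _] := binP j.
have hi : (bin i < (run (bin i)).+1 * W)%N by rewrite ltn_ceil.
have hj : (run (bin i) * W <= bin j)%N by rewrite ij leq_trunc_div.
have h3 : (bin i).+1%:R * h <= ((run (bin i))%:R + 1) * W%:R * h.
  by rewrite ler_pM2r// natr1 -natrM ler_nat.
have h4 : (run (bin i))%:R * W%:R * h <= (bin j)%:R * h by rewrite ler_pM2r// -natrM
    ler_nat.
have hW : W%:R * h = dl / 2 by rewrite /h; field; rewrite pnatr_eq0 -lt0n.
move: h3 h4; rewrite -!mulrA hW => h3 h4; have := dl_gt0; lra.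
Qed.

(** This bound on the number of runs involves neither [s] nor [W]. The loss from dropped boxes is
    counted per run, so [s] can be chosen after [J]. *)
Let J := (Num.truncn (2 * d%:R * D / dl)).+1.

Let run_ltJ i : (run (bin i) < J)%N.
Proof.
rewrite ltnS /J truncn_ge_nat; last first.
  rewrite divr_ge0 ?(ltW dl_gt0)// -mulrA mulr_ge0//.
  exact: le_trans (sg_ge0 i) (sg_leD i).
have hj : (run (bin i) * W <= bin i)%N by rewrite leq_trunc_div.
have /andP[h2 _] := binP i.
have W0 : 0 < W%:R :> R by rewrite ltr0n.
have hW : W%:R * h = dl / 2 by rewrite /h; field; rewrite pnatr_eq0 -lt0n.
rewrite ler_pdivlMr//; have h4 : (run (bin i))%:R * W%:R * h <= (bin i)%:R * h.
  by rewrite ler_pM2r// -natrM ler_nat.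
move: h4; rewrite -mulrA hW => h4; have := sg_leD i.
move: ((run (bin i))%:R : R) h4 => r h4; lra.
Qed.

Let extremes (T : {set 'I_n}) : T \subset S -> T != finset.set0 ->
  exists i j, [/\ i \in T, j \in T &
    forall k l, k \in T -> q i ord0 l <= q k ord0 l <= q j ord0 l].
Proof.
move=> /fintype.subsetP TS /set0Pn[i0 i0T].
case: (@arg_minP _ _ _ i0 (mem T) (fun i => sg (q i)) i0T) => i iT imin.
case: (@arg_maxP _ _ _ i0 (mem T) (fun i => sg (q i)) i0T) => j jT jmax.
exists i, j; split=> // k l kT.
by rewrite !chain_le ?TS ?imin//; exact: jmax.
Qed.

Let Tb k := [set i in S | bin i == k]%SET.
Let Tr r := [set i in S | run (bin i) == r]%SET.
Let present k := Tb k != finset.set0.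

Let TbP i k : (i \in Tb k) = (i \in S) && (bin i == k).
Proof. by rewrite finset.inE. Qed.
Let TrP i r : (i \in Tr r) = (i \in S) && (run (bin i) == r).
Proof. by rewrite finset.inE. Qed.

Lemma chain_bins : exists lohi : nat -> 'rV[R]_d * 'rV[R]_d, forall k, present k ->
  [/\ exists2 i, i \in Tb k & (lohi k).1 = q i, exists2 i, i \in Tb k & (lohi k).2 = q i &
  forall i l, i \in Tb k -> (lohi k).1 ord0 l <= q i ord0 l <= (lohi k).2 ord0 l].
Proof.
have H k : exists lh : 'rV[R]_d * 'rV[R]_d, present k ->
  [/\ exists2 i, i \in Tb k & lh.1 = q i, exists2 i, i \in Tb k & lh.2 = q i &
  forall i l, i \in Tb k -> lh.1 ord0 l <= q i ord0 l <= lh.2 ord0 l]; last first.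
  by have [lohi Hlohi] := choice H; exists lohi.
case: (boolP (present k)) => [pk|_]; last by exists (0, 0).
have TS : Tb k \subset S by apply/fintype.subsetP => i; rewrite TbP => /andP[].
have [i [j [iT jT H]]] := extremes TS pk.
by exists (q i, q j) => _; split=> //; [exists i|exists j].
Qed.

(** The first component is the top point of the run, the second an inward direction at its lowest
    point; every point of the run is within [dl] of the lowest one, so the same direction serves
    them all. *)
Lemma chain_runs : exists tn : nat -> 'rV[R]_d * 'rV[R]_d, forall r, Tr r != finset.set0 ->
  [/\ exists2 i, i \in Tr r & (tn r).1 = q i,
   forall i l, i \in Tr r -> q i ord0 l <= (tn r).1 ord0 l,
   forall i, `|(tn r).2 ord0 i| <= 1 &
   forall i (w : 'rV[R]_d), i \in Tr r -> (forall l, `|w ord0 l| < dl * s) -> Om (q i +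
       s *: (tn r).2 + w)].
Proof.
have H r : exists tn : 'rV[R]_d * 'rV[R]_d, Tr r != finset.set0 ->
  [/\ exists2 i, i \in Tr r & tn.1 = q i,
   forall i l, i \in Tr r -> q i ord0 l <= tn.1 ord0 l,
   forall i, `|tn.2 ord0 i| <= 1 &
   forall i (w : 'rV[R]_d), i \in Tr r -> (forall l, `|w ord0 l| < dl * s) -> Om (q i +
       s *: tn.2 + w)]; last first.
  by have [tn Htn] := choice H; exists tn.
case: (boolP (Tr r != finset.set0)) => [pr|_]; last by exists (0, 0).
have TS : Tr r \subset S by apply/fintype.subsetP => i; rewrite TrP => /andP[].
have [i0 [j [i0T jT H]]] := extremes TS pr.
have [nu [nu1 nuP]] := cone (@pts_cl i0).
exists (q j, nu) => _; split=> //; first by exists j.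
  by move=> i l iT; have /andP[] := H i l iT.
move=> i w iT wd; apply: (nuP (q i) s w (@pts_cl i)) => // l.
have /andP[ql _] := H i l iT.
rewrite ger0_norm ?subr_ge0//.
apply: (@le_lt_trans _ _ (sg (q i) - sg (q i0))).
  by apply: sg_diff => l'; have /andP[] := H i l' iT.
by apply: run_sg; move: iT i0T; rewrite !TrP => /andP[_ /eqP->] /andP[_ /eqP->].
Qed.

Lemma card_chain_bins : #|S| = (\sum_(k < K | present k) #|Tb k|)%N.
Proof.
rewrite -sum1_card (partition_big (fun i => Ordinal (bin_ltK i)) (fun k => present k))/=.
  by apply: eq_bigr => k _; rewrite -sum1_card; apply: eq_bigl => i; rewrite TbP.
move=> i iS; apply/set0Pn; exists i; by rewrite TbP iS /=.
Qed.

Let M1_ge1 : 1 <= M1. Proof. by have := f_le 0; have := f_ge0 0; lra. Qed.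

(** Subadditivity of the [d]-th root, from superadditivity of the [d]-th power. *)
Lemma powR_invnD (x y : R) : 0 <= x -> 0 <= y ->
  (x + y) `^ (d%:R)^-1 <= x `^ (d%:R)^-1 + y `^ (d%:R)^-1.
Proof.
move=> x0 y0; have rt (t : R) : 0 <= t -> (t `^ (d%:R)^-1) ^+ d = t.
  by move=> t0; rewrite -powR_mulrn ?powR_ge0// -powRrM mulVf ?powRr1// pnatr_eq0 -lt0n.
have sup_add k (a b : R) : 0 <= a -> 0 <= b -> a ^+ k.+1 + b ^+ k.+1 <= (a + b) ^+ k.+1.
  move=> a0 b0; elim: k => [|k IH]; first by rewrite !expr1.
  rewrite exprS [(a + b) ^+ _]exprS [b ^+ k.+2]exprS.
  apply: (@le_trans _ _ ((a + b) * (a ^+ k.+1 + b ^+ k.+1)));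
      last by rewrite ler_wpM2l ?addr_ge0.
  have h1 : 0 <= a ^+ k.+1 by rewrite exprn_ge0.
  have h2 : 0 <= b ^+ k.+1 by rewrite exprn_ge0.
  move: (a ^+ k.+1) (b ^+ k.+1) h1 h2 => u v u0 v0.
  rewrite mulrDl !mulrDr -!addrA lerD2l addrCA addrA lerDr.
  by rewrite addr_ge0// mulr_ge0.
set a := x `^ _; set b := y `^ _.
have a0 : 0 <= a by exact: powR_ge0.
have b0 : 0 <= b by exact: powR_ge0.
rewrite -[leRHS](powR_exprn_inv d_gt0)//; last exact: addr_ge0.
apply: ge0_ler_powR; rewrite ?invr_ge0 ?nnegrE ?exprn_ge0 ?addr_ge0//.
have -> : x + y = a ^+ d + b ^+ d by rewrite (rt x x0) (rt y y0).
by have := sup_add d.-1 a b a0 b0; rewrite prednK.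
Qed.

(* The chain is cut into bins of diameter at most [h] by the sum of the
   coordinates, and [W] consecutive bins form a run, on which one inward
   direction [nu] is available. The boxes spanned by the bins, rounded to the
   [eta]-grid and translated by [s *: nu], lie in [Om]; they are still ordered
   once the boxes too close to the end of their run are dropped. A dropped box
   has its [l]-th side in an interval of length [5 * s] for some [l], so the
   dropped energy is small by [root_prod_le]. *)
Lemma chain_decomposition (Lam : R) : 0 < Lam ->
  exists (V : R) (pr : pred nat) (u v : nat -> 'rV[R]_d),
  [/\ (V%:E <= U_fun f z)%E,
   (#|S| <= \sum_(k < K | pr k) longest_chain n pts (in_hbox (u k) (v k)))%N,
   forall k, pr k -> exists gu gv : 'I_d -> nat, forall l,
     [/\ u k ord0 l = eta * (gu l)%:R, v k ord0 l = eta * (gv l)%:R,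
         (gu l < gv l <= (Num.truncn (D / eta)).+1)%N & v k ord0 l - u k ord0 l <= s] &
   \sum_(k < K | pr k) (box_sup (u k) (v k) * \prod_l (v k ord0 l - u k ord0 l)) `^
       (d%:R)^-1
   <= V + (m (4 * d%:R * s) + e') `^ (d%:R)^-1 * (2 * (d%:R * (D + 2)))
      + J%:R * (d%:R * (M1 * (Lam ^+ d.-1 * (5 * s) + d%:R * (D + 2) / Lam)))].
Proof.
move=> Lam0.
have [lohi lohiP] := chain_bins; have [tn tnP] := chain_runs.
pose lo k := (lohi k).1; pose hi k := (lohi k).2.
pose top r := (tn r).1; pose nu r := (tn r).2.
have s1 : s <= 1 by case/andP: dl01 => _; case/andP: s0 => _; lra.
have etaK : 2 * eta * K%:R + 4 * eta <= s / 4.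
  have := eta_s; have := dls; lra.
have h_le : h <= s / 4 by have := h_s; have := dls; lra.
have k_eta k : (k < K)%N -> 0 <= 2 * eta * k%:R <= 2 * eta * K%:R.
  move=> kK; rewrite mulr_ge0 ?ler0n//=; last by rewrite mulr_ge0// ltW.
  by rewrite ler_wpM2l ?mulr_ge0 ?(ltW eta0)// ler_nat ltnW.
have presentK k : present k -> (k < K)%N.
  by move=> /set0Pn[i]; rewrite TbP => /andP[_ /eqP <-].
have loP k : present k -> exists i, [/\ i \in S, bin i = k & lo k = q i].
  by move=> /lohiP[[i + e] _ _]; rewrite TbP => /andP[iS /eqP ik]; exists i.
have hiP k : present k -> exists i, [/\ i \in S, bin i = k & hi k = q i].
  by move=> /lohiP[_ [i + e] _]; rewrite TbP => /andP[iS /eqP ik]; exists i.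
have lo_hi k l : present k -> lo k ord0 l <= hi k ord0 l.
  move=> pk; have [[i iT e] _ H] := lohiP k pk.
  by have /andP[h1 h2] := H i l iT; exact: le_trans h1 h2.
have hi_lo_h k l : present k -> hi k ord0 l - lo k ord0 l <= h.
  move=> pk; have [i [iS ik ei]] := loP k pk; have [j [jS jk ej]] := hiP k pk.
  apply: (@le_trans _ _ (sg (hi k) - sg (lo k))).
    by apply: sg_diff => l'; exact: lo_hi.
  by rewrite ei ej; apply: bin_eq; rewrite ik jk.
have lo0 k l : present k -> 0 <= lo k ord0 l.
  by move=> pk; have [i [iS ik ei]] := loP k pk; rewrite ei;
      have /andP[] := OmD (@pts_cl i) l.
have hiD k l : present k -> hi k ord0 l <= D.
  by move=> pk; have [i [iS ik ei]] := hiP k pk; rewrite ei;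
      have /andP[] := OmD (@pts_cl i) l.
have hi_lo_lt k k' l : present k -> present k' -> (k < k')%N -> hi k ord0 l <= lo k' ord0 l.
  move=> pk pk' kk'; have [i [iS ik ei]] := hiP k pk; have [j [jS jk ej]] := loP k' pk'.
  by rewrite ei ej; apply: chain_le => //; apply: bin_lt; rewrite ik jk.
have TrN k : present k -> Tr (run k) != finset.set0.
  move=> pk; have [i [iS ik ei]] := loP k pk; apply/set0Pn; exists i.
  by rewrite TrP iS ik /=.
have hi_top k l : present k -> hi k ord0 l <= top (run k) ord0 l.
  move=> pk; have [_ H _ _] := tnP _ (TrN k pk); have [i [iS ik ei]] := hiP k pk.
  by rewrite ei; apply: H; rewrite TrP iS ik /=.
have top_lo k k' l : present k -> present k' -> (run k < run k')%N -> top (run k) ord0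
    l <= lo k' ord0 l.
  move=> pk pk' kk'; have [[i + ei] _ _ _] := tnP _ (TrN k pk).
  rewrite TrP => /andP[iS /eqP ir]; have [j [jS jk ej]] := loP k' pk'.
  rewrite /top ei ej; apply: chain_le => //; apply: bin_lt; rewrite jk.
  rewrite ltnNge; apply/negP => H; move: kk'; rewrite -ir ltnNge => /negP; apply.
  exact: leq_div2r.
have top_z k l : present k -> top (run k) ord0 l <= z ord0 l.
  move=> pk; have [[i + ei] _ _ _] := tnP _ (TrN k pk).
  by rewrite TrP => /andP[iS _]; rewrite /top ei; have /forallP := S_le iS; apply.
pose gu k l := Num.truncn (lo k ord0 l / eta).
pose gv k l := (Num.truncn (hi k ord0 l / eta)).+1.
pose u k : 'rV[R]_d := \row_l (eta * (gu k l)%:R).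
pose v k : 'rV[R]_d := \row_l (eta * (gv k l)%:R).
have uP k l : present k -> u k ord0 l <= lo k ord0 l < u k ord0 l + eta.
  move=> pk; rewrite mxE; have H : 0 <= lo k ord0 l / eta by rewrite divr_ge0 ?lo0// ltW.
  have := truncn_itv H; rewrite -/(gu k l) ler_pdivlMr// ltr_pdivrMr// -natr1.
  by rewrite mulrDl mul1r mulrC.
have vP k l : present k -> hi k ord0 l < v k ord0 l <= hi k ord0 l + eta.
  move=> pk; rewrite mxE; have H : 0 <= hi k ord0 l / eta.
    exact: divr_ge0 (le_trans (lo0 k l pk) (lo_hi k l pk)) (ltW eta0).
  have := truncn_itv H; rewrite ler_pdivlMr// ltr_pdivrMr// /gv -natr1.
  by rewrite mulrDl mul1r mulrDr mulr1 mulrC lerD2r andbC.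
have u0 k l : 0 <= u k ord0 l by rewrite mxE mulr_ge0 ?ler0n// ltW.
have uv_lt k l : present k -> u k ord0 l < v k ord0 l.
  move=> pk; have /andP[h1 _] := uP k l pk; have /andP[h2 _] := vP k l pk.
  by have := lo_hi k l pk; lra.
have uv_s k l : present k -> v k ord0 l - u k ord0 l <= h + 2 * eta.
  move=> pk; have /andP[h1 h1'] := uP k l pk; have /andP[h2 h2'] := vP k l pk.
  by have := hi_lo_h k l pk; lra.
have uv_leq k : present k -> leqv (u k) (v k).
  by move=> pk; apply/forallP => l; apply: ltW; exact: uv_lt.
(* Rounding makes successive boxes overlap by less than [2 * eta]; the extra
   translation by [2 * eta * k] separates them again. *)
pose A k l := u k ord0 l + 2 * eta * k%:R.
pose B k l := v k ord0 l + 2 * eta * k%:R.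
have BAE k l : B k l - A k l = v k ord0 l - u k ord0 l by rewrite /A /B; ring.
have BA_le k k' l : present k -> present k' -> (k < k')%N -> B k l <= A k' l.
  move=> pk pk' kk'; have /andP[_ h2] := vP k l pk; have /andP[_ h1] := uP k' l pk'.
  have := hi_lo_lt k k' l pk pk' kk'; rewrite /A /B => h3.
  have : 2 * eta * (k%:R + 1) <= 2 * eta * k'%:R.
    by rewrite ler_wpM2l ?mulr_ge0 ?(ltW eta0)// natr1 ler_nat.
  lra.
have AB k l : present k -> A k l <= B k l.
  by move=> pk; rewrite /A /B lerD2r ltW// uv_lt.
have A0 k l : 0 <= A k l.
  by rewrite /A addr_ge0// mulr_ge0// mulr_ge0// ltW.
have BD k l : present k -> B k l <= D + 2.
  move=> pk; have /andP[_ h1] := vP k l pk; have := hiD k l pk.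
  by have /andP[_ h2] := k_eta k (presentK k pk); rewrite /B; have := eta0; lra.
have width_sum l : \sum_(k < K | present k) (B k l - A k l) <= D + 2.
  rewrite -[leRHS]subr0; apply: (@sum_disjoint_intervals _ (A^~ l) (B^~ l) present).
  - by move=> k k' /andP[kk' _] pk pk'; exact: BA_le.
  - by move=> k _ pk; split; [exact: A0|exact: BD].
  - by have := D_ge0; lra.
pose P k := (\prod_l (B k l - A k l)) `^ (d%:R)^-1.
pose Ms k := box_sup (u k) (v k).
have Ms0 k : present k -> 0 <= Ms k by move=> pk; apply: ltW; apply: box_sup_gt0;
    exact: uv_leq.
have dR0 : 0 <= (d%:R : R)^-1 by rewrite invr_ge0.
have dR1 : (d%:R : R)^-1 <= 1 by rewrite invf_le1 ?ltr0n// ler1n.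
have side0 k l : present k -> 0 <= B k l - A k l by move=> pk; rewrite subr_ge0 AB.
have E_split k : present k ->
   (box_sup (u k) (v k) * \prod_l (v k ord0 l - u k ord0 l)) `^ (d%:R)^-1 = Ms k `^
       (d%:R)^-1 * P k.
  move=> pk; rewrite -/(Ms k) /P; under [in RHS]eq_bigr do rewrite BAE.
  rewrite powRM ?Ms0//; apply: prodr_ge0 => l _; by rewrite -BAE side0.
(* Translations in two runs can differ by [2 * s] per coordinate, and rounding and shifts cost at
   most another [s]. *)
pose keep k := present k && [forall l, hi k ord0 l + 3 * s <= top (run k) ord0 l].
pose Tm := m (4 * d%:R * s) + e'.
have Tm0 : 0 <= Tm.
  by rewrite addr_ge0 ?m_ge0// ?mulr_ge0 ?(ltW s_gt0)//; case/andP: e'01 => /ltW.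
(* Points of the translated box are within [4 * s] per coordinate of the original one, so [f] drops
   below [Ms k] by at most the modulus at [4 * d * s] plus the summand [e'] of [box_sup]. *)
pose mu k := Num.max 0 (Ms k - Tm).
pose nuk k := nu (run k).
have nu1 k l : present k -> - 1 <= nuk k ord0 l <= 1.
  by move=> pk; have [_ _ H _] := tnP _ (TrN k pk); rewrite -ler_norml.
have nus k l : present k -> - s <= s * nuk k ord0 l <= s.
  move=> pk; have /andP[h1 h2] := nu1 k l pk; have sp := s_gt0; apply/andP; split; nra.
pose L := [seq k <- iota 0 K | keep k].
have LP k : k \in L -> keep k /\ present k.
  by rewrite mem_filter => /andP[kk _]; split => //; case/andP: kk.
pose A' k : 'rV[R]_d := \row_l (A k l + s * nuk k ord0 l).
pose B' k : 'rV[R]_d := \row_l (B k l + s * nuk k ord0 l).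
pose V := \sum_(k <- L) segment_energy (mu k) (A' k) (B' k).
have VU : (V%:E <= U_fun f z)%E.
  apply: (U_fun_ge_segments d_gt0 (kappa := dl * s / 4)) => //.
  - by rewrite divr_gt0// mulr_gt0.
  - by apply: sorted_filter; [exact: ltn_trans|exact: iota_ltn_sorted].
  - by move=> k l /LP[_ pk]; rewrite !mxE lerD2r AB.
  - move=> k k' l /LP[/andP[_ /forallP kk] pk] /LP[_ pk'] kk'; rewrite !mxE.
    (* Within a run the translation is common and preserves the order; between runs the margin
       [3 * s] of [keep] and the top point of the earlier run separate the boxes. *)
    have [rk|rk] := eqVneq (run k) (run k').
      by rewrite /nuk rk lerD2r; exact: BA_le.
    have rlt : (run k < run k')%N by rewrite ltn_neqAle rk leq_div2r// ltnW.
    have h1 := top_lo k k' l pk pk' rlt; have h2 := kk l.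
    have /andP[_ h3] := vP k l pk; have /andP[_ h4] := uP k' l pk'.
    have /andP[_ h5] := k_eta k (presentK k pk);
        have /andP[h6 _] := k_eta k' (presentK k' pk').
    have /andP[_ h7] := nus k l pk; have /andP[h8 _] := nus k' l pk'.
    rewrite /A /B; have := eta0; have := s_gt0; lra.
  - move=> k l /LP[/andP[_ /forallP kk] pk]; rewrite !mxE.
    have h1 := top_z k l pk; have h2 := kk l.
    have /andP[_ h3] := vP k l pk; have /andP[_ h5] := k_eta k (presentK k pk).
    have /andP[_ h7] := nus k l pk; rewrite /B; have := eta0; have := s_gt0; lra.
  - by move=> k; rewrite /mu le_max lexx.
  move=> k t x /LP[_ pk] /andP[t0 t1] xH.
  have xlo l : `|x ord0 l - (lo k ord0 l + s * nuk k ord0 l)| < dl * s.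
    have := xH l; rewrite !mxE.
    have -> : B k l + s * nuk k ord0 l - (A k l + s * nuk k ord0 l) = B k l - A k l by ring.
    rewrite BAE ler_norml => /andP[x1 x2].
    have h1 := uv_s k l pk; have h2 := uv_lt k l pk; have /andP[h3 h4] := uP k l pk.
    have /andP[h5 h6] := k_eta k (presentK k pk).
    have h7 : 0 <= (v k ord0 l - u k ord0 l) * t by rewrite mulr_ge0// subr_ge0 ltW.
    have h8 : (v k ord0 l - u k ord0 l) * t <= v k ord0 l - u k ord0 l.
      by rewrite ler_piMr// subr_ge0 ltW.
    have h9 := h_s; have h10 := eta_s; have h11 := eta0.
    have h12 : 0 < dl * s by rewrite mulr_gt0.
    move: x1 x2; rewrite /A; move: ((v k ord0 l - u k ord0 l) * t) h7 h8 => y y0 y1 x1 x2.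
    rewrite ltr_norml; apply/andP; split; lra.
  have [i [iS ik ei]] := loP k pk.
  have Ox : Om x.
    have [_ _ _ H] := tnP _ (TrN k pk).
    have -> : x = q i + s *: (tn (run k)).2 + (x - (q i + s *: (tn (run k)).2)).
      by rewrite addrC subrK.
    apply: H; first by rewrite TrP iS ik /=.
    by move=> l; have := xlo l; rewrite ei !mxE.
  have Msx : Ms k <= f x + m (4 * d%:R * s) + e'.
    apply: box_sup_le; first exact: uv_leq.
    move=> y yb; have [Oy|nOy] := pselect (Om y); last first.
      by rewrite f_out// addr_ge0// m_ge0// !mulr_ge0// ltW.
    have := f_mod Oy Ox; rewrite ler_norml => /andP[_ fyx].
    suff : m (enorm (y - x)) <= m (4 * d%:R * s) by lra.
    apply: m_ndecr; first exact: sqrtr_ge0.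
    rewrite -[4 * _]mulrC -mulrA; apply: enorm_le => l; rewrite !mxE.
    have /andP[y1 y2] := yb l; have /andP[h1 h2] := uP k l pk; have h3 := uv_s k l pk.
    have := xlo l; rewrite ltr_norml => /andP[h4 h5]; have /andP[h6 h7] := nus k l pk.
    have h8 := uv_lt k l pk; have h9 := h_le; have h10 := etaK; have h11 := dls;
        have h12 := eta0.
    have h13 : 0 <= 2 * eta * K%:R by rewrite !mulr_ge0// ltW.
    rewrite ler_norml; apply/andP; split; lra.
  by rewrite /mu ge_max f_ge0 /=; rewrite /Tm; lra.
have sum_side_le Q : \sum_(k < K | present k && Q k) \sum_l (B k l - A k l) <= d%:R *
    (D + 2).
  rewrite exchange_big /=; apply: (@le_trans _ _ (\sum_(l < d) (D + 2))); last first.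
    by rewrite sumr_const card_ord mulr_natl.
  apply: ler_sum => l _; apply: le_trans (width_sum l).
  rewrite [leRHS](bigID (fun k : 'I_K => Q k)) /= lerDl.
  by apply: sumr_ge0 => k /andP[pk _]; exact: side0.
have P0 k : 0 <= P k by exact: powR_ge0.
have P_le k : present k -> P k <= 2 * \sum_l (B k l - A k l).
  move=> pk; have := @root_prod_le R d d_gt0 (fun l => B k l - A k l) 1 (Ordinal d_gt0)
      ltr01 (fun l => side0 k l pk).
  move=> /le_trans; apply; rewrite expr1n mul1r divr1 mulrDl mul1r lerD2r.
  by rewrite (bigD1 (Ordinal d_gt0))//= lerDl; apply: sumr_ge0 => l _; exact: side0.
pose Wd k l := Lam ^+ d.-1 * (B k l - A k l) + (\sum_j (B k j - A k j)) / Lam.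
have Wd0 k l : present k -> 0 <= Wd k l.
  move=> pk; rewrite addr_ge0// ?mulr_ge0 ?exprn_ge0 ?invr_ge0 ?(ltW Lam0) ?side0//.
  by apply: sumr_ge0 => j _; exact: side0.
have M10 : 0 <= M1 by rewrite (le_trans ler01).
have E_Wd k l : present k -> Ms k `^ (d%:R)^-1 * P k <= M1 * Wd k l.
  move=> pk; apply: ler_pM; rewrite ?powR_ge0//.
    apply: (@le_trans _ _ (M1 `^ (d%:R)^-1)).
      by apply: ge0_ler_powR => //; rewrite ?nnegrE ?Ms0//; apply: box_sup_leM;
          exact: uv_leq.
    by rewrite -[leRHS]powRr1//; apply: ler_powR.
  by apply: root_prod_le => // j; exact: side0.
have E_keep k : present k -> Ms k `^ (d%:R)^-1 * P k <=
    segment_energy (mu k) (A' k) (B' k) + Tm `^ (d%:R)^-1 * (2 * \sum_l (B k l - A k l)).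
  move=> pk; rewrite /segment_energy.
  have -> : \prod_l (B' k ord0 l - A' k ord0 l) = \prod_l (B k l - A k l).
    by apply: eq_bigr => l _; rewrite !mxE; ring.
  rewrite -/(P k).
  apply: (@le_trans _ _ (mu k `^ (d%:R)^-1 * P k + Tm `^ (d%:R)^-1 * P k)); last first.
    by rewrite lerD2l; apply: ler_wpM2l; [exact: powR_ge0|exact: P_le].
  rewrite -mulrDl; apply: ler_wpM2r => //.
  have mu0 : 0 <= mu k by rewrite /mu le_max lexx.
  apply: le_trans (powR_invnD mu0 Tm0).
  have MT : Ms k <= mu k + Tm by rewrite -lerBlDr /mu le_max lexx orbT.
  exact: (ge0_ler_powR dR0 (Ms0 k pk) (addr_ge0 mu0 Tm0) MT).
(* Each dropped box is charged to its run [r] and to a coordinate [l] in which the margin fails. *)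
pose Q r l k := (run k == r) && (top r ord0 l < hi k ord0 l + 3 * s).
have drop_sum r l : \sum_(k < K | present k && Q r l k) M1 * Wd k l <=
    M1 * (Lam ^+ d.-1 * (5 * s) + d%:R * (D + 2) / Lam).
  rewrite -mulr_sumr; apply: ler_wpM2l => //; rewrite big_split /= -mulr_sumr -mulr_suml.
  apply: lerD; last by apply: ler_wpM2r; [rewrite invr_ge0 ltW|exact: sum_side_le].
  apply: ler_wpM2l; first by rewrite exprn_ge0// ltW.
  (* The upper end exceeds [top - 3 * s], the bin width and rounding cost at most another [s] below,
     and rounding and shifts at most [s] above the top. *)
  have -> : 5 * s = (top r ord0 l + s) - (top r ord0 l - 4 * s) by ring.
  apply: (@sum_disjoint_intervals _ (A^~ l) (B^~ l) (fun k => present k && Q r l k)).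
  - by move=> k k' /andP[kk' _] /andP[pk _] /andP[pk' _]; exact: BA_le.
  - move=> k _ /andP[pk /andP[/eqP <- h0]].
    have h1 := hi_top k l pk; have h2 := hi_lo_h k l pk.
    have /andP[h3 h4] := uP k l pk; have /andP[h5 h6] := vP k l pk.
    have /andP[h7 h8] := k_eta k (presentK k pk).
    have h9 := eta0; have h10 := s_gt0; rewrite /A /B; split; lra.
  - by have := s_gt0; lra.
exists V, present, u, v; split=> //.
- rewrite card_chain_bins; apply: leq_sum => k pk; apply: leq_longest_chain.
  + move=> i iT; have [_ _ H] := lohiP k pk; apply/forallP => l.
    have /andP[h1 h2] := H i l iT; have /andP[h3 _] := uP k l pk;
        have /andP[h4 _] := vP k l pk.
    by rewrite (le_trans h3 h1) (le_lt_trans h2 h4).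
  + by move=> i j; rewrite !TbP => /andP[iS _] /andP[jS _]; exact: S_cmp.
  + by move=> i j; rewrite !TbP => /andP[iS _] /andP[jS _]; exact: S_inj.
- move=> k pk; exists (gu k), (gv k) => l; rewrite !mxE; split=> //.
    apply/andP; split.
      rewrite /gv ltnS /gu; apply: le_truncn; rewrite ler_pM2r ?invr_gt0//.
      exact: lo_hi.
    by rewrite /gv ltnS; apply: le_truncn; rewrite ler_pM2r ?invr_gt0// hiD.
  have := uv_s k l pk; rewrite !mxE => /le_trans; apply.
  by have := h_le; have := etaK; have := s_gt0;
      have := mulr_ge0 (mulr_ge0 (ler0n R 2) (ltW eta0)) (ler0n R K); lra.
rewrite (eq_bigr (fun k : 'I_K => Ms k `^ (d%:R)^-1 * P k)); last by move=> k;
    exact: E_split.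
rewrite (bigID (fun k : 'I_K => [forall l, hi k ord0 l + 3 * s <= top (run k) ord0 l]))/=.
apply: lerD.
  apply: (@le_trans _ _ (\sum_(k < K | keep k) (segment_energy (mu k) (A' k) (B' k) +
     Tm `^ (d%:R)^-1 * (2 * \sum_l (B k l - A k l))))).
    by apply: ler_sum => k /andP[pk _]; exact: E_keep.
  rewrite big_split /= /V -!mulr_sumr; apply: lerD.
    rewrite /L big_filter -[X in iota 0 X]subn0 -/(index_iota 0 K) big_mkord.
    by [].
  apply: ler_wpM2l; first exact: powR_ge0.
  apply: ler_wpM2l; first by [].
  exact: sum_side_le.
pose F k r l := if Q r l k then M1 * Wd k l else 0.
have F0 k r l : present k -> 0 <= F k r l.
  by move=> pk; rewrite /F; case: ifP => // _; rewrite mulr_ge0// Wd0.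
apply: (@le_trans _ _ (\sum_(k < K | present k) \sum_(r < J) \sum_l F k r l)).
  apply: (@le_trans _ _ (\sum_(k < K | present k && ~~ [forall l, hi k ord0 l + 3 * s
      <= top (run k) ord0 l])
     \sum_(r < J) \sum_l F k r l)).
    apply: ler_sum => k /andP[pk]; rewrite negb_forall => /existsP[l]; rewrite -ltNge => hl.
    have rJ : (run k < J)%N by have [i [_ <- _]] := loP k pk; exact: run_ltJ.
    rewrite (bigD1 (Ordinal rJ))//= (bigD1 l)//= -addrA.
    rewrite {1}/F /Q eqxx hl /=; apply: le_trans (E_Wd k l pk) _; rewrite lerDl.
    by rewrite addr_ge0 ?sumr_ge0// => [l' _|r' _]; rewrite ?sumr_ge0// => *; exact: F0.
  rewrite [leRHS](bigID (fun k : 'I_K => [forall l, hi k ord0 l + 3 * s <= top (run k)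
      ord0 l]))/= lerDr.
  by apply: sumr_ge0 => k /andP[pk _]; apply: sumr_ge0 => r _; apply: sumr_ge0 => l _;
      exact: F0.
rewrite exchange_big /=.
apply: (@le_trans _ _ (\sum_(r < J) \sum_(l < d) M1 * (Lam ^+ d.-1 * (5 * s) + d%:R *
    (D + 2) / Lam))).
  apply: ler_sum => r _; rewrite exchange_big /=; apply: ler_sum => l _.
  by rewrite /F -big_mkcondr /=; exact: drop_sum.
by rewrite !sumr_const !card_ord [leRHS]mulr_natl [X in _ <= X *+ _]mulr_natl.
Qed.

End ChainDecomposition.

(** * The limsup *)

Section Support.
Context {R : realType} {d : nat} {dT : measure_display} {T : measurableType dT}.
Variables (P : probability T R) (X : nat -> T -> 'rV[R]_d) (f : 'rV[R]_d -> R).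
Hypothesis hX : iid_density P X f.
Variables (Om : set 'rV[R]_d) (D : R).
Hypothesis f_ge0 : forall x, 0 <= f x.
Hypothesis f_out : forall x, ~ Om x -> f x = 0.
Hypothesis D_gt0 : 0 < D.
Hypothesis f_mass : box_integral (fun x => (f x)%:E) (const_mx 0) (const_mx D) = 1%E.

(* A point outside [closure Om] lies in a grid cell missing [Om]; there are
   countably many cells, and each such cell has mass zero. *)
Lemma ae_in_closure : {ae P, forall w, forall i, closure Om (X i w)}.
Proof.
apply: ae_foralln => i.
pose a : 'rV[R]_d := const_mx 0; pose b : 'rV[R]_d := const_mx (D + 1).
have ab l : a ord0 l < b ord0 l by rewrite !mxE ltr_wpDl// ltW.
have mB u v : measurable [set w | in_box u v (X i w)].
  by apply: measurable_in_box; exact: hX.1.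
pose box m (c : cell (d := d) m) := [set y | in_box (cell_lo a b c) (cell_hi a b c) y].
pose N m := \big[setU/set0]_(c : cell (d := d) m | `[< Om `&` box m c = set0 >])
   [set w | box m c (X i w)].
have mN m : measurable (N m) by apply: bigsetU_measurable => c _; exact: mB.
have N0 m : P (N m) = 0%E.
  rewrite PrE//; congr EFin; apply/eqP; rewrite eq_le Pr_ge0 andbT.
  apply: (le_trans (Pr_bigcup_le _ _ _)) => [c _|]; first exact: mB.
  apply: sumr_le0 => c /asboolP Oc.
  have lc : leqv (cell_lo a b c) (cell_hi a b c).
    by apply/forallP => l; rewrite !mxE ler_grid// leqnSn.
  apply: le_trans (Pr_in_box_le hX i (lexx 0) lc f_ge0 _) _; last by rewrite mul0r.
  move=> x xc; rewrite f_out// => Ox.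
  by have : (Om `&` box m c) x by []; rewrite Oc.
pose big := [set w | in_box (const_mx 0) (const_mx D) (X i w)].
have bigN : P.-negligible (~` big).
  apply: (negligibleP P (measurableC (mB _ _))).2.
  apply: (etrans (@probability_setC _ _ _ P _ (mB _ _))).
  rewrite hX.2.2 ?f_mass ?subee//.
  by apply/forallP => l; rewrite !mxE ltW.
have NN : P.-negligible (\bigcup_m N m).
  by apply: negligible_bigcup => m; apply: (negligibleP P (mN m)).2; exact: N0.
apply: negligibleS (negligibleU bigN NN) => w /= nw.
have [Bw|nB] := pselect (big w); last by left.
right; have : ~ closure Om (X i w) by [].
move=> /existsNP[B /not_implyP[/nbhs_ballP[e /= e0 eB] /set0P/negP]].
rewrite negbK => /eqP OB.
pose m := Num.truncn ((D + 1) / e).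
have me : (D + 1) / m.+1%:R < e.
  have De : 0 <= (D + 1) / e by rewrite divr_ge0 ?addr_ge0// ltW.
  have /andP[_] := truncn_itv De; rewrite -/m ltr_pdivrMr// => h.
  by rewrite ltr_pdivrMr// mulrC.
have [l|c /(cell_ofP ab) cX] := cell_of_ex m ab (x := X i w).
  by have := Bw l; rewrite !mxE => /andP[-> /le_lt_trans]; apply; rewrite ltrDl.
have cXb : box m c (X i w).
  by move=> l; rewrite !mxE; have /forallP/(_ l)/andP[-> /ltW] := cX.
exists m => //; rewrite /N -bigcup_seq_cond; exists c => //=.
rewrite mem_index_enum /=; apply/asboolP; apply/seteqP; split=> // y [Oy cy].
suff : (Om `&` B) y by rewrite OB.
split=> //; apply: eB; split=> // j l; have -> : j = ord0 by rewrite (ord1 j).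
rewrite /ball /=.
have := cy l; have := cXb l; rewrite !mxE => /andP[x1 x2] /andP[y1 y2].
have := grid_step a b m l (c l); rewrite !mxE subr0 => gs.
rewrite -gs in me; rewrite ltr_norml; apply/andP; split; lra.
Qed.

End Support.

Lemma limn_esup_le_near (R : realType) (u : nat -> \bar R) (C : \bar R) :
  (exists n0, forall n, (n0 <= n)%N -> (u n <= C)%E) -> (limn_esup u <= C)%E.
Proof.
move=> [n0 H]; apply: (@le_trans _ _ (ereal_sup (u @` [set n | (n0 <= n)%N]))).
  by apply: ereal_inf_lbound; exists [set n | (n0 <= n)%N] => //; exists n0.
by apply: ge_ereal_sup => _ [n nn0 <-]; exact: H.
Qed.

Lemma modulus_small (R : realType) (m : R -> R) (e : R) :
  {within [set r : R | 0 <= r], continuous m} -> m 0 = 0 ->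
  (forall r s : R, 0 <= r -> r <= s -> m r <= m s) -> 0 < e ->
  exists2 t, 0 < t & m t <= e.
Proof.
move=> mc m0 mn e0.
have mc0 : m @ within [set r : R | 0 <= r] (nbhs (0 : R)) --> (0 : R).
  by rewrite -[X in _ --> X]m0; move/subspace_continuousP: mc; apply; exact: lexx.
move/cvgrPdist_le: mc0 => /(_ e e0).
rewrite near_withinE => /nbhs_ballP[t /= t0 H]; exists (t / 2); first by rewrite divr_gt0.
have t2 : 0 <= t / 2 by rewrite divr_ge0// ltW.
have := H (t / 2); rewrite /ball /= sub0r normrN ger0_norm// sub0r normrN => H'.
apply: le_trans (ler_norm _) (H' _ t2); rewrite ltr_pdivrMr//.
by rewrite mulr_natr mulr2n ltrDl.
Qed.

Section ChainBound.
Context {R : realType} {d : nat}.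
Hypothesis d_gt0 : (0 < d)%N.
Variables (Om : set 'rV[R]_d) (f : 'rV[R]_d -> R) (m : R -> R).
Hypothesis f_ge0 : forall x, 0 <= f x.
Hypothesis m_cont : {within [set r : R | 0 <= r], continuous m}.
Hypothesis m0 : m 0 = 0.
Hypothesis m_ndecr : forall r s : R, 0 <= r -> r <= s -> m r <= m s.
Hypothesis m_ge0 : forall r : R, 0 <= r -> 0 <= m r.
Hypothesis f_mod : forall x y, Om x -> Om y -> `|f x - f y| <= m (enorm (x - y)).
Hypothesis f_out : forall x, ~ Om x -> f x = 0.
Variables (D M1 : R).
Hypothesis D_ge0 : 0 <= D.
Hypothesis f_le : forall x, f x + 1 <= M1.
Hypothesis OmD : forall x, closure Om x -> forall i, 0 <= x ord0 i <= D.
Variable dl : R.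
Hypothesis dl01 : 0 < dl <= 1.
Hypothesis cone : forall x, closure Om x -> exists nu, inward_direction Om dl x nu.

(** The grid parameters are fixed before [n] and the points, which is what leaves finitely many
    boxes to be controlled almost surely. *)
Lemma u_n_le_box_chains (z : 'rV[R]_d) (eps : R) : 0 < eps ->
  exists (eta s e' : R), [/\ 0 < eta, 0 < e' <= 1, 0 < s <= 1, M1 * s <= 1 &
  forall n (pts : nat -> 'rV[R]_d), (forall i, closure Om (pts i)) ->
  exists (K : nat) (V : R) (pr : pred nat) (u v : nat -> 'rV[R]_d),
  [/\ (V%:E <= U_fun f z)%E,
   (u_n n pts z <= \sum_(k < K | pr k) longest_chain n pts (in_hbox (u k) (v k)))%N,
   forall k, pr k -> exists gu gv : 'I_d -> nat, forall l,
     [/\ u k ord0 l = eta * (gu l)%:R, v k ord0 l = eta * (gv l)%:R,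
         (gu l < gv l <= (Num.truncn (D / eta)).+1)%N & v k ord0 l - u k ord0 l <= s] &
   \sum_(k < K | pr k) (box_sup f e' (u k) (v k) * \prod_l (v k ord0 l - u k ord0 l))
       `^ (d%:R)^-1
   <= V + eps]].
Proof.
move=> eps0.
have dl0 : 0 < dl by case/andP: dl01.
have M10 : 0 < M1 by have := f_le 0; have := f_ge0 0; lra.
have dR : 0 < d%:R :> R by rewrite ltr0n.
pose G := 2 * (d%:R * (D + 2)).
have D2 : 0 < D + 2 by have := D_ge0; lra.
have G0 : 0 < G by rewrite !mulr_gt0.
(* Its [d]-th root times [G] is [eps / 2], the share of the modulus error; [e'] and the modulus at
   [t] take half of [gam] each. *)
pose gam := (eps / (2 * G)) ^+ d.
have gam0 : 0 < gam by rewrite exprn_gt0// divr_gt0// mulr_gt0.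
have gam2 : 0 < gam / 2 by rewrite divr_gt0.
have [t t0 mt] := modulus_small m_cont m0 m_ndecr gam2.
pose e' := Num.min 1 (gam / 2).
have e'0 : 0 < e' by rewrite lt_min ltr01 gam2.
have e'1 : e' <= 1 by rewrite ge_min lexx.
have e'g : e' <= gam / 2 by rewrite ge_min lexx orbT.
pose J : R := (Num.truncn (2 * d%:R * D / dl)).+1%:R.
have J0 : 0 < J by rewrite ltr0n.
pose Jc := J * (d%:R * M1).
have Jc0 : 0 < Jc by rewrite !mulr_gt0.
(* The dropped boxes may cost [eps / 2]: this [Lam] bounds the part divided by [Lam] by [eps / 4],
   and afterwards [s] is taken so small that the part with [Lam ^+ d.-1] is at most [eps / 4]. *)
pose Lam := 4 * Jc * (d%:R * (D + 2)) / eps.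
have Lam0 : 0 < Lam by rewrite divr_gt0// !mulr_gt0.
have LamE : 4 * (Jc * (d%:R * (D + 2) / Lam)) = eps.
  by rewrite /Lam; field; rewrite !gt_eqF.
have LP0 : 0 < Lam ^+ d.-1 by rewrite exprn_gt0.
pose s := Num.min (Num.min (dl / 2) (t / (4 * d%:R))) (Num.min (eps / (20 * Jc * Lam ^+
    d.-1)) M1^-1).
have s0 : 0 < s by rewrite !lt_min !divr_gt0 ?invr_gt0 ?mulr_gt0.
have s_dl : s <= dl / 2 by rewrite !ge_min lexx.
have s_t : 4 * d%:R * s <= t.
  by rewrite mulrC -ler_pdivlMr ?mulr_gt0// !ge_min lexx ?orbT.
have s_J : 20 * Jc * Lam ^+ d.-1 * s <= eps.
  by rewrite mulrC -ler_pdivlMr ?mulr_gt0// !ge_min lexx ?orbT.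
have s_M : M1 * s <= 1.
  by rewrite mulrC -ler_pdivlMr// mul1r !ge_min lexx ?orbT.
have s1 : s <= 1 by case/andP: dl01; lra.
(* Large enough that the bin width [dl / (2 * W)] is at most [dl * s / 4]. *)
pose W := (Num.truncn (2 / s)).+1.
have W_s : 2 <= W%:R * s.
  have h : 0 <= 2 / s by rewrite divr_ge0// ltW.
  by rewrite -ler_pdivrMr//; have /andP[_ /ltW] := truncn_itv h.
have W0 : 0 < W%:R :> R by rewrite ltr0n.
have h_s : dl / (2 * W%:R) <= dl * s / 4.
  rewrite ler_pdivrMr ?mulr_gt0//; have -> : dl * s / 4 * (2 * W%:R) = dl * (W%:R * s)
      / 2 by field.
  by rewrite ler_pdivlMr// ler_pM2l.
set K := (Num.truncn (d%:R * D / (dl / (2 * W%:R)))).+1.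
pose eta := dl * s / (8 * (K%:R + 2)).
have K2 : 0 < K%:R + 2 :> R by rewrite addr_gt0// ltr0n.
have eta0 : 0 < eta by rewrite divr_gt0 ?mulr_gt0.
have eta_s : 2 * eta * (K%:R + 2) <= dl * s / 4.
  by rewrite le_eqVlt /eta; apply/orP; left; apply/eqP; field; rewrite gt_eqF.
exists eta, s, e'; split; rewrite ?e'0 ?s0 ?s_M//.
move=> n pts cl.
have [S [SA SC SI kS]] := longest_chain_witness (leqnn (u_n n pts z)).
have s_dl' : 0 < s < dl by rewrite s0; lra.
have e'01 : 0 < e' <= 1 by rewrite e'0.
have [V [pr [u [v [VU cS grd sm]]]]] := chain_decomposition d_gt0 f_ge0 m_ndecr m_ge0
    f_mod f_out
  D_ge0 f_le OmD dl01 cone s_dl' e'01 (ltn0Sn _ : (0 < W)%N) h_s eta0 eta_s (fun i =>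
      cl i) SA SC SI Lam0.
exists K, V, pr, u, v; split=> //; first exact: leq_trans cS.
apply: (le_trans sm); rewrite -addrA lerD2l.
have ms : m (4 * d%:R * s) <= gam / 2.
  by apply: le_trans mt; apply: m_ndecr => //; rewrite !mulr_ge0// ltW.
have ms0 : 0 <= m (4 * d%:R * s) by apply: m_ge0; rewrite !mulr_ge0// ltW.
have h1 : (m (4 * d%:R * s) + e') `^ (d%:R)^-1 <= eps / (2 * G).
  have eG : 0 <= eps / (2 * G) by rewrite divr_ge0 ?mulr_ge0// ltW.
  rewrite -[leRHS](powR_exprn_inv d_gt0 eG) -/gam.
  apply: ge0_ler_powR; rewrite ?invr_ge0 ?nnegrE ?(ltW gam0) ?addr_ge0 ?(ltW e'0)//.
  by lra.
have h2 : (m (4 * d%:R * s) + e') `^ (d%:R)^-1 * G <= eps / 2.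
  rewrite -ler_pdivlMr//; apply: (le_trans h1); rewrite le_eqVlt; apply/orP; left;
      apply/eqP.
  by field; rewrite gt_eqF.
have -> : eps = eps / 2 + eps / 2 by rewrite -splitr.
apply: lerD; first exact: h2.
rewrite -/J; have -> : J * (d%:R * (M1 * (Lam ^+ d.-1 * (5 * s) + d%:R * (D + 2) / Lam))) =
   (20 * Jc * Lam ^+ d.-1 * s) / 4 + Jc * (d%:R * (D + 2) / Lam).
  by rewrite /Jc; move: (Lam ^+ d.-1) => L; field; rewrite gt_eqF.
lra.
Qed.

End ChainBound.

Section BoundedDomain.
Context {R : realType} {d : nat}.

Lemma norm_coord_le (x : 'rV[R]_d) i : `|x ord0 i| <= `|x|.
Proof.
rewrite [leRHS]/Num.Def.normr /= mx_normrE; apply/bigmax_geP; right.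
by exists (ord0, i).
Qed.

Lemma closure_coord_itv (Om : set 'rV[R]_d) (D : R) :
  (forall x, Om x -> forall i, 0 <= x ord0 i <= D) ->
  forall x, closure Om x -> forall i, 0 <= x ord0 i <= D.
Proof.
move=> OD x cx i; have ci : (fun y : 'rV[R]_d => y ord0 i) @ x --> x ord0 i.
  exact: coord_continuous.
rewrite !leNgt; apply/andP; split; apply/negP => xi.
  have [y [Oy /= yi]] : Om `&` [set y | y ord0 i < 0] !=set0.
    by apply: cx; exact: (cvgr_lt (x ord0 i) ci).
  by have /andP[] := OD y Oy i; rewrite leNgt yi.
have [y [Oy /= yi]] : Om `&` [set y | D < y ord0 i] !=set0.
  by apply: cx; exact: (cvgr_gt (x ord0 i) ci).
by have /andP[_] := OD y Oy i; rewrite leNgt yi.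
Qed.

End BoundedDomain.

Section LimsupBound.
Context {R : realType} {d : nat}.
Hypothesis d_gt0 : (0 < d)%N.

Lemma near_all_fin (T : Type) (F : set_system T) (I : finType) (Q : I -> T -> nat -> Prop) :
  Filter F ->
  (forall i, \forall w \near F, exists n0, forall n, (n0 <= n)%N -> Q i w n) ->
  \forall w \near F, exists n0, forall n, (n0 <= n)%N -> forall i, Q i w n.
Proof.
move=> FF H; have := filter_forall FF H; apply: filterS => w /choice[n0 Hn].
exists (\max_i n0 i)%N => n nn i; apply: Hn; apply: leq_trans nn.
exact: (leq_bigmax i).
Qed.

Variables (Om : set 'rV[R]_d) (f : 'rV[R]_d -> R) (m : R -> R) (D M1 dl c : R).
Hypothesis f_ge0 : forall x, 0 <= f x.
Hypothesis m_cont : {within [set r : R | 0 <= r], continuous m}.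
Hypothesis m0 : m 0 = 0.
Hypothesis m_ndecr : forall r s : R, 0 <= r -> r <= s -> m r <= m s.
Hypothesis m_ge0 : forall r : R, 0 <= r -> 0 <= m r.
Hypothesis f_mod : forall x y, Om x -> Om y -> `|f x - f y| <= m (enorm (x - y)).
Hypothesis f_out : forall x, ~ Om x -> f x = 0.
Hypothesis D_gt0 : 0 < D.
Hypothesis f_le : forall x, f x + 1 <= M1.
Hypothesis OmD : forall x, closure Om x -> forall i, 0 <= x ord0 i <= D.
Hypothesis dl01 : 0 < dl <= 1.
Hypothesis cone : forall x, closure Om x -> exists nu, inward_direction Om dl x nu.
Hypothesis hc : is_chain_constant d c.
Hypothesis f_mass : box_integral (fun x => (f x)%:E) (const_mx 0) (const_mx D) = 1%E.
Context {dT : measure_display} {T : measurableType dT}.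
Variables (P : probability T R) (X : nat -> T -> 'rV[R]_d).
Hypothesis hX : iid_density P X f.

(** Only finitely many boxes have their corners on the bounded grid, so one null set and one
    threshold [n0] serve all of them, including boxes chosen depending on the sample and on [n]. *)
Lemma ae_grid_boxes (eta s e' eps : R) (Q : nat) : 0 < eta -> 0 < e' <= 1 ->
  0 < s <= 1 -> M1 * s <= 1 -> 0 < eps ->
  {ae P, forall w, exists n0, forall n, (n0 <= n)%N ->
    forall (u v : 'rV[R]_d) (gu gv : 'I_d -> nat),
    (forall l, [/\ u ord0 l = eta * (gu l)%:R, v ord0 l = eta * (gv l)%:R,
         (gu l < gv l <= Q)%N & v ord0 l - u ord0 l <= s]) ->
    (longest_chain n (fun i => X i w) (in_hbox u v))%:R <=
    (c + eps) * ((box_sup f e' u v * \prod_l (v ord0 l - u ord0 l)) `^ (d%:R)^-1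
                 * n%:R `^ (d%:R)^-1)}.
Proof.
move=> eta0 e'01 /andP[s0 s1] Ms eps0.
have l0 : 'I_d := Ordinal d_gt0.
have f_leM x : f x <= M1 by have := f_le x; lra.
have hY := iid_uniformized hX l0 f_ge0 f_leM D_gt0 f_mass.
pose I := ({ffun 'I_d -> 'I_Q.+1} * {ffun 'I_d -> 'I_Q.+1})%type.
pose g (a : {ffun 'I_d -> 'I_Q.+1}) : 'rV[R]_d := \row_l (eta * (a l : nat)%:R).
pose good (i : I) := [forall l, (i.1 l < i.2 l)%N && (g i.2 ord0 l - g i.1 ord0 l <= s)].
pose bound (i : I) w n := good i ->
  (longest_chain n (fun j => X j w) (in_hbox (g i.1) (g i.2)))%:R <=
    (c + eps) * ((box_sup f e' (g i.1) (g i.2) * \prod_l (g i.2 ord0 l - g i.1 ord0 l))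
        `^ (d%:R)^-1
                 * n%:R `^ (d%:R)^-1).
have H : \forall w \near (almost_everywhere P), exists n0, forall n, (n0 <= n)%N ->
    forall i : I, bound i w n.
  apply: near_all_fin => i; have [/forallP gi|/negP ngi] := boolP (good i); last first.
    by apply: nearW => w; exists 0%N => n _ /ngi.
  have ab l : g i.1 ord0 l < g i.2 ord0 l.
    by have /andP[h _] := gi l; rewrite !mxE ltr_pM2l// ltr_nat.
  have uv : leqv (g i.1) (g i.2) by apply/forallP => l; exact: ltW.
  have M10 : 0 < M1 by have := f_le 0; have := f_ge0 0; lra.
  have bs0 := box_sup_gt0 f_ge0 f_le e'01 uv.
  (* This product is the thinning probability. All sides are at most 1 and one of them is at most
     [s], so [M1 * s] bounds it. *)
  have p1 : box_sup f e' (g i.1) (g i.2) * \prod_l (g i.2 ord0 l - g i.1 ord0 l) <= 1.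
    apply: le_trans Ms; apply: ler_pM.
    - exact: ltW bs0.
    - by apply: prodr_ge0 => l _; rewrite subr_ge0 ltW.
    - by have := box_sup_leM f_le e'01 uv.
    - rewrite (bigD1 l0)//= -[leRHS]mulr1; apply: ler_pM.
      + by rewrite subr_ge0 ltW.
      + by apply: prodr_ge0 => l _; rewrite subr_ge0 ltW.
      + by have /andP[] := gi l0.
      + apply: (@le_trans _ _ (\prod_(l < d | l != l0) 1)); last by rewrite big1.
        apply: ler_prod => l _; rewrite subr_ge0 ltW//=.
        by have /andP[_ h] := gi l; exact: le_trans h s1.
  have := box_chain_upper_bound d_gt0 hX hY f_ge0 f_leM hc ab
    (box_sup_gt0 f_ge0 f_le e'01 uv) (fun x => box_sup_ge f_le e'01 (y := x)) p1 eps0.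
  by apply: filterS => w [n0 Hn0]; exists n0 => n nn _; exact: Hn0.
apply: filterS H => w [n0 Hn0]; exists n0 => n nn u v gu gv uvP.
have guQ l : (gu l < Q.+1)%N.
  have [_ _ /andP[h1 h2] _] := uvP l; by rewrite ltnS ltnW// (leq_trans h1).
have gvQ l : (gv l < Q.+1)%N by have [_ _ /andP[h1 h2] _] := uvP l.
have uE : u = g [ffun l => Ordinal (guQ l)].
  by apply/rowP => l; rewrite !mxE ffunE /=; have [] := uvP l.
have vE : v = g [ffun l => Ordinal (gvQ l)].
  by apply/rowP => l; rewrite !mxE ffunE /=; have [] := uvP l.
rewrite uE vE; apply: (Hn0 n nn ([ffun l => Ordinal (guQ l)], [ffun l => Ordinal (gvQ l)])).
apply/forallP => l; rewrite -uE -vE !ffunE /=.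
by have [_ _ /andP[-> _] ->] := uvP l.
Qed.

Lemma ae_u_n_le (z : 'rV[R]_d) (Uz e : R) : U_fun f z = Uz%:E -> 0 <= Uz -> 0 < e ->
  {ae P, forall w, exists n0, forall n, (n0 <= n)%N ->
    n%:R `^ (- (d%:R)^-1) * (u_n n (fun i => X i w) z)%:R <= c * Uz + e}.
Proof.
move=> UE U0 e0; have c0 : 0 < c by case: hc.
(* Both errors in [(c + eps') * (Uz + eps)] are at most [e / 2]: [c * eps] by this choice, and
   [eps' * (Uz + eps)] by the choice of [eps']. *)
pose eps := e / (2 * (c + 1)).
have c1 : 0 < c + 1 by rewrite addr_gt0.
have eps0 : 0 < eps by rewrite divr_gt0// mulr_gt0.
have epsE : 2 * (c + 1) * eps = e by rewrite /eps; field; rewrite gt_eqF.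
pose eps' := e / (2 * (Uz + eps)).
have Ue0 : 0 < Uz + eps by rewrite ltr_wpDl.
have eps'0 : 0 < eps' by rewrite divr_gt0// mulr_gt0.
have eps'E : 2 * (eps' * (Uz + eps)) = e by rewrite /eps'; field; rewrite gt_eqF.
have total : (c + eps') * (Uz + eps) <= c * Uz + e by rewrite mulrDl; lra.
have [eta [s [e' [eta0 e'01 s01 Ms H]]]] := u_n_le_box_chains d_gt0 f_ge0 m_cont m0
    m_ndecr m_ge0
  f_mod f_out (ltW D_gt0) f_le OmD dl01 cone z eps0.
have aeX := ae_in_closure hX f_ge0 f_out D_gt0 f_mass.
have aeB := ae_grid_boxes (Num.truncn (D / eta)).+1 eta0 e'01 s01 Ms eps'0.
apply: filterS2 aeX aeB => w cl [n0 Hn0].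
exists (maxn n0 1) => n; rewrite geq_max => /andP[n0n n1].
have [K [V [pr [u [v [VU uS grd sm]]]]]] := H n (fun i => X i w) cl.
have V_le : V <= Uz by move: VU; rewrite UE lee_fin.
have n0' : 0 < n%:R :> R by rewrite ltr0n.
rewrite powRN mulrC ler_pdivrMr ?powR_gt0//.
apply: (@le_trans _ _ ((c + eps') * (Uz + eps) * n%:R `^ (d%:R)^-1)); last first.
  by rewrite ler_wpM2r ?powR_ge0.
apply: (@le_trans _ _ (\sum_(k < K | pr k) (longest_chain n (fun i => X i w) (in_hbox
    (u k) (v k)))%:R)).
  by rewrite -natr_sum ler_nat.
apply: (@le_trans _ _ (\sum_(k < K | pr k) (c + eps') *
    ((box_sup f e' (u k) (v k) * \prod_l (v k ord0 l - u k ord0 l)) `^ (d%:R)^-1 * n%:R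
        `^ (d%:R)^-1))).
  by apply: ler_sum => k pk; have [gu [gv gP]] := grd k pk; exact: Hn0 gP.
rewrite -mulr_sumr -mulr_suml mulrA; apply: ler_wpM2r; first exact: powR_ge0.
apply: ler_wpM2l; first by rewrite addr_ge0 ?ltW.
by apply: (le_trans sm); rewrite lerD2r.
Qed.

End LimsupBound.

Theorem theorem3p5 (R : realType) (d : nat) (hd : (2 <= d)%N)
  (Om : set 'rV[R]_d)
  (Om_open : open Om) (Om_bdd : bounded_set Om)
  (Om_pos : forall x, Om x -> forall i, 0 < x ord0 i)
  (Om_lip : lipschitz_boundary Om)
  (f : 'rV[R]_d -> R) (f_ge0 : forall x, 0 <= f x)
  (f_prob : forall a b : 'rV[R]_d, Om `<=` in_box a b ->
            box_integral (fun x => (f x)%:E) a b = 1%E)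
  (m : R -> R)
  (m_cont : {within [set r : R | 0 <= r], continuous m})
  (m_ndecr : forall r s : R, 0 <= r -> r <= s -> m r <= m s)
  (m_ge0 : forall r : R, 0 <= r -> 0 <= m r)
  (m0 : m 0 = 0)
  (f_mod : forall x y, Om x -> Om y -> `|f x - f y| <= m (enorm (x - y)))
  (f_out : forall x, ~ Om x -> f x = 0)
  (c : R) (hc : is_chain_constant d c)
  (dT : measure_display) (T : measurableType dT) (P : probability T R)
  (X : nat -> T -> 'rV[R]_d) (hX : iid_density P X f)
  (z : 'rV[R]_d) :
  {ae P, forall w,
     (limn_esup (fun n : nat =>
        (n%:R `^ (- (d%:R)^-1) * (u_n n (fun i => X i w) z)%:R)%:E)
      <= c%:E * U_fun f z)%E}.
Proof.
have d_gt0 : (0 < d)%N by exact: ltnW.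
pose l0 : 'I_d := Ordinal d_gt0.
have [Mb [Mbr Om_le]] := Om_bdd.
pose D := Num.max 0 Mb + 1.
have D_gt0 : 0 < D by rewrite ltr_wpDl// le_max lexx.
have OD x : Om x -> forall i, 0 <= x ord0 i <= D.
  move=> Ox i; rewrite ltW ?Om_pos//=.
  apply: le_trans (ler_norm _) (le_trans (norm_coord_le x i) _).
  by apply: Om_le => //; rewrite /D ltr_pwDr// le_max lexx orbT.
have f_mass : box_integral (fun x => (f x)%:E) (const_mx 0) (const_mx D) = 1%E.
  by apply: f_prob => x Ox i; rewrite !mxE OD.
have [M1 f_le] : exists M1, forall x, f x + 1 <= M1.
  have [[x0 Ox0]|nO] := pselect (exists x, Om x); last first.
    by exists 1 => x; rewrite f_out ?add0r// => Ox; apply: nO; exists x.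
  exists (f x0 + m (d%:R * D) + 1) => x; rewrite lerD2r.
  have mD : 0 <= m (d%:R * D) by rewrite m_ge0// mulr_ge0// ltW.
  have [Ox|/f_out->] := pselect (Om x); last by rewrite addr_ge0.
  have := f_mod x x0 Ox Ox0; rewrite ler_norml => /andP[_]; rewrite lerBlDl => /le_trans;
      apply.
  rewrite lerD2l; apply: m_ndecr; first exact: sqrtr_ge0.
  apply: enorm_le => i; rewrite !mxE ler_norml.
  by have /andP[? ?] := OD x Ox i; have /andP[? ?] := OD x0 Ox0 i; apply/andP; split; lra.
have OmD := closure_coord_itv OD.
have [dl [dl01 cone]] := uniform_inward_direction d_gt0 Om_open Om_bdd Om_lip.
(* The empty family of segments still yields an admissible curve ending at [z], so the supremum is
   not over an empty set, wherever [z] lies. *)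
have U0 : (0 <= U_fun f z)%E.
  have := @U_fun_ge_segments R d d_gt0 f z [::] (fun=> 0) (fun=> 0) (fun=> 0) 1 f_ge0
      ltr01 erefl.
  by rewrite big_nil; apply.
have c0 : 0 < c by case: hc.
case UE: (U_fun f z) U0 => [Uz| |] //; last by move=> _; apply: nearW => w;
    rewrite gt0_muley// leey.
rewrite lee_fin => Uz0.
(* Countably many tolerances, so that a single null set suffices for all [e]. *)
have : {ae P, forall w, forall j : nat, exists n0, forall n, (n0 <= n)%N ->
    n%:R `^ (- (d%:R)^-1) * (u_n n (fun i => X i w) z)%:R <= c * Uz + j.+1%:R^-1}.
  apply: ae_foralln => j.
  exact: (ae_u_n_le d_gt0 f_ge0 m_cont m0 m_ndecr m_ge0 f_mod f_out D_gt0 f_le OmD dl01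
      cone hc f_mass hX UE Uz0).
apply: filterS => w H; rewrite -EFinM; apply/lee_addgt0Pr => e e0.
have [j je] : exists j : nat, j.+1%:R^-1 <= e.
  exists (Num.truncn e^-1); rewrite invf_ple ?posrE// ltW//.
  have : 0 <= e^-1 by rewrite invr_ge0 ltW.
  by move=> /truncn_itv/andP[].
have [n0 Hn0] := H j; apply: limn_esup_le_near; exists n0 => n nn.
by rewrite -EFinD lee_fin (le_trans (Hn0 n nn))// lerD2l.
Qed.
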